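(* Fix $U,a,b>0$. For each $n\in\mathbb{N}$ let $r=r(n)\in\mathbb{N}$ and let $\boldsymbol{y}=(y_{ij})_{1\le i\le n,\,1\le j\le r(n)}$ be real data, with $\bar y_i=\frac1r\sum_{j=1}^r y_{ij}$ and $\bar y=\frac{1}{nr}\sum_{i=1}^n\sum_{j=1}^r y_{ij}$. Let $\rho_*(n,r(n),\boldsymbol{y},U,a,b)$ denote the geometric convergence rate (in total variation) of the Markov chain $\{\boldsymbol{\eta}_m\}_{m=0}^\infty$ on $\mathbb{R}^{n+1}$ with Markov transition density $k(\boldsymbol{\eta}'\mid\boldsymbol{\eta})=\int_0^\infty \pi(\boldsymbol{\eta}'\mid B,\boldsymbol{y})\,\pi(B\mid\boldsymbol{\eta},\boldsymbol{y})\,dB$. Assume that (A1) $\dfrac{r(n)^2}{n^3}\to\infty$ as $n\to\infty$; and (A2) there is a constant $C<\infty$ such that, for all large $n$, $n^{-1}\sum_{i=1}^n(\bar y_i-\bar y)^2<C$. Then $\rho_*(n,r(n),\boldsymbol{y},U,a,b)\to 0$ as $n\to\infty$.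
   Context: Model. $y_{ij}=\theta_i+e_{ij}$, $i=1,\dots,n$, $j=1,\dots,r$, where the $\theta_i$ are iid $\mathrm{N}(\mu,A)$, the $e_{ij}$ are iid $\mathrm{N}(0,V)$ independent of the $\theta_i$, and $V>0$ is known. The prior is $\pi(\mu)\propto 1$ (flat on $\mathbb{R}$) and, independently, $A\sim\mathrm{IG}(a,b)$ with $a,b>0$, i.e. density proportional to $x^{-a-1}e^{-b/x}$ on $(0,\infty)$. Put $\eta_0=\sqrt n\,\mu$, $\eta_i=\theta_i-\mu$ for $i=1,\dots,n$, $B=1/A$, $U=1/V$, and $\boldsymbol{\eta}=(\eta_0,\dots,\eta_n)^T$. The posterior density of $(\boldsymbol{\eta},B)$ on $\mathbb{R}^{n+1}\times(0,\infty)$ is $$\pi(\boldsymbol{\eta},B\mid\boldsymbol{y})\propto B^{a+\frac n2-1}\exp\Big\{-\frac U2\sum_{i=1}^n\sum_{j=1}^r\Big(y_{ij}-\frac{\eta_0}{\sqrt n}-\eta_i\Big)^2-B\Big(b+\frac12\sum_{i=1}^n\eta_i^2\Big)\Big\}.$$ The conditional densities $\pi(\boldsymbol{\eta}\mid B,\boldsymbol{y})$ and $\pi(B\mid\boldsymbol{\eta},\boldsymbol{y})$ are as follows. Given $(B,\boldsymbol{y})$, $\eta_0\sim \mathrm{N}\big(\sqrt n\,\bar y,\ \frac{B+rU}{rBU}\big)$, and given $(\eta_0,B,\boldsymbol{y})$ the variables $\eta_1,\dots,\eta_n$ are independent with $\eta_i\sim\mathrm{N}\big(\frac{rU}{B+rU}(\bar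 y_i-\frac{\eta_0}{\sqrt n}),\ \frac{1}{B+rU}\big)$. Also $B\mid\boldsymbol{\eta},\boldsymbol{y}\sim\mathrm{Gamma}\big(a+\frac n2,\ b+\frac12\sum_{i=1}^n\eta_i^2\big)$, in the shape-rate parametrization. (Normal distributions are written as mean, variance.) The chain $\{\boldsymbol{\eta}_m\}$ is the $\boldsymbol{\eta}$-marginal of the two-block Gibbs sampler with blocks $\boldsymbol{\eta}$ and $B$; its stationary distribution $\Pi$ is the marginal posterior of $\boldsymbol{\eta}$. Geometric convergence rate. For a Markov transition kernel $K$ on $\mathsf{X}\subset\mathbb{R}^q$ with stationary distribution $\Pi$, let $K_x^m(\cdot)$ be the $m$-step transition kernel started at $x$, and let $d_{TV}(\mu,\nu)=\sup_{A}[\mu(A)-\nu(A)]$ (supremum over Borel sets). The geometric convergence rate $\rho_*$ is the infimum of all $\rho\in[0,1]$ for which there exists a function $M:\mathsf{X}\to[0,\infty)$ such that $d_{TV}(K_x^m,\Pi)\le M(x)\rho^m$ for every $x\in\mathsf{X}$ and every $m\in\mathbb{N}=\{1,2,3,\dots\}$. *)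

(* Defs.v *)
From HB Require Import structures.
From mathcomp Require Import all_boot all_order all_algebra.
From mathcomp Require Import all_classical all_reals all_analysis.
From mathcomp Require Import measurable_realfun.

Set Implicit Arguments.
Unset Strict Implicit.
Unset Printing Implicit Defensive.

Import Order.TTheory GRing.Theory Num.Theory.
Import numFieldNormedType.Exports.

Local Open Scope classical_set_scope.
Local Open Scope ring_scope.

Section measurability.
Context {R : realType} d (T : measurableType d).

Lemma measurable_invr : measurable_fun [set: R] (@GRing.inv R).
Proof.
rewrite (_ : GRing.inv = fun x : R => if x == 0 then 0 else x^-1); last first.
  by apply/funext => x; case: eqP => // ->; rewrite invr0.
apply: measurable_fun_if => //.
  exact: measurable_fun_eqr.
apply: (@measurable_funS _ _ _ _ [set x : R | x != 0]).
- exact: open_measurable.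
- by move=> x [_ /= ->].
- apply: open_continuous_measurable_fun => //.
  by apply/in_setP => x /= x0; exact: inv_continuous.
Qed.

Lemma measurable_funVr (f : T -> R) :
  measurable_fun setT f -> measurable_fun setT (fun t => (f t)^-1).
Proof. exact: measurableT_comp measurable_invr. Qed.

Lemma measurable_sqrtr : measurable_fun [set: R] (@Num.sqrt R).
Proof. by apply: continuous_measurable_fun; exact: sqrt_continuous. Qed.

Lemma measurable_normal_pdf3 (m s x : T -> R) :
  measurable_fun setT m -> measurable_fun setT s -> measurable_fun setT x ->
  measurable_fun setT (fun t => normal_pdf (m t) (s t) (x t)).
Proof.
move=> mm ms mx; rewrite /normal_pdf; apply: measurable_fun_ifT.
- exact: measurable_fun_eqr.
- exact: measurableT_comp.
- apply: measurable_funM.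
  + apply: measurable_funVr; apply: (measurableT_comp measurable_sqrtr).
    by apply: measurable_funD; apply: measurable_funM => //;
      exact: measurable_funX.
  + apply: (measurableT_comp (@measurable_expR R)); apply: measurable_funM.
      apply: measurableT_comp => //; apply: measurable_funX.
      exact: measurable_funB.
    by apply: measurable_funVr; apply: measurable_funD; exact: measurable_funX.
Qed.

Lemma measurable_integral_param d' (T' : measurableType d')
    (mu : {sigma_finite_measure set T' -> \bar R}) (D : set T')
    (f : T * T' -> \bar R) :
  measurable D -> measurable_fun setT f -> (forall z, 0 <= f z)%E ->
  measurable_fun setT (fun x => \int[mu]_(y in D) f (x, y))%E.
Proof.
move=> mD mf f0.
rewrite (_ : (fun x => _) =
  fubini_F mu (fun z => f z * (\1_D z.2)%:E)%E); last first.
  by apply/funext => x; rewrite /fubini_F [LHS]integral_mkcond epatch_indic.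
apply: measurable_fun_fubini_tonelli_F.
- apply: emeasurable_funM => //; apply/measurable_EFinP.
  have mD1 : measurable_fun setT (\1_D : T' -> R) by exact: measurable_indic.
  exact: (measurableT_comp mD1 measurable_snd).
- by move=> z; rewrite mule_ge0 // lee_fin.
Qed.

End measurability.

Section cons_measure.
Context {R : realType} d (T : measurableType d) (k : nat).
Variables (mu : {sigma_finite_measure set T -> \bar R})
  (nu : {sigma_finite_measure set (k.-tuple T) -> \bar R}).

Definition cons_pair (z : T * k.-tuple T) : k.+1.-tuple T :=
  [tuple of z.1 :: z.2].

Lemma measurable_cons_pair : measurable_fun setT cons_pair.
Proof. exact: measurable_cons. Qed.

Definition cons_measure : set (k.+1.-tuple T) -> \bar R :=
  pushforward (mu \x nu)%E cons_pair.

Let mcons A : measurable A -> measurable (cons_pair @^-1` A).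
Proof.
by move=> mA; rewrite -[X in measurable X]setTI; exact: measurable_cons_pair.
Qed.

Let cons_measure0 : cons_measure set0 = 0%E.
Proof. by rewrite /cons_measure /pushforward preimage_set0 measure0. Qed.

Let cons_measure_ge0 A : (0 <= cons_measure A)%E.
Proof. by rewrite /cons_measure /pushforward. Qed.

Let cons_measure_sigma_additive : semi_sigma_additive cons_measure.
Proof.
move=> F mF tF mUF; rewrite /cons_measure /pushforward preimage_bigcup.
apply: measure_semi_sigma_additive.
- by move=> i; exact: mcons.
- apply/trivIsetP => /= i j _ _ ij; rewrite -preimage_setI.
  by move/trivIsetP : tF => /(_ _ _ _ _ ij) ->//; rewrite preimage_set0.
- by rewrite -preimage_bigcup; exact: mcons.
Qed.

HB.instance Definition _ := isMeasure.Build _ _ _ cons_measure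
  cons_measure0 cons_measure_ge0 cons_measure_sigma_additive.

Let cons_measure_sigma_finite : sigma_finite setT cons_measure.
Proof.
pose g (t : k.+1.-tuple T) : T * k.-tuple T := (thead t, [tuple of behead t]).
have mg : measurable_fun setT g.
  by apply: measurable_fun_pair; [exact: measurable_tnth
                                 |exact: measurable_behead].
have gK z : g (cons_pair z) = z.
  by case: z => x t; rewrite /g theadE; congr pair; exact/val_inj.
have /sigma_finiteP[F [TF ndF Foo]] := sigma_finiteT mu.
have /sigma_finiteP[G [TG ndG Goo]] := sigma_finiteT nu.
exists (fun i => g @^-1` (F i `*` G i)).
  rewrite -preimage_bigcup [X in _ @^-1` X](_ : _ = setT) ?preimage_setT//.
  rewrite -setXTT TF TG predeqE => -[x t]; split.
    by move=> [i _ []/= ? ?]; split; exists i.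
  move=> [/= [i _ Fix] [j _ Gjt]]; exists (maxn i j) => //; split.
    by move: x Fix; exact/subsetPset/ndF/leq_maxl.
  by move: t Gjt; exact/subsetPset/ndG/leq_maxr.
move=> i; have [mFi Fioo] := Foo i; have [mGi Gioo] := Goo i; split.
  by rewrite -[X in measurable X]setTI; apply: mg => //; exact: measurableX.
rewrite /cons_measure /pushforward -comp_preimage.
rewrite (_ : g \o _ = id) ?preimage_id; last by apply/funext => z; exact: gK.
by rewrite product_measure1E// lte_mul_pinfty// ge0_fin_numE.
Qed.

HB.instance Definition _ := Measure_isSigmaFinite.Build _ _ _ cons_measure
  cons_measure_sigma_finite.

End cons_measure.

(* Lebesgue measure on R^k, carried by [k.-tuple (measurableTypeR R)] with the
   sigma-algebra generated by the coordinates, i.e., the Borel sets of R^k *)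
Fixpoint lebesgue_tuple (R : realType) k :
    {sigma_finite_measure set (k.-tuple (measurableTypeR R)) -> \bar R} :=
  match k with
  | 0 => \d_([tuple])
  | k'.+1 => cons_measure lebesgue_measure (lebesgue_tuple R k')
  end.

Section geometric_convergence_rate.
Context {R : realType} d (X : measurableType d).
Local Open Scope ereal_scope.

Definition tv_dist (mu nu : set X -> \bar R) : \bar R :=
  ereal_sup [set mu A - nu A | A in measurable].

Fixpoint kernel_iter (K : R.-ker X ~> X) (m : nat) (x : X) : set X -> \bar R :=
  match m with
  | 0 => \d_x
  | m'.+1 => fun A => \int[K x]_z kernel_iter K m' z A
  end.

(* [K] is meant to have total mass 1 and stationary distribution [Pi]; then
   rho = 1 is admissible with M = 1, so the infimum is over a nonempty set *)
Definition geometric_rate (K : R.-ker X ~> X) (Pi : probability X R) : R :=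
  inf [set rho : R | (0 <= rho <= 1)%R /\
    exists M : X -> R, (forall x, (0 <= M x)%R) /\
      forall x m, (0 < m)%N ->
        tv_dist (kernel_iter K m x) Pi <= (M x * rho ^+ m)%:E].

End geometric_convergence_rate.

Section gamma_distribution.
Context {R : realType}.

Definition gamma_fun (s : R) : R :=
  \int[lebesgue_measure]_(x in `]0, +oo[) (x `^ (s - 1) * expR (- x)).

(* the density on ]0, +oo[ only, in the shape-rate parametrization *)
Definition gamma_pdf (shape rate x : R) : R :=
  rate `^ shape / gamma_fun shape * x `^ (shape - 1) * expR (- (rate * x)).

Lemma gamma_pdf_ge0 shape rate x : 0 <= gamma_pdf shape rate x.
Proof.
rewrite /gamma_pdf !mulr_ge0 ?powR_ge0 ?expR_ge0// invr_ge0.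
by apply: Rintegral_ge0 => t _; rewrite mulr_ge0 ?powR_ge0 ?expR_ge0.
Qed.

Lemma measurable_gamma_pdf d (T : measurableType d) (shape : R)
    (rate x : T -> R) :
  measurable_fun setT rate -> measurable_fun setT x ->
  measurable_fun setT (fun t => gamma_pdf shape (rate t) (x t)).
Proof.
move=> mrate mx; apply: measurable_funM; last first.
  apply: (measurableT_comp (@measurable_expR R)); apply: measurableT_comp => //.
  exact: measurable_funM.
apply: measurable_funM; last first.
  exact: (measurableT_comp (@measurable_powR R (shape - 1)) mx).
apply: measurable_funM => //.
exact: (measurableT_comp (@measurable_powR R shape) mrate).
Qed.

End gamma_distribution.

HB.instance Definition _ d1 d2 (T1 : measurableType d1) (T2 : measurableType d2)
  := isMeasurableFun.Build _ _ (T1 * T2)%type T1 fst measurable_fst.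

Section random_effects_model.
Context {R : realType} {n r : nat}.
Local Notation RT := (measurableTypeR R).
Variables (U a b : R) (y : 'M[R]_(n, r)).
Implicit Types (eta : n.+1.-tuple RT) (B : R).

(* [eta] is (eta_0, eta_1, ..., eta_n), and [eta_ eta i] is eta_(i+1) since
   the elements of ['I_n] start at 0 *)
Local Notation eta0 eta := (thead eta : R).
Local Notation eta_ eta i := (tnth eta (lift ord0 i) : R).

Definition row_mean (i : 'I_n) : R := (\sum_(j < r) y i j) / r%:R.

Definition grand_mean : R :=
  (\sum_(i < n) \sum_(j < r) y i j) / (n%:R * r%:R).

(* [normal_pdf] takes the standard deviation, not the variance *)
Definition eta_cond_pdf B eta : R :=
  normal_pdf (Num.sqrt n%:R * grand_mean)
    (Num.sqrt ((B + r%:R * U) / (r%:R * B * U))) (eta0 eta) *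
  \prod_(i < n)
    normal_pdf
      (r%:R * U / (B + r%:R * U) * (row_mean i - eta0 eta / Num.sqrt n%:R))
      (Num.sqrt (1 / (B + r%:R * U))) (eta_ eta i).

Definition B_cond_pdf eta B : R :=
  gamma_pdf (a + n%:R / 2) (b + 2^-1 * \sum_(i < n) eta_ eta i ^+ 2) B.

(* [trans_density eta eta'] is k(eta' | eta): the old state comes first *)
Definition trans_density eta eta' : \bar R :=
  (\int[lebesgue_measure]_(B in `]0%R, +oo[)
    (eta_cond_pdf B eta' * B_cond_pdf eta B)%:E)%E.

Definition trans_measure eta (A : set (n.+1.-tuple RT)) : \bar R :=
  (\int[lebesgue_tuple R n.+1]_(eta' in A) trans_density eta eta')%E.

(* unnormalized posterior density of (eta, B) on R^(n+1) x R, zero for B <= 0 *)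
Definition posterior_weight (z : n.+1.-tuple RT * RT) : R :=
  let: (eta, B) := z in
  if 0 < B then
    B `^ (a + n%:R / 2 - 1) *
    expR (- (U / 2) * (\sum_(i < n) \sum_(j < r)
              (y i j - eta0 eta / Num.sqrt n%:R - eta_ eta i) ^+ 2)
          - B * (b + 2^-1 * \sum_(i < n) eta_ eta i ^+ 2))
  else 0.

Definition posterior_mass (A : set (n.+1.-tuple RT * RT)) : \bar R :=
  (\int[lebesgue_tuple R n.+1 \x lebesgue_measure]_(z in A)
     (posterior_weight z)%:E)%E.

Let measurable_eta_cond_pdf d (T : measurableType d) (f : T -> R)
    (g : T -> n.+1.-tuple RT) :
  measurable_fun setT f -> measurable_fun setT g ->
  measurable_fun setT (fun t => eta_cond_pdf (f t) (g t)).
Proof.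
move=> mf mg.
have mgi i : measurable_fun setT (fun t => tnth (g t) i : R).
  exact: measurableT_comp (measurable_tnth i) mg.
have mg0 : measurable_fun setT (fun t => thead (g t) : R) by exact: mgi.
have mBrU : measurable_fun setT (fun t => f t + r%:R * U).
  by apply: measurable_funD.
apply: measurable_funM.
  apply: measurable_normal_pdf3 => //.
  apply: (measurableT_comp measurable_sqrtr); apply: measurable_funM => //.
  apply: measurable_funVr; apply: measurable_funM => //.
  exact: measurable_funM.
apply: measurable_prod => i _; apply: measurable_normal_pdf3 => //.
  apply: measurable_funM.
    by apply: measurable_funM => //; exact: measurable_funVr.
  by apply: measurable_funB => //; exact: measurable_funM.
apply: (measurableT_comp measurable_sqrtr); apply: measurable_funM => //.
exact: measurable_funVr.
Qed.

Let measurable_sum_eta_sqr d (T : measurableType d)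
    (g : T -> n.+1.-tuple RT) :
  measurable_fun setT g ->
  measurable_fun setT (fun t => \sum_(i < n) eta_ (g t) i ^+ 2).
Proof.
move=> mg; apply: measurable_sum => i; apply: measurable_funX.
exact: measurableT_comp (measurable_tnth _) mg.
Qed.

Let measurable_B_cond_pdf d (T : measurableType d) (f : T -> R)
    (g : T -> n.+1.-tuple RT) :
  measurable_fun setT f -> measurable_fun setT g ->
  measurable_fun setT (fun t => B_cond_pdf (g t) (f t)).
Proof.
move=> mf mg; apply: measurable_gamma_pdf => //.
apply: measurable_funD => //; apply: measurable_funM => //.
exact: measurable_sum_eta_sqr.
Qed.

Let eta_cond_pdf_ge0 B eta : 0 <= eta_cond_pdf B eta.
Proof.
rewrite /eta_cond_pdf mulr_ge0 ?normal_pdf_ge0//.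
by apply: prodr_ge0 => i _; exact: normal_pdf_ge0.
Qed.

Lemma trans_density_ge0 eta eta' : (0 <= trans_density eta eta')%E.
Proof.
apply: integral_ge0 => B _.
by rewrite lee_fin mulr_ge0 ?eta_cond_pdf_ge0 ?gamma_pdf_ge0.
Qed.

Lemma measurable_trans_density : measurable_fun setT
  (fun z : n.+1.-tuple RT * n.+1.-tuple RT => trans_density z.1 z.2).
Proof.
apply: (@measurable_integral_param _ _ _ _ _ lebesgue_measure
  `]0%R, +oo[%classic
  (fun w : n.+1.-tuple RT * n.+1.-tuple RT * RT =>
    (eta_cond_pdf w.2 w.1.2 * B_cond_pdf w.1.1 w.2)%:E)) => //.
- apply/measurable_EFinP; apply: measurable_funM.
    apply: measurable_eta_cond_pdf => //.
    exact: measurableT_comp measurable_snd measurable_fst.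
  apply: measurable_B_cond_pdf => //.
  exact: measurableT_comp measurable_fst measurable_fst.
- by move=> z; rewrite lee_fin mulr_ge0 ?eta_cond_pdf_ge0 ?gamma_pdf_ge0.
Qed.

Section trans_measure_measure.
Variable eta : n.+1.-tuple RT.

Let trans_measure0 : trans_measure eta set0 = 0%E.
Proof. exact: integral_set0. Qed.

Let trans_measure_ge0 A : (0 <= trans_measure eta A)%E.
Proof. by apply: integral_ge0 => eta' _; exact: trans_density_ge0. Qed.

Let trans_measure_sigma_additive : semi_sigma_additive (trans_measure eta).
Proof.
apply: semi_sigma_additive_nng_induced => //.
- exact: (measurableT_comp measurable_trans_density (pair1_measurable eta)).
- by move=> eta'; exact: trans_density_ge0.
Qed.

HB.instance Definition _ := isMeasure.Build _ _ _ (trans_measure eta)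
  trans_measure0 trans_measure_ge0 trans_measure_sigma_additive.

End trans_measure_measure.

Definition eta_kernel :
    n.+1.-tuple RT -> {measure set (n.+1.-tuple RT) -> \bar R} :=
  trans_measure.

Let measurable_eta_kernel A : measurable A ->
  measurable_fun setT (eta_kernel ^~ A).
Proof.
move=> mA.
apply: (@measurable_integral_param _ _ _ _ _ (lebesgue_tuple R n.+1) A
  (fun z => trans_density z.1 z.2)) => //.
- exact: measurable_trans_density.
- by move=> z; exact: trans_density_ge0.
Qed.

HB.instance Definition _ := isKernel.Build _ _ _ _ _ eta_kernel
  measurable_eta_kernel.

Let posterior_weight_ge0 z : 0 <= posterior_weight z.
Proof.
by case: z => eta B /=; case: ifP => // _; rewrite mulr_ge0 ?powR_ge0 ?expR_ge0.
Qed.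

Let measurable_posterior_weight : measurable_fun setT posterior_weight.
Proof.
have mth i : measurable_fun setT
    (fun z : n.+1.-tuple RT * RT => tnth z.1 i : R).
  exact: (measurableT_comp (measurable_tnth i) measurable_fst).
have mB : measurable_fun setT (fun z : n.+1.-tuple RT * RT => z.2 : R).
  exact: measurable_snd.
rewrite (_ : posterior_weight = fun z => if 0 < (z.2 : R) then
    (z.2 : R) `^ (a + n%:R / 2 - 1) *
    expR (- (U / 2) * (\sum_(i < n) \sum_(j < r)
              (y i j - eta0 z.1 / Num.sqrt n%:R - eta_ z.1 i) ^+ 2)
          - (z.2 : R) * (b + 2^-1 * \sum_(i < n) (eta_ z.1 i) ^+ 2))
  else 0); last by apply/funext => -[].
apply: measurable_fun_ifT => //; first exact: measurable_fun_ltr.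
apply: measurable_funM.
  exact: (measurableT_comp (@measurable_powR R (a + n%:R / 2 - 1)) mB).
apply: (measurableT_comp (@measurable_expR R)); apply: measurable_funB.
  apply: measurable_funM => //; apply: measurable_sum => i.
  apply: measurable_sum => j; apply: measurable_funX; apply: measurable_funB.
    by apply: measurable_funB => //; apply: measurable_funM => //; exact: mth.
  exact: mth.
apply: measurable_funM => //; apply: measurable_funD => //.
by apply: measurable_funM => //; exact: measurable_sum_eta_sqr.
Qed.

Let posterior_mass0 : posterior_mass set0 = 0%E.
Proof. exact: integral_set0. Qed.

Let posterior_mass_ge0 A : (0 <= posterior_mass A)%E.
Proof. by apply: integral_ge0 => z _; rewrite lee_fin. Qed.

Let posterior_mass_sigma_additive : semi_sigma_additive posterior_mass.
Proof.
by apply: semi_sigma_additive_nng_induced => //; exact/measurable_EFinP.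
Qed.

HB.instance Definition _ := isMeasure.Build _ _ _ posterior_mass
  posterior_mass0 posterior_mass_ge0 posterior_mass_sigma_additive.

(* the default [\d_point] is never used when U, a, b, n, r are positive, for
   then the total mass is positive and finite *)
Definition posterior : probability (n.+1.-tuple RT * RT)%type R :=
  mnormalize posterior_mass \d_point.

Definition eta_posterior : probability (n.+1.-tuple RT) R :=
  distribution posterior fst.

Definition eta_geometric_rate : R := geometric_rate eta_kernel eta_posterior.

End random_effects_model.

(* Main.v *)
From HB Require Import structures.
Require Import Defs.
From mathcomp Require Import all_boot all_order all_algebra.
From mathcomp Require Import all_classical all_reals all_analysis.
From mathcomp Require Import measurable_realfun ring lra.

(** Why the rate tends to 0. A step of the chain forgets everything about eta
    except S, the sum of the squares of eta_1, ..., eta_n. Let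
    t = sqrt (2 b + S) be the [spread] of eta. With u a Gamma variable of shape
    alpha = a + n/2 and rate 1, the step draws B = 2 u / t^2 and then eta as an
    affine function of n + 1 standard normals, with coefficients depending on B
    ([eta_of]). Run two copies of the chain with the same u and the same
    normals. The new vectors (eta_1, ..., eta_n) differ only through three
    coefficients, and each of them is Lipschitz in t, because t stays above
    sqrt (2 b) ([slope_lip], [noise_lip], [grand_sd_lip]). The spread is itself
    1-Lipschitz in the vector, so one step multiplies the mean distance between
    spreads by at most [contraction_bound] ([eta_kernel_contracting]). Two of
    the coefficients become constant as r grows, and what they contribute is
    O(n^(3/2) / r); the third carries the uncertainty on the overall mean, and
    contributes O(n^(-1/2)), since 1 / sqrt u is of that order
    ([contraction_bound_le]). This is where the hypotheses A1 and A2 enter.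

    Contraction of distances becomes convergence in total variation by one more
    step: the Gamma distributions of B for two spreads t1 <= t2 share the mass
    (t1 / t2)^(2 alpha), so they are close when t1 and t2 are
    ([eta_kernel_smoothing]). Combined with the stationarity of the posterior
    ([eta_posterior_stationary]) and with the finiteness of the posterior mean
    of the spread ([eta_posterior_spread_lty]), this yields
    M(x) contraction_bound^m as a bound for the m-step distance, for each n such
    that contraction_bound <= 1 ([geometric_rate_le], [eta_geometric_rate_le]).

    Stationarity is the usual argument for two-block Gibbs samplers, based on
    the two factorizations of the joint density ([posterior_weight_B],
    [posterior_weight_eta]); the first one also gives the marginal of B, with
    which the moments are estimated. *)

Set Implicit Arguments.
Unset Strict Implicit.
Unset Printing Implicit Defensive.
Import Order.TTheory GRing.Theory Num.Theory.
Import numFieldNormedType.Exports.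
Local Open Scope classical_set_scope.
Local Open Scope ring_scope.

(** * Densities, Tonelli on a subset, affine substitution *)

Section density.
Context {R : realType} d (T : measurableType d).
Variables (mu nu : {measure set T -> \bar R}) (rho : T -> \bar R).
Hypotheses (mrho : measurable_fun setT rho) (rho0 : forall x, (0 <= rho x)%E).
Hypothesis nuE : forall A, measurable A -> nu A = (\int[mu]_(x in A) rho x)%E.
Local Open Scope ereal_scope.
Import HBNNSimple.

(** Both sides commute with increasing limits, which reduces the identity to
    simple functions. *)
Lemma ge0_integral_density (f : T -> \bar R) :
  measurable_fun setT f -> (forall x, 0 <= f x) ->
  \int[nu]_x f x = \int[mu]_x (f x * rho x).
Proof.
move=> mf f0; pose h := nnsfun_approx measurableT mf.
have hf x : (h n x)%:E @[n --> \oo] --> f x by exact: cvg_nnsfun_approx.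
have mhr n : measurable_fun setT (fun x => (h n x)%:E * rho x).
  by apply: emeasurable_funM => //; exact/measurable_EFinP.
have -> : \int[nu]_x f x = limn (fun n => \int[nu]_x (h n x)%:E).
  rewrite -monotone_convergence//.
  - by apply: eq_integral => x _; apply/esym/cvg_lim.
  - by move=> n; exact/measurable_EFinP.
  - by move=> n x _; rewrite lee_fin.
  - by move=> x _ m n mn; rewrite lee_fin; exact/lefP/nd_nnsfun_approx.
have -> : \int[mu]_x (f x * rho x) = limn (fun n => \int[mu]_x ((h n x)%:E * rho x)).
  rewrite -monotone_convergence//.
  - apply: eq_integral => x _; apply/esym/cvg_lim => //.
    (* the products 0 * +oo are excluded before passing to the limit *)
    have [r0|r0] := eqVneq (rho x) 0.
      by rewrite r0 mule0; under eq_fun do rewrite mule0; exact: cvg_cst.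
    have [fx0|fx0] := eqVneq (f x) 0.
      suff h0 n : h n x = 0%R.
        by rewrite fx0 mul0e; under eq_fun do rewrite h0 mul0e; exact: cvg_cst.
      apply/eqP; rewrite eq_le fun_ge0 andbT -lee_fin -[leRHS]fx0.
      by rewrite /h nnsfun_approxE; exact: le_approx.
    apply: cvgeM => //; last exact: cvg_cst.
    by rewrite mule_defE (negbTE r0) (negbTE fx0).
  - by move=> n x _; rewrite mule_ge0// lee_fin.
  - move=> x _ m n mn; apply: lee_wpmul2r => //.
    by rewrite lee_fin; exact/lefP/nd_nnsfun_approx.
congr (limn _); apply/funext => n.
under eq_integral do rewrite fimfunE -fsumEFin//.
rewrite ge0_integral_fsum//; last 2 first.
- by move=> y; exact/measurable_EFinP/measurable_funM.
- by move=> y x _; rewrite nnfun_muleindic_ge0.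
transitivity (\int[mu]_x \sum_(k \in range (h n))
    ((k * \1_(h n @^-1` [set k]) x)%:E * rho x)).
  rewrite ge0_integral_fsum//; last 2 first.
  - move=> y; apply: emeasurable_funM => //.
    exact/measurable_EFinP/measurable_funM.
  - by move=> y x _; rewrite mule_ge0// nnfun_muleindic_ge0.
  apply: eq_fsbigr => k /[!inE] -[z _ hz].
  have k0 : (0 <= k)%R by rewrite -hz.
  rewrite integralZl_indic_nnsfun// integral_indic// setIT nuE//.
  under [RHS]eq_integral do rewrite EFinM -muleA.
  rewrite ge0_integralZl_EFin//; last 2 first.
  - by move=> x _; rewrite mule_ge0// lee_fin.
  - by apply: emeasurable_funM => //; exact/measurable_EFinP.
  congr (_ * _); rewrite integral_mkcond; apply: eq_integral => x _.
  by rewrite epatch_indic muleC.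
apply: eq_integral => x _.
by rewrite [in RHS]fimfunE -[in RHS]fsumEFin// ge0_mule_fsuml// => k; rewrite nnfun_muleindic_ge0.
Qed.
End density.

Section tonelli_on.
Context {R : realType} d1 d2 (T1 : measurableType d1) (T2 : measurableType d2).
Variables (m1 : {sigma_finite_measure set T1 -> \bar R})
  (m2 : {sigma_finite_measure set T2 -> \bar R}).
Local Open Scope ereal_scope.

Lemma tonelli_on (D : set T2) (f : T1 * T2 -> \bar R) : measurable D ->
  measurable_fun setT f -> (forall z, 0 <= f z) ->
  \int[m1]_x \int[m2]_(y in D) f (x, y) = \int[m2]_(y in D) \int[m1]_x f (x, y).
Proof.
move=> mD mf f0.
have mD1 : measurable_fun setT (fun z : T1 * T2 => (\1_D z.2)%:E : \bar R).
  apply/measurable_EFinP.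
  by apply: (measurableT_comp _ measurable_snd); exact: measurable_indic.
transitivity (\int[m1]_x \int[m2]_y (f (x, y) * (\1_D y)%:E)).
  by apply: eq_integral => x _; rewrite integral_mkcond epatch_indic.
rewrite (fubini_tonelli (fun z => f z * (\1_D z.2)%:E))//; first last.
- by move=> z; rewrite mule_ge0// lee_fin.
- exact: emeasurable_funM.
rewrite [RHS]integral_mkcond epatch_indic; apply: eq_integral => y _.
rewrite /= ge0_integralZr ?lee_fin//.
  exact: (measurableT_comp mf (pair2_measurable y)).

Qed.
End tonelli_on.

Section affine.
Context {R : realType}.
Local Notation mu := (@lebesgue_measure R).
Local Open Scope ereal_scope.

(** A measure on the line that agrees with Lebesgue measure on bounded half-open
    intervals is Lebesgue measure. *)
Lemma lebesgue_measure_affine (m s : R) (A : set R) : (0 < s)%R -> measurable A ->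
  s%:E * mu ((fun z : R => m + s * z)%R @^-1` A) = mu A.
Proof.
move=> s0 mA.
have ma : measurable_fun setT ((fun z : R => m + s * z)%R : R -> measurableTypeR R).
  by apply: measurable_funD => //; exact: measurable_funM.
pose phi : R -> measurableTypeR R := fun z => (m + s * z)%R.
pose nu := mscale (NngNum (ltW s0)) (pushforward mu phi).
rewrite -[LHS]/(nu ma A); apply/esym.
apply: lebesgue_measure_unique => // _ [[a b]] _ <-.
rewrite /nu/= /mscale/= /pushforward/= /phi.
rewrite (_ : _ @^-1` _ = `](a - m) / s, (b - m) / s]%classic)%R; last first.
  apply/seteqP; split => x /=; rewrite !in_itv/=.
    by rewrite ltr_pdivrMr// ler_pdivlMr// ltrBlDl lerBrDl ![(x * s)%R]mulrC.
  by rewrite ltr_pdivrMr// ler_pdivlMr// ltrBlDl lerBrDl ![(x * s)%R]mulrC.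
rewrite !lebesgue_measure_itv/= !lte_fin ltr_pM2r ?invr_gt0// ltrD2r.
case: ifPn => _; last by rewrite mule0.
by rewrite -!EFinD -EFinM; congr EFin; field; rewrite ?gt_eqF.
Qed.

Lemma ge0_integral_affine (m s : R) (D : set R) (f : R -> \bar R) :
  (0 < s)%R -> measurable D ->
  measurable_fun setT f -> (forall x, 0 <= f x) ->
  \int[mu]_(x in D) f x =
  \int[mu]_(z in (fun z : R => m + s * z)%R @^-1` D) (s%:E * f (m + s * z)%R).
Proof.
move=> s0 mD mf f0.
have ma : measurable_fun setT ((fun z : R => m + s * z)%R : R -> measurableTypeR R).
  by apply: measurable_funD => //; exact: measurable_funM.
pose phi : R -> measurableTypeR R := fun z => (m + s * z)%R.
pose nu := mscale (NngNum (ltW s0)) (pushforward mu phi).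
rewrite ge0_integralZl_EFin//; last 3 first.
- by rewrite -[X in measurable X]setTI; exact: ma.
- apply: (measurable_funS measurableT) => //.
  exact: (measurableT_comp mf ma).
- exact: ltW.
transitivity (\int[nu ma]_(x in D) f x).
  apply: eq_measure_integral => //= A mA _.
  exact: (esym (lebesgue_measure_affine m s0 mA)).
rewrite ge0_integral_mscale//; last exact: measurable_funS mf.
by rewrite ge0_integral_pushforward//; exact: measurable_funS mf.
Qed.
End affine.

(** * From a contracting kernel to a geometric rate *)

Section rate.
Context {R : realType} d (X : measurableType d).
Variables (K : R.-ker X ~> X) (Pi : probability X R) (t : X -> R) (L g : R).
Hypotheses (mt : measurable_fun setT t) (t0 : forall x, 0 <= t x).
Hypotheses (L0 : 0 <= L) (g0 : 0 < g) (g1 : g <= 1).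
Local Open Scope ereal_scope.
Hypothesis stationary : forall f : X -> \bar R, measurable_fun setT f ->
  (forall x, 0 <= f x) -> \int[Pi]_x \int[K x]_z f z = \int[Pi]_x f x.
Hypothesis smoothing : forall f : X -> \bar R, measurable_fun setT f ->
  (forall x, 0 <= f x <= 1) -> forall x x',
  \int[K x]_z f z <= \int[K x']_z f z + (L * `|t x - t x'|)%:E.
Hypothesis contracting : forall (f : X -> \bar R) (l : R), (0 <= l)%R ->
  measurable_fun setT f -> (forall x, 0 <= f x) ->
  (forall x x', f x <= f x' + (l * `|t x - t x'|)%:E) -> forall x x',
  \int[K x]_z f z <= \int[K x']_z f z + (g * l * `|t x - t x'|)%:E.
Hypothesis integrable_t : \int[Pi]_x (t x)%:E < +oo.

Let kernel_iter_ge0 A m x : 0 <= kernel_iter K m x A.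
Proof. by elim: m x => [|m ih] x //=; exact: integral_ge0. Qed.

Let measurable_kernel_iter A m : measurable A ->
  measurable_fun setT (fun x => kernel_iter K m x A).
Proof.
move=> mA; elim: m => [|m ih] /=.
  by apply/measurable_EFinP; exact: measurable_indic.
by apply: measurable_fun_integral_kernel => //; exact: measurable_kernel.
Qed.

Let integral_kernel_iter A m : measurable A ->
  \int[Pi]_x kernel_iter K m x A = Pi A.
Proof.
move=> mA; elim: m => [|m ih] /=; first by rewrite integral_indic// setIT.
by rewrite stationary//; exact: measurable_kernel_iter.
Qed.

Let kernel_iter_lip A m : measurable A -> forall x x',
  kernel_iter K m.+1 x A <=
  kernel_iter K m.+1 x' A + (g ^+ m * L * `|t x - t x'|)%:E.
Proof.
move=> mA; elim: m => [|m ih] x x'.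
  rewrite expr0 mul1r; apply: smoothing.
    by apply/measurable_EFinP; exact: measurable_indic.
  by move=> z; rewrite diracE lee_fin; case: (_ \in _); rewrite lee_fin ?lexx ?ler01.
rewrite exprS -(mulrA g); apply: contracting => //.
- by rewrite mulr_ge0// exprn_ge0// ltW.
- exact: (measurable_kernel_iter m.+1).
- by move=> z; exact: (kernel_iter_ge0 A m.+1).
Qed.

(** By [smoothing] and then [contracting], the m-step probability of a set, seen
    as a function of the starting point, is L g^(m-1)-Lipschitz with respect to
    t. Averaging over a second starting point of law Pi turns the probability
    from that point into Pi A, by stationarity, and leaves an error that is
    finite because t is integrable.

    Contraction is expressed on functions, which is the dual form of a
    Wasserstein contraction, and by one-sided inequalities between functions
    with values in [0, +oo], which can be integrated as they stand. *)
Lemma geometric_rate_le : (0 <= geometric_rate K Pi <= g)%R.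
Proof.
rewrite /geometric_rate; set S := [set rho | _]%classic.
have cstPi (k : \bar R) : \int[Pi]_x' (cst k x') = k.
  rewrite integral_cst// -[RHS]mule1; congr (_ * _).
  exact: probability_setT.
have Sg : S g.
  split; first by rewrite ltW.
  pose It := fine (\int[Pi]_x (t x)%:E).
  have tint0 : 0 <= \int[Pi]_x (t x)%:E.
    by apply: integral_ge0 => x _; rewrite lee_fin.
  have ItE : \int[Pi]_x (t x)%:E = It%:E.
    by rewrite fineK// ge0_fin_numE.
  have It0 : (0 <= It)%R by exact: fine_ge0.
  exists (fun x => L / g * (t x + It))%R; split.
    by move=> x; rewrite mulr_ge0 ?divr_ge0 ?addr_ge0// ltW.
  move=> x [//|m] _; apply: ge_ereal_sup => _ [A mA <-].
  rewrite leeBlDr ?fin_num_measure//.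
  pose c := (g ^+ m * L)%R.
  have c0 : (0 <= c)%R by rewrite mulr_ge0// exprn_ge0// ltW.
  have -> : (L / g * (t x + It) * g ^+ m.+1 = c * t x + c * It)%R.
    by rewrite /c exprS; field; rewrite gt_eqF.
  have -> : kernel_iter K m.+1 x A = \int[Pi]_x' (cst (kernel_iter K m.+1 x A) x').
    by rewrite cstPi.
  apply: (@le_trans _ _ (\int[Pi]_x'
      (kernel_iter K m.+1 x' A + ((c * t x)%:E + c%:E * (t x')%:E)))).
    apply: ge0_le_integral => //.
    - by move=> z _; exact: (kernel_iter_ge0 _ m.+1).
    - apply: emeasurable_funD; first exact: (measurable_kernel_iter m.+1).
      apply: emeasurable_funD => //.
      by apply: emeasurable_funM => //; exact/measurable_EFinP.
    - move=> z _; apply: (le_trans (kernel_iter_lip m mA x z)).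
      apply: leeD => //; rewrite -EFinM -EFinD lee_fin -mulrDr ler_wpM2l//.
      by rewrite (le_trans (ler_normB _ _))// !ger0_norm.
  rewrite ge0_integralD//; first last.
  - apply: emeasurable_funD => //.
    by apply: emeasurable_funM => //; exact/measurable_EFinP.
  - by move=> z _; rewrite -EFinM -EFinD lee_fin addr_ge0// mulr_ge0.
  - exact: (measurable_kernel_iter m.+1).
  rewrite (integral_kernel_iter m.+1 mA) addeC leeD2r//.
  rewrite ge0_integralD//; first last.
  - by apply: emeasurable_funM => //; exact/measurable_EFinP.
  - by move=> z _; rewrite -EFinM lee_fin mulr_ge0.
  - by move=> z _; rewrite lee_fin mulr_ge0.
  rewrite (cstPi _) ge0_integralZl_EFin//.
  - by rewrite ItE.
  - by move=> z _; rewrite lee_fin.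
  - exact/measurable_EFinP.
apply/andP; split; first by apply: lb_le_inf; [exists g|move=> z [/andP[]]].
by apply: ge_inf => //; exists 0%R => z [/andP[]].
Qed.
End rate.

(** * The Gamma distribution *)

Section gamma.
Context {R : realType}.
Local Notation mu := (@lebesgue_measure R).
Local Notation D := `]0%R, +oo[%classic.
Implicit Types s l k : R.

Lemma ge0_integral_scale (c : R) (f : R -> \bar R) :
  0 < c -> measurable_fun setT f -> (forall x, 0 <= f x)%E ->
  (\int[mu]_(x in D) f x = \int[mu]_(x in D) (c%:E * f (c * x)%R))%E.
Proof.
move=> c0 mf f0; rewrite (ge0_integral_affine 0 c0)//.
rewrite (_ : _ @^-1` D = D); last first.
  by apply/seteqP; split => x /=; rewrite !in_itv/= !andbT add0r pmulr_rgt0.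
by under eq_integral do rewrite add0r.
Qed.

(** The Gamma density of shape s and rate l without its normalizing constant. *)
Definition gamma_kern s l x : R := x `^ (s - 1) * expR (- (l * x)).

Lemma gamma_kern_ge0 s l x : 0 <= gamma_kern s l x.
Proof. by rewrite mulr_ge0 ?powR_ge0 ?expR_ge0. Qed.

Lemma measurable_gamma_kern s l : measurable_fun setT (gamma_kern s l).
Proof.
apply: measurable_funM; first exact: measurable_powR.
apply: measurableT_comp => //; apply: measurableT_comp => //.
Qed.

Lemma measurable_gamma_kernE s l (A : set R) :
  measurable_fun A (fun x => (gamma_kern s l x)%:E).
Proof.
apply: measurable_funTS; apply/measurable_EFinP; exact: measurable_gamma_kern.
Qed.

Lemma mem_itv_gt0 (x : R) : x \in D -> 0 < x.
Proof. by rewrite inE/= in_itv/= andbT. Qed.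

Definition gamma_int s l : \bar R := (\int[mu]_(x in D) (gamma_kern s l x)%:E)%E.

Lemma gamma_int_ge0 s l : (0 <= gamma_int s l)%E.
Proof. by apply: integral_ge0 => x _; rewrite lee_fin gamma_kern_ge0. Qed.

Lemma gamma_int_scale s l : 0 < l ->
  gamma_int s l = ((l `^ (- s))%:E * gamma_int s 1)%E.
Proof.
move=> l0; rewrite /gamma_int (@ge0_integral_scale l^-1) ?invr_gt0//; last 2 first.
- exact: measurable_gamma_kernE.
- by move=> x; rewrite lee_fin gamma_kern_ge0.
rewrite -ge0_integralZl_EFin ?powR_ge0//; last 2 first.
- by move=> x _; rewrite lee_fin gamma_kern_ge0.
- exact: measurable_gamma_kernE.
apply: eq_integral => x /mem_itv_gt0 x0; rewrite -!EFinM; congr EFin.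
rewrite /gamma_kern mulVKf ?gt_eqF// mul1r powRM ?invr_ge0 ?ltW//.
rewrite mulrA [in RHS]mulrA; congr *%R; rewrite mulrA; congr *%R.
by rewrite -(powR_inv1 (ltW l0)) -powRrM -powRD ?(gt_eqF l0) ?implybT//; congr powR; ring.
Qed.

Lemma powR_expR (x p : R) : 0 < x -> x `^ p = expR (p * ln x).
Proof. by move=> x0; rewrite /powR gt_eqF. Qed.

(** With p = s - 1, the inequality ln v < v at v = x / (2 p) gives
    x^p <= (2 p)^p e^(x/2), so an exponential density dominates. *)
Lemma gamma_int_lty s : 1 < s -> (gamma_int s 1 < +oo)%E.
Proof.
move=> s1; pose p := s - 1; have p0 : 0 < p by rewrite subr_gt0.
pose C := expR (p * ln (2 * p)) * 2.
apply: (@le_lt_trans _ _ (\int[mu]_(x in D) (C%:E * (exponential_pdf 2^-1 x)%:E))%E).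
  apply: ge0_le_integral => //.
  - by move=> x _; rewrite lee_fin gamma_kern_ge0.
  - exact: measurable_gamma_kernE.
  - apply: measurable_funTS; apply: emeasurable_funM => //.
    apply/measurable_EFinP; exact: measurable_exponential_pdf.
  - move=> x; rewrite /= in_itv/= andbT => x0; rewrite -EFinM lee_fin.
    rewrite (exponential_pdfE _ (ltW x0)) /gamma_kern powR_expR// -expRD.
    rewrite /C mulrA -[_ * 2 * _]mulrA mulfV ?pnatr_eq0// mulr1 -expRD ler_expR.
    have : ln (x / (2 * p)) < x / (2 * p).
      by apply: ln_sublinear; rewrite divr_gt0// mulr_gt0.
    rewrite ln_div ?posrE ?mulr_gt0// -(ltr_pM2l p0).
    have -> : p * (x / (2 * p)) = x / 2 by field; rewrite gt_eqF.
    rewrite -/p mulrBr; lra.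
apply: (@le_lt_trans _ _ (\int[mu]_x (C%:E * (exponential_pdf 2^-1 x)%:E))%E).
  apply: ge0_subset_integral => //.
  - apply: emeasurable_funM => //.
    apply/measurable_EFinP; exact: measurable_exponential_pdf.
  - by move=> x _; rewrite -EFinM lee_fin !mulr_ge0 ?expR_ge0// exponential_pdf_ge0.
rewrite ge0_integralZl_EFin//; last 3 first.
- by move=> x _; rewrite lee_fin exponential_pdf_ge0.
- apply/measurable_EFinP; exact: measurable_exponential_pdf.
- by rewrite mulr_ge0 ?expR_ge0.
by rewrite integral_exponential_pdf// mule1 ltry.
Qed.

Lemma gamma_intE s : 1 < s -> gamma_int s 1 = (gamma_fun s)%:E.
Proof.
move=> s1; rewrite /gamma_fun /Rintegral.
under eq_integral do rewrite -[X in expR (- X)]mul1r -/(gamma_kern s 1 _).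
by rewrite fineK// ge0_fin_numE ?gamma_int_lty// gamma_int_ge0.
Qed.

Lemma gamma_fun_gt0 s : 1 < s -> 0 < gamma_fun s.
Proof.
move=> s1; rewrite -lte_fin -gamma_intE//.
apply: (@lt_le_trans _ _ (\int[mu]_(x in `[1%R, 2%R]) (expR (- 2))%:E)%E).
  rewrite integral_cst//= lebesgue_measure_itv/= lte_fin ltr1n.
  by rewrite -EFinB -EFinM lte_fin mulr_gt0 ?expR_gt0//; lra.
apply: (@le_trans _ _ (\int[mu]_(x in `[1%R, 2%R]) (gamma_kern s 1 x)%:E)%E).
  apply: ge0_le_integral => //.
  - exact: measurable_gamma_kernE.
  - move=> x; rewrite /= in_itv/= => /andP[x1 x2]; rewrite lee_fin /gamma_kern mul1r.
    rewrite -[leLHS]mul1r ler_pM ?expR_ge0 ?ler_expR ?lerN2//.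
    rewrite -[leLHS](powRr0 x); apply: ler_powR => //; lra.
apply: ge0_subset_integral => //.
- exact: measurable_gamma_kernE.
- by move=> x _; rewrite lee_fin gamma_kern_ge0.
- by move=> x; rewrite /= !in_itv/= andbT => /andP[x1 _]; rewrite (lt_le_trans ltr01).
Qed.

Lemma powR_succ (x p : R) : 0 < x -> x `^ (p + 1) = x * x `^ p.
Proof.
move=> x0; rewrite powRD ?powRr1 ?ltW//; first by rewrite mulrC.
by rewrite (gt_eqF x0) implybT.
Qed.

Lemma gamma_kernS s l x : 0 < x -> gamma_kern (s + 1) l x = x * gamma_kern s l x.
Proof.
move=> x0; rewrite /gamma_kern mulrA; congr *%R.
by rewrite addrAC powR_succ.
Qed.

(** Write G for the Gamma function. Integrating
    (1 + (1 - l) x) e^(-x) <= e^(-l x) against x^(s-1) gives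
    G(s) + (1 - l) G(s+1) <= l^(-s) G(s). The choice l = e^(-1/(2s)) makes
    l^(-s) at most 2 and 1 - l of order 1/s. The constant is not the best one,
    but it is linear in s. *)
Lemma gamma_fun_succ_le s : 1 < s -> gamma_fun (s + 1) <= 2 * (s + 1) * gamma_fun s.
Proof.
move=> s1; have s0 : 0 < s by lra.
pose x0 := (2 * s)^-1; have x00 : 0 < x0 by rewrite invr_gt0; lra.
pose l := expR (- x0).
have lub : l <= (1 + x0)^-1.
  by rewrite /l expRN lef_pV2 ?posrE ?expR_gt0 ?expR_ge1Dx//; lra.
have l1 : l < 1 by rewrite expR_lt1 oppr_lt0.
have ls : l `^ (- s) <= 2.
  rewrite /l -expRM; have -> : - x0 * - s = 2^-1.
    by rewrite /x0; field; rewrite gt_eqF.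
  rewrite -[expR _]invrK -expRN -[leRHS]invrK lef_pV2 ?posrE ?expR_gt0//.
  by rewrite (le_trans _ (expR_ge1Dx _))//; lra.
have : gamma_fun s + (1 - l) * gamma_fun (s + 1) <= l `^ (- s) * gamma_fun s.
  rewrite -lee_fin EFinD !EFinM -!gamma_intE//; last lra.
  rewrite -gamma_int_scale ?expR_gt0// /gamma_int.
  rewrite -ge0_integralZl_EFin//; last 3 first.
  - by move=> x _; rewrite lee_fin gamma_kern_ge0.
  - exact: measurable_gamma_kernE.
  - by rewrite subr_ge0 ltW.
  rewrite -ge0_integralD//; first last.
  - by apply: emeasurable_funM => //; exact: measurable_gamma_kernE.
  - by move=> x _; rewrite -EFinM lee_fin mulr_ge0 ?gamma_kern_ge0// subr_ge0 ltW.
  - exact: measurable_gamma_kernE.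
  - by move=> x _; rewrite lee_fin gamma_kern_ge0.
  apply: ge0_le_integral => //.
  - move=> x _; rewrite -EFinM -EFinD lee_fin addr_ge0 ?gamma_kern_ge0//.
    by rewrite mulr_ge0 ?gamma_kern_ge0// subr_ge0 ltW.
  - apply: emeasurable_funD; first exact: measurable_gamma_kernE.
    by apply: emeasurable_funM => //; exact: measurable_gamma_kernE.
  - exact: measurable_gamma_kernE.
  - move=> x; rewrite /= in_itv/= andbT => xp.
    rewrite -EFinM -EFinD lee_fin gamma_kernS// mulrA -[X in X + _]mul1r -mulrDl.
    rewrite /gamma_kern mulrCA ler_wpM2l ?powR_ge0//.
    have -> : - (l * x) = (1 - l) * x + - (1 * x) by ring.
    by rewrite expRD ler_wpM2r ?expR_ge0 ?expR_ge1Dx.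
have := gamma_fun_gt0 s1.
have := @gamma_fun_gt0 (s + 1); move=> /(_ ltac:(lra)).
move: (gamma_fun s) (gamma_fun (s + 1)) => G G' G'0 G0 H.
have H2 : (1 - l) * G' <= G.
  by rewrite -(lerD2l G) (le_trans H)// -mulr2n -mulr_natl ler_wpM2r// ltW.
have l2 : (2 * s + 1)^-1 <= 1 - l.
  have -> : (2 * s + 1)^-1 = 1 - (1 + x0)^-1.
    by rewrite /x0; field; rewrite !gt_eqF//; lra.
  by rewrite lerD2l lerN2.
have : (2 * s + 1)^-1 * G' <= G by rewrite (le_trans _ H2)// ler_wpM2r// ltW.
rewrite mulrC ler_pdivrMr; last lra.
by move=> /le_trans; apply; rewrite mulrC ler_wpM2r ?(ltW G0)//; lra.
Qed.

(** The companion of [gamma_fun_succ_le]: now l = e^(1/k) > 1, and the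
    convexity inequality (1 - (l - 1) x) e^(-x) <= e^(-l x) gives
    (1 - l^(-k)) G(k) <= (l - 1) G(k+1). *)
Lemma gamma_fun_pred_le k : 1 < k -> gamma_fun k <= 2 / (k - 1) * gamma_fun (k + 1).
Proof.
move=> k1; have k0 : 0 < k by lra.
pose l := expR k^-1.
have l1 : 1 < l by rewrite expR_gt1 invr_gt0.
have lk : l `^ (- k) <= 2^-1.
  rewrite /l -expRM mulrN mulVf ?gt_eqF// expRN lef_pV2 ?posrE ?expR_gt0//.
  by rewrite (le_trans _ (expR_ge1Dx _))//; lra.
have lub : l - 1 <= (k - 1)^-1.
  have : l <= (1 - k^-1)^-1.
    rewrite /l -[expR _]invrK -expRN lef_pV2 ?posrE ?expR_gt0 ?expR_ge1Dx//.
    by rewrite subr_gt0 invf_lt1.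
  rewrite lerBlDr => /le_trans; apply; rewrite le_eqVlt; apply/orP; left; apply/eqP.
  by field; rewrite !gt_eqF//; lra.
have : gamma_fun k <= l `^ (- k) * gamma_fun k + (l - 1) * gamma_fun (k + 1).
  rewrite -lee_fin EFinD !EFinM -!gamma_intE//; last lra.
  rewrite -gamma_int_scale ?expR_gt0// /gamma_int.
  rewrite -ge0_integralZl_EFin//; last 3 first.
  - by move=> x _; rewrite lee_fin gamma_kern_ge0.
  - exact: measurable_gamma_kernE.
  - by rewrite subr_ge0 ltW.
  rewrite -ge0_integralD//; first last.
  - by apply: emeasurable_funM => //; exact: measurable_gamma_kernE.
  - by move=> x _; rewrite -EFinM lee_fin mulr_ge0 ?gamma_kern_ge0// subr_ge0 ltW.
  - exact: measurable_gamma_kernE.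
  - by move=> x _; rewrite lee_fin gamma_kern_ge0.
  apply: ge0_le_integral => //.
  - by move=> x _; rewrite lee_fin gamma_kern_ge0.
  - exact: measurable_gamma_kernE.
  - apply: emeasurable_funD; first exact: measurable_gamma_kernE.
    by apply: emeasurable_funM => //; exact: measurable_gamma_kernE.
  - move=> x; rewrite /= in_itv/= andbT => xp.
    rewrite -EFinM -EFinD lee_fin gamma_kernS// mulrA -lerBlDr -[X in X - _]mul1r -mulrBl.
    rewrite /gamma_kern mulrCA ler_wpM2l ?powR_ge0//.
    have -> : - (l * x) = - ((l - 1) * x) + - (1 * x) by ring.
    by rewrite expRD ler_wpM2r ?expR_ge0// expR_ge1Dx.
have := gamma_fun_gt0 k1.
have := @gamma_fun_gt0 (k + 1); move=> /(_ ltac:(lra)).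
move: (gamma_fun k) (gamma_fun (k + 1)) => G G' G'0 G0 H.
have : l `^ (- k) * G <= 2^-1 * G by rewrite ler_wpM2r// ltW.
have : (l - 1) * G' <= (k - 1)^-1 * G' by rewrite ler_wpM2r// ltW.
rewrite -mulrA; lra.
Qed.

Lemma gamma_pdfE s l x : gamma_pdf s l x = l `^ s / gamma_fun s * gamma_kern s l x.
Proof. by rewrite /gamma_pdf /gamma_kern mulrA. Qed.

Lemma measurable_gamma_pdfE s l (A : set R) :
  measurable_fun A (fun x => (gamma_pdf s l x)%:E).
Proof.
apply: measurable_funTS; apply/measurable_EFinP.
exact: measurable_gamma_pdf.
Qed.

Lemma integral_gamma_pdf s l : 1 < s -> 0 < l ->
  (\int[mu]_(x in D) (gamma_pdf s l x)%:E = 1)%E.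
Proof.
move=> s1 l0; under eq_integral do rewrite gamma_pdfE EFinM.
have G0 := gamma_fun_gt0 s1.
rewrite ge0_integralZl_EFin//; last 3 first.
- by move=> x _; rewrite lee_fin gamma_kern_ge0.
- exact: measurable_gamma_kernE.
- by rewrite divr_ge0 ?powR_ge0 ?ltW.
rewrite -/(gamma_int s l) gamma_int_scale// gamma_intE// -!EFinM; congr EFin.
rewrite powRN; field; rewrite !gt_eqF// powR_gt0//.
Qed.

(** A Gamma variable of rate l is 1/l times one of rate 1: chains whose rates
    differ can be driven by the same draw u. *)
Lemma integral_gamma_pdf_scale s l (f : R -> \bar R) : 0 < l ->
  measurable_fun setT f -> (forall x, 0 <= f x)%E ->
  (\int[mu]_(x in D) (f x * (gamma_pdf s l x)%:E) =
   \int[mu]_(u in D) (f (u / l)%R * (gamma_pdf s 1 u)%:E))%E.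
Proof.
move=> l0 mf f0; rewrite (@ge0_integral_scale l^-1) ?invr_gt0//; last 2 first.
- by apply: emeasurable_funM => //; exact: measurable_gamma_pdfE.
- by move=> x; rewrite mule_ge0// lee_fin gamma_pdf_ge0.
apply: eq_integral => x /mem_itv_gt0 x0.
rewrite [(l^-1 * x)%R]mulrC muleCA -EFinM; congr (_ * _%:E)%E.
rewrite !gamma_pdfE /gamma_kern powR1 [x / l]mulrC mulVKf ?gt_eqF// mul1r.
rewrite powRM ?invr_ge0 ?ltW//.
have -> : l `^ s = l * l `^ (s - 1).
  by rewrite -powR_succ// subrK.
have -> : l^-1 `^ (s - 1) = (l `^ (s - 1))^-1.
  by rewrite -(powR_inv1 (ltW l0)) -powRrM mulN1r powRN.
rewrite mul1r.
have := gt_eqF (powR_gt0 (s - 1) l0).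
have := gt_eqF l0.
have [->|/negP G0] := eqVneq (gamma_fun s) 0; first by rewrite invr0 !(mulr0, mul0r).
move: (l `^ (s - 1)) (x `^ _) (expR _) => a b c la aa.
by field; rewrite la aa; apply/and3P; split => //; apply/negP.
Qed.

Lemma integral_gamma_pdf_id s : 1 < s ->
  (\int[mu]_(u in D) (u%:E * (gamma_pdf s 1 u)%:E) <= (2 * (s + 1))%:E)%E.
Proof.
move=> s1; have G0 := gamma_fun_gt0 s1.
rewrite [leLHS](_ : _ = \int[mu]_(u in D)
    ((gamma_fun s)^-1%:E * (gamma_kern (s + 1) 1 u)%:E))%E; last first.
  apply: eq_integral => u /mem_itv_gt0 u0; rewrite -!EFinM gamma_pdfE gamma_kernS// powR1; congr EFin; ring.
rewrite ge0_integralZl_EFin//; last 3 first.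
- by move=> x _; rewrite lee_fin gamma_kern_ge0.
- exact: measurable_gamma_kernE.
- by rewrite invr_ge0 ltW.
rewrite -/(gamma_int _ _) gamma_intE; last lra.
by rewrite -EFinM lee_fin mulrC ler_pdivrMr// gamma_fun_succ_le.
Qed.

Lemma integral_gamma_pdf_inv s : 2 < s ->
  (\int[mu]_(u in D) (u^-1%:E * (gamma_pdf s 1 u)%:E) <= (2 / (s - 2))%:E)%E.
Proof.
move=> s2; have G0 : 0 < gamma_fun s by apply: gamma_fun_gt0; lra.
rewrite [leLHS](_ : _ = \int[mu]_(u in D)
    ((gamma_fun s)^-1%:E * (gamma_kern (s - 1) 1 u)%:E))%E; last first.
  apply: eq_integral => u /mem_itv_gt0 u0; rewrite -!EFinM gamma_pdfE powR1.
  have -> : gamma_kern s 1 u = u * gamma_kern (s - 1) 1 u.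
    by rewrite -gamma_kernS// subrK.
  by congr EFin; field; rewrite !gt_eqF.
rewrite ge0_integralZl_EFin//; last 3 first.
- by move=> x _; rewrite lee_fin gamma_kern_ge0.
- exact: measurable_gamma_kernE.
- by rewrite invr_ge0 ltW.
rewrite -/(gamma_int _ _) gamma_intE; last lra.
rewrite -EFinM lee_fin mulrC ler_pdivrMr//.
have := @gamma_fun_pred_le (s - 1); rewrite subrK => /(_ ltac:(lra)).
by have -> : s - 1 - 1 = s - 2 by ring.
Qed.
End gamma.

(** * Vectors of independent standard normals *)

Section gauss.
Context {R : realType}.
Local Notation RT := (measurableTypeR R).
Local Notation mu := (@lebesgue_measure R).
Local Open Scope ereal_scope.

Lemma ge0_integral_cons_measure d (T : measurableType d) k
    (m : {sigma_finite_measure set T -> \bar R})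
    (m' : {sigma_finite_measure set (k.-tuple T) -> \bar R})
    (f : k.+1.-tuple T -> \bar R) :
  measurable_fun setT f -> (forall x, 0 <= f x) ->
  \int[cons_measure m m']_x f x = \int[m]_x \int[m']_t f [tuple of x :: t].
Proof.
move=> mf f0.
transitivity (\int[m \x m']_z (f \o @cons_pair _ T k) z).
  rewrite -[LHS]/(\int[pushforward (m \x m') (@cons_pair _ T k)]_x f x).
  rewrite ge0_integral_pushforward//.
  exact: measurable_cons_pair.
rewrite fubini_tonelli1//; last by move=> z; exact: f0.
by apply: measurableT_comp => //; exact: measurable_cons_pair.
Qed.

(** Built coordinate by coordinate like [lebesgue_tuple], so that both unfold
    together in inductions on k. *)
Fixpoint gauss_tuple k : {sigma_finite_measure set (k.-tuple RT) -> \bar R} :=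
  match k with
  | 0 => \d_([tuple])
  | k'.+1 => cons_measure (normal_prob 0 1) (gauss_tuple k')
  end.

Lemma integral_normal_affine (m s : R) (f : R -> \bar R) : (0 < s)%R ->
  measurable_fun setT f -> (forall x, 0 <= f x) ->
  \int[mu]_x (f x * (normal_pdf m s x)%:E) =
  \int[normal_prob 0 1]_z f (m + s * z)%R.
Proof.
move=> s0 mf f0; rewrite (ge0_integral_affine m s0)//; last 2 first.
- apply: emeasurable_funM => //; apply/measurable_EFinP.
  exact: measurable_normal_pdf.
- by move=> x; rewrite mule_ge0// lee_fin normal_pdf_ge0.
rewrite preimage_setT.
have ma : measurable_fun setT ((fun z : R => m + s * z)%R : R -> measurableTypeR R).
  by apply: measurable_funD => //; exact: measurable_funM.
rewrite (@ge0_integral_density _ _ _ mu (normal_prob 0 1)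
  (fun x => (normal_pdf 0 1 x)%:E))//; first last.
- exact: (measurableT_comp mf ma).
- by move=> x; rewrite lee_fin normal_pdf_ge0.
- by apply/measurable_EFinP; exact: measurable_normal_pdf.
apply: eq_integral => z _; rewrite muleCA -EFinM; congr (_ * _%:E).
rewrite !normal_pdfE ?oner_eq0 ?gt_eqF// /normal_peak /normal_fun.
rewrite -!mulrnAr expr1n mul1r sqrtrM ?sqr_ge0// sqrtr_sqr gtr0_norm//.
rewrite invfM mulrA mulrA mulfV ?gt_eqF//; congr (_ * expR _)%R.
- by rewrite div1r.
- by field; rewrite gt_eqF.
Qed.

Lemma measurable_consr k (x : RT) :
  measurable_fun setT (fun t : k.-tuple RT => [tuple of x :: t]).
Proof. exact: measurable_cons. Qed.

Lemma measurable_affine_tuple d (T : measurableType d) k (m s : T -> 'I_k -> R)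
    (z : T -> k.-tuple RT) :
  (forall i, measurable_fun setT (m ^~ i)) ->
  (forall i, measurable_fun setT (s ^~ i)) -> measurable_fun setT z ->
  measurable_fun setT (fun t => [tuple (m t i + s t i * tnth (z t) i)%R : RT | i < k]).
Proof.
move=> mm ms mz; apply/measurable_fun_tnthP => i.
rewrite (_ : _ \o _ = fun t => (m t i + s t i * tnth (z t) i)%R); last first.
  by apply/funext => t /=; rewrite tnth_mktuple.
apply: measurable_funD; first exact: mm.
apply: measurable_funM; first exact: ms.
exact: (measurableT_comp (measurable_tnth i) mz).
Qed.

Lemma integral_lebesgue_tuple_normal k (m : 'I_k -> R) (s : R)
    (f : k.-tuple RT -> \bar R) : (0 < s)%R ->
  measurable_fun setT f -> (forall x, 0 <= f x) ->
  \int[lebesgue_tuple R k]_x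
     (f x * (\prod_(i < k) normal_pdf (m i) s (tnth x i))%:E) =
  \int[gauss_tuple k]_z f [tuple (m i + s * tnth z i)%R : RT | i < k].
Proof.
move=> s0; elim: k => [|k ih] in m f *.
  move=> mf f0 /=; rewrite !integral_dirac//; last 2 first.
  - apply: (eq_measurable_fun f) => // z _; congr f.
    by apply: eq_from_tnth => -[].
  - by apply: (eq_measurable_fun f) => // z _; rewrite big_ord0 mule1.
  by rewrite big_ord0 mule1; congr (_ * f _); apply: eq_from_tnth => -[].
move=> mf f0.
have mprod d (T : measurableType d) j (a : 'I_j -> R) (g : T -> j.-tuple RT) :
    measurable_fun setT g ->
    measurable_fun setT (fun x => (\prod_(i < j) normal_pdf (a i) s (tnth (g x) i))%:E).
  move=> mg; apply/measurable_EFinP; apply: measurable_prod => i _.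
  apply: measurable_normal_pdf3 => //.
  exact: (measurableT_comp (measurable_tnth i) mg).
have prod0 j (a : 'I_j -> R) (x : j.-tuple RT) :
    (0 <= \prod_(i < j) normal_pdf (a i) s (tnth x i))%R.
  by apply: prodr_ge0 => i _; exact: normal_pdf_ge0.
rewrite /= ge0_integral_cons_measure//; last 2 first.
- by apply: emeasurable_funM => //; exact: (mprod _ _ _ m id).
- by move=> x; apply: mule_ge0 => //; rewrite lee_fin; exact: prod0.
rewrite ge0_integral_cons_measure//; last first.
  apply: measurableT_comp => //.
  by apply: (@measurable_affine_tuple _ _ _ (fun=> m) (fun _ _ => s) id) => // i.
pose aff (t : k.-tuple RT) := [tuple (m (lift ord0 i) + s * tnth t i)%R : RT | i < k].
have maff : measurable_fun setT aff.
  by apply: (@measurable_affine_tuple _ _ _ (fun=> m \o lift ord0) (fun _ _ => s) id) => // i.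
pose g x := \int[gauss_tuple k]_t f [tuple of x :: aff t].
transitivity (\int[mu]_x (g x * (normal_pdf (m ord0) s x)%:E)).
  apply: eq_integral => x _.
  under eq_integral do rewrite big_ord_recl tnth0 EFinM muleA muleAC.
  rewrite ge0_integralZr ?lee_fin ?normal_pdf_ge0//; last 2 first.
  - apply: emeasurable_funM.
      exact: (measurableT_comp mf (measurable_consr x)).
    under eq_fun do under eq_bigr do rewrite tnthS.
    exact: (mprod _ _ _ (m \o lift ord0) id).
  - move=> t _; rewrite mule_ge0// lee_fin.
    by apply: prodr_ge0 => i _; exact: normal_pdf_ge0.
  congr (_ * _).
  under eq_integral do under eq_bigr do rewrite tnthS.
  rewrite (ih (m \o lift ord0) (fun t => f [tuple of x :: t]))//.
  exact: (measurableT_comp mf (measurable_consr x)).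
have g0 x : 0 <= g x by exact: integral_ge0.
have mg : measurable_fun setT g.
  apply: (@measurable_integral_param _ _ _ _ _ _ _
    (fun z : RT * k.-tuple RT => f [tuple of z.1 :: aff z.2])) => //.
  apply: (measurableT_comp mf); apply: measurable_cons => //.
  exact: measurableT_comp.
rewrite (integral_normal_affine (m ord0) s0 mg g0).
apply: eq_integral => x _; apply: eq_integral => t _; congr f.
apply: eq_from_tnth => i; rewrite tnth_mktuple.
case: (unliftP ord0 i) => [j ->|->]; rewrite ?tnth0// !tnthS tnth_mktuple.
by [].
Qed.

Lemma gauss_tuple_setT k : gauss_tuple k [set: k.-tuple RT] = 1.
Proof.
rewrite -[LHS]mul1e -integral_cst//; elim: k => [|k ih] /=.
  by rewrite integral_dirac// diracT mul1e.
rewrite ge0_integral_cons_measure//= (eq_integral (cst 1)); last first.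
  by move=> x _; rewrite -[RHS]ih.
by rewrite integral_cst// mul1e; exact: probability_setT.
Qed.

Lemma integral_gauss_cst k (c : \bar R) : \int[gauss_tuple k]_z c = c.
Proof.
rewrite integral_cst// -[RHS]mule1; congr (_ * _); exact: gauss_tuple_setT.
Qed.

(** Since z^2 <= 4 e^(z^2/4), and e^(z^2/4) times the standard normal density is
    sqrt 2 times the normal density of variance 2, the second moment is at most
    4 sqrt 2 <= 6; an absolute constant is enough for the contraction bound. *)
Lemma integral_normal_sqr : \int[normal_prob 0 1]_z (z ^+ 2)%:E <= 6%:E :> \bar R.
Proof.
rewrite (@ge0_integral_density _ _ _ mu (normal_prob 0 1)
  (fun x => (normal_pdf 0 1 x)%:E))//; first last.
- by move=> x; rewrite lee_fin sqr_ge0.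
- by apply/measurable_EFinP; exact: measurable_funX.
- by move=> x; rewrite lee_fin normal_pdf_ge0.
- by apply/measurable_EFinP; exact: measurable_normal_pdf.
pose s2 : R := Num.sqrt 2.
have s22 : (s2 ^+ 2 = 2)%R by rewrite sqr_sqrtr.
have s20 : (0 < s2)%R by rewrite sqrtr_gt0.
have s2le : (4 * s2 <= 6)%R by nra.
have -> : 6%:E = \int[mu]_x (6%:E * (normal_pdf 0 s2 x)%:E) :> \bar R.
  rewrite ge0_integralZl_EFin//; last 2 first.
  - by move=> x _; rewrite lee_fin normal_pdf_ge0.
  - by apply/measurable_EFinP; exact: measurable_normal_pdf.
  by rewrite integral_normal_pdf mule1.
apply: ge0_le_integral => //.
- by move=> x _; rewrite -EFinM lee_fin mulr_ge0 ?sqr_ge0 ?normal_pdf_ge0.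
- apply: emeasurable_funM; apply/measurable_EFinP; first exact: measurable_funX.
  exact: measurable_normal_pdf.
- apply: emeasurable_funM => //; apply/measurable_EFinP.
  exact: measurable_normal_pdf.
move=> x _; rewrite -!EFinM lee_fin !normal_pdfE ?oner_eq0 ?gt_eqF//.
rewrite /normal_peak /normal_fun s22 expr1n mul1r.
have -> : (2 * pi *+ 2 = 2 * (pi *+ 2) :> R)%R by move: (pi : R) => p; ring.
rewrite sqrtrM// invfM subr0 -/s2.
have p0 : (0 <= (Num.sqrt (pi *+ 2 : R))^-1)%R by rewrite invr_ge0.
rewrite [leLHS]mulrCA [leRHS](_ : _ = (Num.sqrt (pi *+ 2))^-1 * (6 / s2 * expR (- x ^+ 2 / (2 *+ 2))))%R; last ring.
rewrite ler_wpM2l//.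
have -> : (- x ^+ 2 / (1 *+ 2) = - (x ^+ 2 / 4) + - x ^+ 2 / (2 *+ 2) :> R)%R by field.
rewrite expRD mulrA ler_wpM2r ?expR_ge0//.
apply: (@le_trans _ _ 4%R); last by rewrite ler_pdivlMr.
have := expR_ge1Dx (x ^+ 2 / 4 : R); have := expR_gt0 (x ^+ 2 / 4 : R).
rewrite expRN => e0 e1; rewrite ler_pdivrMr//; lra.
Qed.

Lemma integral_gauss_tuple_sqr k :
  \int[gauss_tuple k]_z (\sum_(i < k) tnth z i ^+ 2)%:E <= (6 * k%:R)%:E :> \bar R.
Proof.
have mS j : measurable_fun setT (fun z : j.-tuple RT => (\sum_(i < j) (tnth z i : R) ^+ 2)%R).
  by apply: measurable_sum => i; apply: measurable_funX; exact: measurable_tnth.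
have S0 j (z : j.-tuple RT) : (0 <= \sum_(i < j) (tnth z i : R) ^+ 2)%R.
  by apply: sumr_ge0 => i _; exact: sqr_ge0.
elim: k => [|k ih].
  rewrite integral_dirac//; last by apply/measurable_EFinP; exact: (mS 0%N).
  by rewrite big_ord0 mulr0 mule0 lexx.
rewrite /= ge0_integral_cons_measure//; last 2 first.
- by apply/measurable_EFinP; exact: (mS k.+1).
- by move=> x; rewrite lee_fin; exact: (S0 k.+1).
apply: (@le_trans _ _ (\int[normal_prob 0 1]_x ((x ^+ 2)%:E + (6 * k%:R)%:E))).
  apply: ge0_le_integral => //.
  - by move=> x _; apply: integral_ge0 => t _; rewrite lee_fin; exact: (S0 k.+1).
  - apply: (@measurable_integral_param _ _ _ _ _ _ _
      (fun z : RT * k.-tuple RT =>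
        (\sum_(i < k.+1) (tnth [tuple of z.1 :: z.2] i : R) ^+ 2)%:E)) => //.
      apply/measurable_EFinP; apply: (measurableT_comp (mS k.+1)).
      exact: measurable_cons.
    by move=> z; rewrite lee_fin; exact: (S0 k.+1).
  - apply: emeasurable_funD => //; apply/measurable_EFinP; exact: measurable_funX.
  - move=> x _; under eq_integral do rewrite big_ord_recl tnth0 EFinD.
    rewrite ge0_integralD//; first last.
    + apply/measurable_EFinP; under eq_fun do under eq_bigr do rewrite tnthS.
      exact: mS.
    + move=> t _; rewrite lee_fin; apply: sumr_ge0 => i _; exact: sqr_ge0.
    + by move=> t _; rewrite lee_fin sqr_ge0.
    rewrite integral_gauss_cst leeD2l//.
    by under eq_integral do under eq_bigr do rewrite tnthS.
rewrite ge0_integralD//; first last.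
- apply/measurable_EFinP; exact: measurable_funX.
- by move=> x _; rewrite lee_fin sqr_ge0.
rewrite integral_cst//.
rewrite [X in _ + _ * X](_ : _ = 1); last exact: probability_setT.
have -> : (6 * k.+1%:R = 6 * k%:R + 6 :> R)%R by rewrite -[in LHS](natr1 k) mulrDr mulr1.
rewrite mule1 addrC EFinD; apply: leeD => //; exact: integral_normal_sqr.
Qed.
End gauss.

(** * Euclidean norms *)

Section euclid.
Context {R : realType} {n : nat}.
Implicit Types u v : 'I_n -> R.

Definition enorm u : R := Num.sqrt (\sum_(i < n) u i ^+ 2).

Lemma sum_sqr_ge0 u : 0 <= \sum_(i < n) u i ^+ 2.
Proof. by apply: sumr_ge0 => i _; exact: sqr_ge0. Qed.

Lemma enorm_ge0 u : 0 <= enorm u.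
Proof. exact: sqrtr_ge0. Qed.

Lemma sqr_enorm u : enorm u ^+ 2 = \sum_(i < n) u i ^+ 2.
Proof. by rewrite sqr_sqrtr// sum_sqr_ge0. Qed.

Lemma enorm_le u x : 0 <= x -> \sum_(i < n) u i ^+ 2 <= x ^+ 2 -> enorm u <= x.
Proof. by move=> x0 h; rewrite -(ger0_norm x0) -sqrtr_sqr ler_wsqrtr. Qed.

(** Expand the sum of the squares (B u_i - C v_i)^2, where B is the sum of the
    v_i^2 and C that of the u_i v_i. *)
Lemma cauchy_schwarz u v :
  (\sum_(i < n) u i * v i) ^+ 2 <=
  (\sum_(i < n) u i ^+ 2) * (\sum_(i < n) v i ^+ 2).
Proof.
have A0 := sum_sqr_ge0 u; have B0 := sum_sqr_ge0 v.
set A := \sum_(i < n) u i ^+ 2 in A0 *; set B := \sum_(i < n) v i ^+ 2 in B0 *.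
set C := \sum_(i < n) _.
have : 0 <= B * (A * B - C ^+ 2).
  have -> : B * (A * B - C ^+ 2) = \sum_(i < n) (B * u i - C * v i) ^+ 2.
    transitivity (\sum_(i < n) (B ^+ 2 * u i ^+ 2 +
        (- (2 * B * C) * (u i * v i) + C ^+ 2 * v i ^+ 2))).
      by rewrite !big_split/= -!mulr_sumr -/A -/B -/C; ring.
    by apply: eq_bigr => i _; ring.
  by apply: sumr_ge0 => i _; exact: sqr_ge0.
have [B1|] := ltrP 0 B; first by rewrite pmulr_rge0// subr_ge0.
move=> Ble; have BE : B = 0 by apply/eqP; rewrite eq_le Ble.
have v0 i : v i = 0.
  have /eqP := BE; rewrite psumr_eq0; last by move=> j _; exact: sqr_ge0.
  by move/allP => /(_ i); rewrite mem_index_enum => /(_ isT); rewrite sqrf_eq0 => /eqP.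
rewrite BE mulr0 => _; rewrite [X in X ^+ 2](_ : C = 0) ?expr0n//.
by apply: big1 => i _; rewrite v0 mulr0.
Qed.

Lemma enormD u v : enorm (fun i => u i + v i) <= enorm u + enorm v.
Proof.
apply: enorm_le; first by rewrite addr_ge0 ?enorm_ge0.
under eq_bigr do rewrite sqrrD.
rewrite !big_split/= sqrrD !sqr_enorm lerD2r lerD2l -mulr2n ler_wMn2r//.
rewrite (le_trans (ler_norm _))// -sqrtr_sqr /enorm -sqrtrM ?sum_sqr_ge0//.
by rewrite ler_wsqrtr// cauchy_schwarz.
Qed.

Lemma enormZ (a : R) u : enorm (fun i => a * u i) = `|a| * enorm u.
Proof.
rewrite /enorm -sqrtr_sqr -sqrtrM ?sqr_ge0//; congr Num.sqrt.
by rewrite mulr_sumr; apply: eq_bigr => i _; rewrite exprMn.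
Qed.

Lemma enorm_const (x : R) : (0 < n)%N ->
  enorm (fun _ => - (x / Num.sqrt n%:R)) = `|x|.
Proof.
move=> n0; rewrite /enorm sumr_const card_ord sqrrN expr_div_n sqr_sqrtr ?ler0n//.
by rewrite -[_ *+ n]mulr_natr divfK ?pnatr_eq0 -?lt0n// sqrtr_sqr.
Qed.

(** The square root is the Euclidean norm of u with one more coordinate, sqrt c,
    and norms are 1-Lipschitz. *)
Lemma sqrt_add_sqr_lip (c : R) u v : 0 <= c ->
  `|Num.sqrt (c + \sum_(i < n) u i ^+ 2) - Num.sqrt (c + \sum_(i < n) v i ^+ 2)|
  <= enorm (fun i => u i - v i).
Proof.
move=> c0; wlog suff main : u v / Num.sqrt (c + \sum_(i < n) u i ^+ 2) <=
    Num.sqrt (c + \sum_(i < n) v i ^+ 2) + enorm (fun i => u i - v i).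
  rewrite ler_norml lerBlDl main andbT lerBrDr addrC lerBlDr.
  rewrite (le_trans (main v u))// lerD2l.
  rewrite (_ : (fun i => v i - u i) = fun i => -1 * (u i - v i)).
    by rewrite enormZ normrN1 mul1r.
  by apply/funext => i; ring.
set d := fun i => u i - v i.
have uE : u = fun i => v i + d i by apply/funext => i; rewrite /d; ring.
have h : enorm u <= enorm v + enorm d by rewrite {1}uE enormD.
have nu := enorm_ge0 u; have nv := enorm_ge0 v; have nd := enorm_ge0 d.
rewrite -(sqr_enorm u) -(sqr_enorm v).
have cv : 0 <= c + enorm v ^+ 2 by rewrite addr_ge0 ?sqr_ge0.
have sv : enorm v <= Num.sqrt (c + enorm v ^+ 2).
  by rewrite -{1}(ger0_norm nv) -sqrtr_sqr ler_wsqrtr// lerDr.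
have s0 := sqrtr_ge0 (c + enorm v ^+ 2).
rewrite -[leRHS]ger0_norm ?addr_ge0// -sqrtr_sqr ler_wsqrtr//.
have SS := sqr_sqrtr cv; move: SS s0 sv; set S := Num.sqrt _ => SS s0 sv.
have h1 : enorm u ^+ 2 <= (enorm v + enorm d) ^+ 2.
  by rewrite ler_pXn2r ?nnegrE ?addr_ge0.
have h2 := ler_wpM2r nd sv.
move: h1; rewrite !sqrrD SS !mulr2n; move: h2 {nu nv nd h cv uE}.
by move: (enorm u ^+ 2) (enorm v ^+ 2) (enorm d ^+ 2) (_ * _) (_ * _) => *; lra.
Qed.
End euclid.

(** * The coefficients of the normal update *)

Section coefficients.
Context {R : realType}.
Variables (rho u tau : R).
Hypotheses (rho0 : 0 < rho) (u0 : 0 < u) (tau0 : 0 < tau).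

(** Given B, the sd of eta_0 is [grand_sd B]; given eta_0 too, eta_i has mean
    [slope B] times its row mean minus eta_0 / sqrt n, and sd [noise B]. *)
Definition slope (B : R) := rho / (B + rho).
Definition noise (B : R) := Num.sqrt (1 / (B + rho)).
Definition grand_sd (B : R) := Num.sqrt ((B + rho) / (rho * B)).

(* B t is the value of B when the previous state has spread t and the Gamma
   draw is u; in this scale the coefficients are rational in t and q t *)
Let q t := Num.sqrt (2 * u + rho * t ^+ 2).
Let B t := u / (2^-1 * t ^+ 2).

Let d0 t : 0 < 2 * u + rho * t ^+ 2.
Proof.
apply: ltr_pwDl; first by rewrite mulr_gt0.
by apply: mulr_ge0; [exact: ltW|exact: sqr_ge0].
Qed.

Let q0 t : 0 < q t.
Proof. by rewrite sqrtr_gt0. Qed.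

Let qq t : q t ^+ 2 = 2 * u + rho * t ^+ 2.
Proof.
by rewrite sqr_sqrtr// ltW.
Qed.

Let noiseE t : 0 < t -> noise (B t) = t / q t.
Proof.
move=> t0; rewrite /noise.
have -> : 1 / (B t + rho) = (t / q t) ^+ 2.
  rewrite expr_div_n qq /B; field.
  by rewrite !gt_eqF.
by rewrite sqrtr_sqr ger0_norm// divr_ge0// ltW.
Qed.

Let slopeE t : 0 < t -> slope (B t) = rho * t ^+ 2 / q t ^+ 2.
Proof.
move=> t0; rewrite /slope qq /B; field.
by rewrite !gt_eqF.
Qed.

Let grand_sdE t : 0 < t ->
  slope (B t) * grand_sd (B t) = Num.sqrt rho * t ^+ 2 / q t / Num.sqrt (2 * u).
Proof.
move=> t0.
have u20 : 0 < 2 * u by rewrite mulr_gt0.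
have s0 : 0 < Num.sqrt rho by rewrite sqrtr_gt0.
have v0 : 0 < Num.sqrt (2 * u) by rewrite sqrtr_gt0.
have ss : Num.sqrt rho ^+ 2 = rho by rewrite sqr_sqrtr// ltW.
have vv : Num.sqrt (2 * u) ^+ 2 = 2 * u by rewrite sqr_sqrtr// ltW.
rewrite slopeE// /grand_sd.
have -> : (B t + rho) / (rho * B t) = (q t / (Num.sqrt rho * Num.sqrt (2 * u))) ^+ 2.
  rewrite expr_div_n exprMn ss vv qq /B; field.
  by rewrite !gt_eqF.
rewrite sqrtr_sqr ger0_norm ?divr_ge0 ?mulr_ge0// ?(ltW (q0 t))//.
rewrite -{1}ss; field; by rewrite !gt_eqF.
Qed.

Let q_ge t : 0 < t -> Num.sqrt rho * t <= q t.
Proof.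
move=> t0; rewrite -[X in _ * X](gtr0_norm t0) -sqrtr_sqr -sqrtrM ?(ltW rho0)//.
by rewrite ler_wsqrtr// lerDr mulr_ge0// ltW.
Qed.

(** This product is the coefficient of the noise of eta_0 in eta_i. As a function
    of t it is sqrt rho t^2 / q t, up to the factor 1 / sqrt (2 u); its slope
    stays bounded but does not vanish for large rho, so this coefficient is the
    source of the n^(-1/2) term of the rate. *)
Lemma grand_sd_lip t1 t2 : 0 < t1 -> 0 < t2 ->
  `|slope (B t1) * grand_sd (B t1) - slope (B t2) * grand_sd (B t2)|
  <= `|t1 - t2| * (3 / Num.sqrt (2 * u)).
Proof.
wlog le12 : t1 t2 / t2 <= t1.
  move=> wl t10 t20; have [le|/ltW le] := leP t2 t1; first exact: wl.
  by rewrite distrC [`|t1 - _|]distrC; exact: wl.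
move=> t10 t20.
have s0 : 0 < Num.sqrt rho by rewrite sqrtr_gt0.
have ss : Num.sqrt rho ^+ 2 = rho by rewrite sqr_sqrtr// ltW.
have v0 : 0 < Num.sqrt (2 * u) by rewrite sqrtr_gt0 mulr_gt0.
rewrite !grand_sdE// -mulrBl normrM [`|_^-1|]gtr0_norm ?invr_gt0//.
rewrite [leRHS]mulrA ler_wpM2r ?invr_ge0 ?(ltW v0)//.
set s := Num.sqrt rho in s0 ss *.
set q1 := q t1; set q2 := q t2.
have q10 : 0 < q1 := q0 t1.
have q20 : 0 < q2 := q0 t2.
have q1q : q1 ^+ 2 = 2 * u + rho * t1 ^+ 2 := qq t1.
have q2q : q2 ^+ 2 = 2 * u + rho * t2 ^+ 2 := qq t2.
have g1 : s * t1 <= q1 := q_ge t10.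
have g2 : s * t2 <= q2 := q_ge t20.
have dE : (q1 - q2) * (q1 + q2) = s ^+ 2 * (t1 - t2) * (t1 + t2).
  by rewrite ss -subr_sqr q1q q2q; ring.
have dt0 : 0 <= t1 - t2 by rewrite subr_ge0.
have q12 : 0 <= q1 - q2.
  rewrite -(pmulr_lge0 _ (addr_gt0 q10 q20)) dE.
  apply: mulr_ge0; last by apply: addr_ge0; exact: ltW.
  by apply: mulr_ge0 => //; exact: sqr_ge0.
have qd : q1 - q2 <= s * (t1 - t2).
  rewrite -(ler_pM2r (addr_gt0 q10 q20)) dE.
  have -> : s ^+ 2 * (t1 - t2) * (t1 + t2) = s * (t1 - t2) * (s * t1 + s * t2) by ring.
  by rewrite ler_wpM2l ?mulr_ge0 ?(ltW s0)// lerD.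
rewrite (ger0_norm dt0).
have -> : s * t1 ^+ 2 / q1 - s * t2 ^+ 2 / q2 =
    s * ((t1 - t2) * (t1 + t2) * q2 - t2 ^+ 2 * (q1 - q2)) / (q1 * q2).
  by field; rewrite !gt_eqF.
rewrite normrM [`|_^-1|]gtr0_norm ?invr_gt0 ?mulr_gt0// ler_pdivrMr ?mulr_gt0//.
rewrite normrM (gtr0_norm s0).
apply: (@le_trans _ _ (s * ((t1 - t2) * (t1 + t2) * q2 + t2 ^+ 2 * (q1 - q2)))).
  rewrite ler_wpM2l ?(ltW s0)// (le_trans (ler_normB _ _))//.
  rewrite !ger0_norm//; first by apply: mulr_ge0 => //; exact: sqr_ge0.
  apply: mulr_ge0; last exact: ltW.
  by apply: mulr_ge0 => //; apply: addr_ge0; exact: ltW.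
have a1 : s * ((t1 - t2) * (t1 + t2) * q2) <= (t1 - t2) * (2 * (q1 * q2)).
  have -> : s * ((t1 - t2) * (t1 + t2) * q2) = (t1 - t2) * ((s * (t1 + t2)) * q2) by ring.
  rewrite ler_wpM2l// mulrA ler_wpM2r ?(ltW q20)//.
  have : s * t2 <= s * t1 by rewrite ler_wpM2l// ltW.
  lra.
have a2 : s * (t2 ^+ 2 * (q1 - q2)) <= (t1 - t2) * (q1 * q2).
  apply: (@le_trans _ _ (s * (t2 ^+ 2 * (s * (t1 - t2))))).
    by rewrite ler_wpM2l ?(ltW s0)// ler_wpM2l ?sqr_ge0.
  have -> : s * (t2 ^+ 2 * (s * (t1 - t2))) = (t1 - t2) * ((s * t2) * (s * t2)) by ring.
  rewrite ler_wpM2l//; apply: ler_pM => //; rewrite ?mulr_ge0 ?(ltW s0) ?(ltW t20)//.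
  by rewrite (le_trans g2)// -subr_ge0.
rewrite mulrDr; lra.
Qed.
Variables (t1 t2 : R).
Hypotheses (ht1 : tau <= t1) (ht2 : tau <= t2).
Let t10 : 0 < t1. Proof. exact: lt_le_trans ht1. Qed.
Let t20 : 0 < t2. Proof. exact: lt_le_trans ht2. Qed.

Let sum_inv : (t1 + t2) / (t1 ^+ 2 * t2 ^+ 2) <= 2 / tau ^+ 3.
Proof.
have -> : (t1 + t2) / (t1 ^+ 2 * t2 ^+ 2) = (t1 * t2 ^+ 2)^-1 + (t1 ^+ 2 * t2)^-1.
  by field; rewrite !gt_eqF.
have -> : 2 / tau ^+ 3 = (tau ^+ 3)^-1 + (tau ^+ 3)^-1 by field; rewrite gt_eqF.
have h0 : 0 <= tau := ltW tau0.
apply: lerD; rewrite lef_pV2 ?posrE ?mulr_gt0 ?exprn_gt0//.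
  by rewrite exprS ler_pM ?sqr_ge0// ler_pXn2r ?nnegrE// ltW.
by rewrite exprSr ler_pM ?sqr_ge0// ler_pXn2r ?nnegrE// ltW.
Qed.

(** The slope is rho t^2 / (2 u + rho t^2), whose derivative in t is at most
    4 u / (rho t^3). The lower bound tau on t makes this small when rho is
    large compared with u. *)
Lemma slope_lip :
  `|slope (B t1) - slope (B t2)| <= `|t1 - t2| * (4 * u / (rho * tau ^+ 3)).
Proof.
rewrite !slopeE//.
have -> : rho * t1 ^+ 2 / q t1 ^+ 2 - rho * t2 ^+ 2 / q t2 ^+ 2 =
    (t1 - t2) * (2 * u * rho * (t1 + t2) / (q t1 ^+ 2 * q t2 ^+ 2)).
  have h : rho * t1 ^+ 2 * q t2 ^+ 2 - rho * t2 ^+ 2 * q t1 ^+ 2 =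
      (t1 - t2) * (2 * u * rho * (t1 + t2)) by rewrite !qq; ring.
  rewrite mulrA -h; field; by rewrite !gt_eqF.
rewrite normrM ler_wpM2l//.
have e0 : 0 <= 2 * u * rho * (t1 + t2).
  by apply: ltW; rewrite !mulr_gt0 ?addr_gt0.
rewrite ger0_norm; last by apply: divr_ge0 => //; apply: mulr_ge0; exact: sqr_ge0.
apply: (@le_trans _ _ (2 * u * rho * (t1 + t2) / ((rho * t1 ^+ 2) * (rho * t2 ^+ 2)))).
  have p1 : 0 < rho * t1 ^+ 2 by rewrite mulr_gt0 ?exprn_gt0.
  have p2 : 0 < rho * t2 ^+ 2 by rewrite mulr_gt0 ?exprn_gt0.
  rewrite ler_wpM2l// lef_pV2 ?posrE ?mulr_gt0 ?exprn_gt0// !qq.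
  have u0' := u0; by apply: ler_pM; lra.
have -> : 2 * u * rho * (t1 + t2) / ((rho * t1 ^+ 2) * (rho * t2 ^+ 2)) =
    2 * u / rho * ((t1 + t2) / (t1 ^+ 2 * t2 ^+ 2)) by field; rewrite !gt_eqF.
have -> : 4 * u / (rho * tau ^+ 3) = 2 * u / rho * (2 / tau ^+ 3).
  by field; rewrite !gt_eqF.
apply: (ler_wpM2l _ sum_inv); apply: ltW; rewrite divr_gt0 ?mulr_gt0//.
Qed.

Lemma noise_lip :
  `|noise (B t1) - noise (B t2)| <=
  `|t1 - t2| * (2 * u / (rho * Num.sqrt rho * tau ^+ 3)).
Proof.
have s0 : 0 < Num.sqrt rho by rewrite sqrtr_gt0.
have ss : Num.sqrt rho ^+ 2 = rho by rewrite sqr_sqrtr// ltW.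
rewrite !noiseE//.
have D0 : 0 < t1 * q t2 + t2 * q t1 by rewrite addr_gt0// mulr_gt0.
have -> : t1 / q t1 - t2 / q t2 =
    (t1 - t2) * (2 * u * (t1 + t2) / ((t1 * q t2 + t2 * q t1) * (q t1 * q t2))).
  have h : t1 ^+ 2 * q t2 ^+ 2 - t2 ^+ 2 * q t1 ^+ 2 =
      (t1 - t2) * (2 * u * (t1 + t2)) by rewrite !qq; ring.
  rewrite mulrA -h; field; by rewrite !gt_eqF.
rewrite normrM ler_wpM2l//.
have e0 : 0 <= 2 * u * (t1 + t2).
  by apply: ltW; rewrite !mulr_gt0 ?addr_gt0.
rewrite ger0_norm; last by apply: divr_ge0 => //; apply: ltW; rewrite !mulr_gt0.
have g1 := q_ge t10; have g2 := q_ge t20.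
apply: (@le_trans _ _ (2 * u * (t1 + t2) /
    ((2 * Num.sqrt rho * t1 * t2) * ((Num.sqrt rho * t1) * (Num.sqrt rho * t2))))).
  rewrite ler_wpM2l// lef_pV2 ?posrE ?mulr_gt0//.
  apply: ler_pM.
  - by apply: ltW; rewrite !mulr_gt0.
  - by apply: ltW; rewrite !mulr_gt0.
  - have := ler_wpM2l (ltW t10) g2; have := ler_wpM2l (ltW t20) g1; lra.
  - by apply: ler_pM => //; apply: ltW; rewrite mulr_gt0.
have -> : 2 * u * (t1 + t2) /
    ((2 * Num.sqrt rho * t1 * t2) * ((Num.sqrt rho * t1) * (Num.sqrt rho * t2))) =
    u / (rho * Num.sqrt rho) * ((t1 + t2) / (t1 ^+ 2 * t2 ^+ 2)).
  by rewrite -{4}ss; field; rewrite !gt_eqF.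
have -> : 2 * u / (rho * Num.sqrt rho * tau ^+ 3) =
    u / (rho * Num.sqrt rho) * (2 / tau ^+ 3).
  by field; rewrite !gt_eqF.
apply: (ler_wpM2l _ sum_inv); apply: ltW; rewrite divr_gt0 ?mulr_gt0//.
Qed.

End coefficients.

(** * The update of eta as an affine image of Gaussian noise *)

Section chain.
Context {R : realType} {n r : nat}.
Local Notation RT := (measurableTypeR R).
Local Notation mu := (@lebesgue_measure R).
Local Notation D := `]0%R, +oo[%classic.
Variables (U a b : R) (y : 'M[R]_(n, r)).
Hypotheses (U0 : 0 < U) (b0 : 0 < b) (n0 : (0 < n)%N) (r0 : (0 < r)%N).
Local Notation eta0 eta := (thead eta : R).
Local Notation eta_ eta i := (tnth eta (lift ord0 i) : R).
Local Notation rho := (r%:R * U).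
Local Notation alpha := (a + n%:R / 2).

Lemma rho_gt0 : 0 < rho. Proof. by rewrite mulr_gt0// ltr0n. Qed.

Definition sqr_eta (eta : n.+1.-tuple RT) : R := \sum_(i < n) eta_ eta i ^+ 2.

(** The next B depends on eta only through its rate b + S / 2 = spread^2 / 2, where
    S is the sum of the squares of eta_1, ..., eta_n. The square root is the
    scale in which the update of eta is Lipschitz, and 2 b keeps it away
    from 0. *)
Definition spread (eta : n.+1.-tuple RT) : R := Num.sqrt (2 * b + sqr_eta eta).

Definition between : R := \sum_(i < n) (row_mean y i - grand_mean y) ^+ 2.

Lemma measurable_sqr_eta : measurable_fun setT sqr_eta.
Proof.
apply: measurable_sum => i; apply: measurable_funX; exact: measurable_tnth.
Qed.

Lemma measurable_spread : measurable_fun setT spread.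
Proof.
apply: (measurableT_comp measurable_sqrtr); apply: measurable_funD => //.
exact: measurable_sqr_eta.
Qed.

Lemma spread_ge0 eta : 0 <= spread eta.
Proof. exact: sqrtr_ge0. Qed.

Lemma sqr_eta_ge0 eta : 0 <= sqr_eta eta.
Proof. by apply: sumr_ge0 => i _; exact: sqr_ge0. Qed.

Lemma spread_ge eta : Num.sqrt (2 * b) <= spread eta.
Proof. by rewrite ler_wsqrtr// lerDl sqr_eta_ge0. Qed.

Lemma rateE eta : b + 2^-1 * sqr_eta eta = 2^-1 * spread eta ^+ 2.
Proof.
rewrite sqr_sqrtr; first by field.
by rewrite addr_ge0 ?sqr_eta_ge0// mulr_ge0// ltW.
Qed.

Lemma rate_gt0 eta : 0 < b + 2^-1 * sqr_eta eta.
Proof. by rewrite ltr_pwDl// mulr_ge0 ?sqr_eta_ge0. Qed.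

(** The random map behind the draw of eta given B, driven by standard normals z. *)
Definition eta_of (B : R) (z : n.+1.-tuple RT) : n.+1.-tuple RT :=
  [tuple of (Num.sqrt n%:R * grand_mean y + grand_sd rho B * eta0 z : RT) ::
    [tuple (slope rho B * (row_mean y i -
        (Num.sqrt n%:R * grand_mean y + grand_sd rho B * eta0 z) / Num.sqrt n%:R)
      + noise rho B * eta_ z i : RT) | i < n]].

(** Replacing the row means by their deviations isolates the noise of eta_0,
    which enters all the eta_i with the same coefficient. *)
Lemma eta_ofE B z i : eta_ (eta_of B z) i =
  slope rho B * (row_mean y i - grand_mean y)
  + (slope rho B * grand_sd rho B * - (eta0 z / Num.sqrt n%:R) + noise rho B * eta_ z i).
Proof.
rewrite tnthS tnth_mktuple; field.
by rewrite gt_eqF// sqrtr_gt0 ltr0n.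
Qed.

Lemma measurable_slope : measurable_fun setT (slope rho).
Proof.
by apply: measurable_funM => //; apply: measurable_funVr; exact: measurable_funD.
Qed.

Lemma measurable_noise : measurable_fun setT (noise rho).
Proof.
apply: (measurableT_comp measurable_sqrtr).
by apply: measurable_funM => //; apply: measurable_funVr; exact: measurable_funD.
Qed.

Lemma measurable_grand_sd : measurable_fun setT (grand_sd rho).
Proof.
apply: (measurableT_comp measurable_sqrtr).
apply: measurable_funM; first exact: measurable_funD.
by apply: measurable_funVr; exact: measurable_funM.
Qed.

Lemma measurable_eta_of d (T : measurableType d) (f : T -> R) (g : T -> n.+1.-tuple RT) :
  measurable_fun setT f -> measurable_fun setT g ->
  measurable_fun setT (fun t => eta_of (f t) (g t)).
Proof.
move=> mf mg.
have mi (i : 'I_n.+1) : measurable_fun setT (fun t => tnth (g t) i : R).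
  exact: (measurableT_comp (measurable_tnth i) mg).
have m0 : measurable_fun setT
    (fun t => Num.sqrt n%:R * grand_mean y + grand_sd rho (f t) * eta0 (g t)).
  apply: measurable_funD => //; apply: measurable_funM; last exact: mi.
  exact: (measurableT_comp measurable_grand_sd mf).
apply: measurable_cons => //.
apply/measurable_fun_tnthP => i.
rewrite [X in measurable_fun _ X](_ : _ = fun t => slope rho (f t) * (row_mean y i -
        (Num.sqrt n%:R * grand_mean y + grand_sd rho (f t) * eta0 (g t)) / Num.sqrt n%:R)
      + noise rho (f t) * eta_ (g t) i); last first.
  by apply/funext => t /=; rewrite tnth_mktuple.
apply: measurable_funD; apply: measurable_funM.
- exact: (measurableT_comp measurable_slope mf).
- by apply: measurable_funB => //; exact: measurable_funM.
- exact: (measurableT_comp measurable_noise mf).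
- exact: mi.
Qed.

Lemma measurable_eta_cond_pdf d (T : measurableType d) (f : T -> R)
    (g : T -> n.+1.-tuple RT) :
  measurable_fun setT f -> measurable_fun setT g ->
  measurable_fun setT (fun t => eta_cond_pdf U y (f t) (g t)).
Proof.
move=> mf mg.
have mi (i : 'I_n.+1) : measurable_fun setT (fun t => tnth (g t) i : R).
  exact: (measurableT_comp (measurable_tnth i) mg).
apply: measurable_funM.
  apply: measurable_normal_pdf3 => //; last exact: mi.
  apply: (measurableT_comp measurable_sqrtr).
  apply: measurable_funM; first exact: measurable_funD.
  by apply: measurable_funVr; apply: measurable_funM => //; exact: measurable_funM.
apply: measurable_prod => i _; apply: measurable_normal_pdf3.
- apply: measurable_funM; first exact: (measurableT_comp measurable_slope mf).
  by apply: measurable_funB => //; apply: measurable_funM => //; exact: mi.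
- exact: (measurableT_comp measurable_noise mf).
- exact: mi.
Qed.

Lemma measurable_B_cond_pdf d (T : measurableType d) (f : T -> R)
    (g : T -> n.+1.-tuple RT) :
  measurable_fun setT f -> measurable_fun setT g ->
  measurable_fun setT (fun t => B_cond_pdf a b (g t) (f t)).
Proof.
move=> mf mg; apply: measurable_gamma_pdf => //.
apply: measurable_funD => //; apply: measurable_funM => //.
exact: (measurableT_comp measurable_sqr_eta mg).
Qed.

Lemma eta_cond_pdf_ge0 B eta : 0 <= eta_cond_pdf U y B eta.
Proof.
apply: mulr_ge0; first exact: normal_pdf_ge0.
by apply: prodr_ge0 => i _; exact: normal_pdf_ge0.
Qed.

Lemma grand_sd_gt0 B : 0 < B -> 0 < grand_sd rho B.
Proof.
move=> B0; have h := rho_gt0.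
by rewrite sqrtr_gt0 divr_gt0 ?(mulr_gt0 h) ?addr_gt0.
Qed.

Lemma noise_gt0 B : 0 < B -> 0 < noise rho B.
Proof. by move=> B0; rewrite sqrtr_gt0 divr_gt0 ?addr_gt0 ?rho_gt0. Qed.

Local Open Scope ereal_scope.

(** Substitute in eta_1, ..., eta_n for fixed eta_0, whose value moves their
    means, and then in eta_0. *)
Lemma integral_eta_cond_pdf B (f : n.+1.-tuple RT -> \bar R) : (0 < B)%R ->
  measurable_fun setT f -> (forall x, 0 <= f x) ->
  \int[lebesgue_tuple R n.+1]_x (f x * (eta_cond_pdf U y B x)%:E) =
  \int[gauss_tuple n.+1]_z f (eta_of B z).
Proof.
move=> B0 mf f0.
rewrite [LHS]ge0_integral_cons_measure//; last 2 first.
- apply: emeasurable_funM => //; apply/measurable_EFinP.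
  exact: measurable_eta_cond_pdf.
- by move=> x; rewrite mule_ge0// lee_fin eta_cond_pdf_ge0.
rewrite [RHS]ge0_integral_cons_measure//; last first.
  by apply: (measurableT_comp mf); exact: measurable_eta_of.
pose m (x : R) (i : 'I_n) := (slope rho B * (row_mean y i - x / Num.sqrt n%:R))%R.
pose rest x (t : n.-tuple RT) : n.-tuple RT :=
  [tuple (m x i + noise rho B * tnth t i : RT)%R | i < n].
pose g (x : R) := \int[gauss_tuple n]_t f [tuple of (x : RT) :: rest x t].
transitivity (\int[mu]_x (g x * (normal_pdf (Num.sqrt n%:R * grand_mean y)
    (grand_sd rho B) x)%:E)).
  apply: eq_integral => x _.
  rewrite /g -(@integral_lebesgue_tuple_normal _ _ (m x) _
    (fun t => f [tuple of (x : RT) :: t]))//; last 2 first.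
  - exact: noise_gt0.
  - exact: (measurableT_comp mf (measurable_consr x)).
  rewrite -ge0_integralZr ?lee_fin ?normal_pdf_ge0//; last 2 first.
  - apply: emeasurable_funM; first exact: (measurableT_comp mf (measurable_consr x)).
    apply/measurable_EFinP; apply: measurable_prod => i _.
    by apply: measurable_normal_pdf3 => //; exact: measurable_tnth.
  - move=> t _; rewrite mule_ge0// lee_fin.
    by apply: prodr_ge0 => i _; exact: normal_pdf_ge0.
  apply: eq_integral => t _; rewrite -muleA; congr (_ * _).
  rewrite /eta_cond_pdf theadE -EFinM mulrC; congr (_ * normal_pdf _ _ _)%:E.
    by apply: eq_bigr => i _; rewrite tnthS.
  by rewrite /grand_sd mulrAC.
have g0 x : 0 <= g x by exact: integral_ge0.
have mg : measurable_fun setT g.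
  apply: (@measurable_integral_param _ _ _ _ _ _ _
    (fun z : RT * n.-tuple RT => f [tuple of z.1 :: rest z.1 z.2])) => //.
  apply: (measurableT_comp mf); apply: measurable_cons => //.
  apply: measurable_affine_tuple => // i.
  apply: measurable_funM => //; apply: measurable_funB => //.
  by apply: measurable_funM => //; exact: measurable_fst.
rewrite (integral_normal_affine _ (grand_sd_gt0 B0) mg g0).
apply: eq_integral => x _; apply: eq_integral => t _; congr f.
rewrite /eta_of theadE; congr [tuple of _ :: _].
by apply: eq_from_tnth => i; rewrite !tnth_mktuple tnthS.
Qed.

Definition eta_mean (f : n.+1.-tuple RT -> \bar R) (B : R) : \bar R :=
  \int[gauss_tuple n.+1]_z f (eta_of B z).

Lemma eta_mean_ge0 f B : (forall x, 0 <= f x) -> 0 <= eta_mean f B.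
Proof. by move=> f0; exact: integral_ge0. Qed.

Lemma measurable_eta_mean f : measurable_fun setT f -> (forall x, 0 <= f x) ->
  measurable_fun setT (eta_mean f).
Proof.
move=> mf f0; apply: (@measurable_integral_param _ _ _ _ _ _ _
    (fun z : RT * n.+1.-tuple RT => f (eta_of z.1 z.2))) => //.
by apply: (measurableT_comp mf); exact: measurable_eta_of.
Qed.

Lemma integral_eta_kernel eta f : measurable_fun setT f -> (forall x, 0 <= f x) ->
  \int[eta_kernel U a b y eta]_x f x =
  \int[mu]_(B in D) (eta_mean f B * (B_cond_pdf a b eta B)%:E).
Proof.
move=> mf f0.
rewrite (@ge0_integral_density _ _ _ (lebesgue_tuple R n.+1) _
  (trans_density U a b y eta))//; last 2 first.
- exact: (measurableT_comp (measurable_trans_density U a b y) (pair1_measurable eta)).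
- by move=> x; exact: trans_density_ge0.
have mp d (T : measurableType d) (g : T -> R) (h : T -> n.+1.-tuple RT) :
    measurable_fun setT g -> measurable_fun setT h ->
    measurable_fun setT (fun x => (eta_cond_pdf U y (g x) (h x) * B_cond_pdf a b eta (g x))%:E).
  move=> mg mh; apply/measurable_EFinP; apply: measurable_funM.
    exact: measurable_eta_cond_pdf.
  exact: measurable_B_cond_pdf.
transitivity (\int[lebesgue_tuple R n.+1]_x \int[mu]_(B in D)
    (f x * (eta_cond_pdf U y B x * B_cond_pdf a b eta B)%:E)).
  apply: eq_integral => x _; rewrite /trans_density ge0_integralZl//.
  - by apply: measurable_funTS; exact: mp.
  - by move=> B _; rewrite lee_fin mulr_ge0 ?eta_cond_pdf_ge0 ?gamma_pdf_ge0.
rewrite (@tonelli_on _ _ _ _ _ _ mu D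
  (fun z : n.+1.-tuple RT * RT =>
    f z.1 * (eta_cond_pdf U y z.2 z.1 * B_cond_pdf a b eta z.2)%:E))//; last 2 first.
- apply: emeasurable_funM; first exact: (measurableT_comp mf).
  exact: mp.
- by move=> z; rewrite mule_ge0// lee_fin mulr_ge0 ?eta_cond_pdf_ge0 ?gamma_pdf_ge0.
apply: eq_integral => B /mem_itv_gt0 B0 /=.
under eq_integral do rewrite EFinM muleA.
rewrite ge0_integralZr ?lee_fin ?gamma_pdf_ge0//; last 2 first.
- apply: emeasurable_funM => //; apply/measurable_EFinP.
  exact: measurable_eta_cond_pdf.
- by move=> x _; rewrite mule_ge0// lee_fin eta_cond_pdf_ge0.
by rewrite integral_eta_cond_pdf.
Qed.

End chain.

(** * Closeness of Gamma distributions *)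

Section gamma_compare.
Context {R : realType}.
Local Notation mu := (@lebesgue_measure R).
Local Notation D := `]0%R, +oo[%classic.
Implicit Types s : R.

Lemma gamma_pdf_ratio s l1 l2 x : 1 < s -> 0 < l1 -> l1 <= l2 -> 0 < x ->
  (l1 / l2) `^ s * gamma_pdf s l2 x <= gamma_pdf s l1 x.
Proof.
move=> s1 l10 le12 x0; have l20 : 0 < l2 by exact: lt_le_trans le12.
rewrite !gamma_pdfE powRM ?invr_ge0 ?(ltW l10) ?(ltW l20)//.
have -> : l2^-1 `^ s = (l2 `^ s)^-1.
  by rewrite -(powR_inv1 (ltW l20)) -powRrM mulN1r powRN.
have p0 := powR_gt0 s l20; have G0 := gamma_fun_gt0 s1.
have -> : l1 `^ s / l2 `^ s * (l2 `^ s / gamma_fun s * gamma_kern s l2 x) =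
    l1 `^ s / gamma_fun s * gamma_kern s l2 x.
  by field; rewrite !gt_eqF.
rewrite ler_wpM2l ?divr_ge0 ?powR_ge0 ?(ltW G0)//.
by rewrite ler_wpM2l ?powR_ge0// ler_expR lerN2 ler_wpM2r// ltW.
Qed.

(** This is e^v >= 1 + v at v = - 2 s ln (t2 / t1), with ln (1 + w) <= w. *)
Lemma gamma_ratio_ge s t1 t2 : 1 < s -> 0 < t1 -> t1 <= t2 ->
  1 - 2 * s * (t2 - t1) / t1 <= ((2^-1 * t1 ^+ 2) / (2^-1 * t2 ^+ 2)) `^ s.
Proof.
move=> s1 t10 le12; have t20 : 0 < t2 by exact: lt_le_trans le12.
have -> : (2^-1 * t1 ^+ 2) / (2^-1 * t2 ^+ 2) = (t2 / t1) `^ (- 2).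
  rewrite (powR_invn 2) ?divr_ge0 ?(ltW t10) ?(ltW t20)//.
  by field; rewrite !gt_eqF.
rewrite -powRrM powR_expR ?divr_gt0//.
apply: le_trans (expR_ge1Dx _).
have h : ln (t2 / t1) <= (t2 - t1) / t1.
  have -> : (t2 - t1) / t1 = t2 / t1 - 1 by field; rewrite gt_eqF.
  have {1}-> : t2 / t1 = 1 + (t2 / t1 - 1) by ring.
  by apply: le_ln1Dx; rewrite ltrBrDl addrN divr_gt0.
have s20 : 0 <= 2 * s by lra.
have := ler_wpM2l s20 h; move: (ln _) => L; lra.
Qed.

Local Open Scope ereal_scope.

(** By [gamma_pdf_ratio] the two densities have th = (l1 / l2)^s times the second
    one as a common part; what is left of each has mass 1 - th, and this bounds
    their total variation distance. *)
Lemma gamma_mean_close s l1 l2 (g : R -> \bar R) : (1 < s)%R -> (0 < l1)%R ->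
  (l1 <= l2)%R -> measurable_fun setT g -> (forall x, 0 <= g x <= 1) ->
  \int[mu]_(x in D) (g x * (gamma_pdf s l1 x)%:E) <=
    \int[mu]_(x in D) (g x * (gamma_pdf s l2 x)%:E) + (1 - (l1 / l2) `^ s)%:E /\
  \int[mu]_(x in D) (g x * (gamma_pdf s l2 x)%:E) <=
    \int[mu]_(x in D) (g x * (gamma_pdf s l1 x)%:E) + (1 - (l1 / l2) `^ s)%:E.
Proof.
move=> s1 l10 le12 mg g01; have l20 : (0 < l2)%R by exact: lt_le_trans le12.
set th := ((l1 / l2) `^ s)%R.
have th0 : (0 <= th)%R by exact: powR_ge0.
have th1 : (th <= 1)%R.
  have h : (l1 / l2 <= 1)%R by rewrite ler_pdivrMr// mul1r.
  have e1 : (1 = 1 `^ s :> R)%R by rewrite powR1.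
  rewrite /th [leRHS]e1; apply: ge0_ler_powR => //; first lra.
  - by rewrite nnegrE divr_ge0// ltW.
  - by rewrite nnegrE.
have g0 x : 0 <= g x by case/andP: (g01 x).
have gE x : g x = (fine (g x))%:E.
  rewrite fineK// ge0_fin_numE//; case/andP: (g01 x) => _ /le_lt_trans; apply.
  exact: ltry.
have f0 x : (0 <= fine (g x))%R by exact: fine_ge0.
have f1 x : (fine (g x) <= 1)%R by rewrite -lee_fin -gE; case/andP: (g01 x).
have mgp (l : R) : measurable_fun (D : set R) (fun x : R => g x * (gamma_pdf s l x)%:E).
  apply: emeasurable_funM; last exact: measurable_gamma_pdfE.
  exact: measurable_funTS.
have mp (c l : R) : measurable_fun (D : set R) (fun x : R => c%:E * (gamma_pdf s l x)%:E).
  by apply: emeasurable_funM => //; exact: measurable_gamma_pdfE.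
have gp0 (l x : R) : 0 <= g x * (gamma_pdf s l x)%:E.
  by rewrite mule_ge0// lee_fin gamma_pdf_ge0.
have p0 (c l x : R) : (0 <= c)%R -> 0 <= c%:E * (gamma_pdf s l x)%:E.
  by move=> c0; rewrite mule_ge0 ?lee_fin ?gamma_pdf_ge0.
have ip (c l : R) : (0 <= c)%R -> (0 < l)%R ->
    \int[mu]_(x in D) (c%:E * (gamma_pdf s l x)%:E) = c%:E.
  move=> c0 l0; rewrite ge0_integralZl_EFin//; last 2 first.
  - by move=> x _; rewrite lee_fin gamma_pdf_ge0.
  - exact: measurable_gamma_pdfE.
  by rewrite integral_gamma_pdf// mule1.
have pt (x : R) : (D : set R) x -> (th * gamma_pdf s l2 x <= gamma_pdf s l1 x)%R.
  by rewrite /= in_itv/= andbT => x0; exact: gamma_pdf_ratio.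
split.
- have : \int[mu]_(x in D) (g x * (gamma_pdf s l1 x)%:E) + th%:E <=
      \int[mu]_(x in D) (g x * (gamma_pdf s l2 x)%:E) + 1.
    rewrite -(ip _ _ th0 l20) -[X in _ <= _ + X](ip _ _ ler01 l10).
    rewrite -!ge0_integralD; [|by []|by move=> x _; exact: gp0|exact: mgp
      |by move=> x _; exact: p0|exact: mp|by []|by move=> x _; exact: gp0
      |exact: mgp|by move=> x _; exact: p0|exact: mp].
    apply: ge0_le_integral => //.
    + by move=> x _; apply: adde_ge0 => //; exact: p0.
    + by apply: emeasurable_funD; [exact: mgp|exact: mp].
    + by apply: emeasurable_funD; [exact: mgp|exact: mp].
    + move=> x Dx; rewrite gE -!EFinM -!EFinD lee_fin.
      have h1 := pt x Dx; have h2 := f0 x; have h3 := f1 x.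
      have h4 := gamma_pdf_ge0 s l2 x.
      have h5 : (0 <= (1 - fine (g x)) * (gamma_pdf s l1 x - th * gamma_pdf s l2 x))%R.
        by apply: mulr_ge0; rewrite subr_ge0.
      have h6 : (0 <= fine (g x) * gamma_pdf s l2 x * (1 - th))%R.
        by apply: mulr_ge0; [exact: mulr_ge0|rewrite subr_ge0].
      nra.
  have : \int[mu]_(x in D) (g x * (gamma_pdf s l1 x)%:E) \is a fin_num.
    rewrite ge0_fin_numE; last by apply: integral_ge0 => x _.
    apply: (@le_lt_trans _ _ 1); last exact: ltry.
    rewrite -(ip _ _ ler01 l10); apply: ge0_le_integral; [by []
      |by move=> x _; exact: gp0|exact: mgp|exact: mp|].
    by move=> x _; rewrite gE -!EFinM lee_fin ler_wpM2r// gamma_pdf_ge0.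
  case: (\int[mu]_(x in D) (g x * (gamma_pdf s l1 x)%:E)) => // r1 _.
  case: (\int[mu]_(x in D) (g x * (gamma_pdf s l2 x)%:E)) => [r2| |].
  + by rewrite -!EFinD !lee_fin => ?; lra.
  + by rewrite !addye// !leey.
  + by rewrite !addNye leeNy_eq.
- have thC : (0 <= 1 - th)%R by rewrite subr_ge0.
  rewrite -(ip _ _ thC l20).
  rewrite -!ge0_integralD; [|by []|by move=> x _; exact: gp0|exact: mgp
    |by move=> x _; exact: p0|exact: mp].
  apply: ge0_le_integral; [by []|by move=> x _; exact: gp0|exact: mgp| |].
  + by apply: emeasurable_funD; [exact: mgp|exact: mp].
  + move=> x Dx; rewrite gE -!EFinM -!EFinD lee_fin.
    have h1 := ler_wpM2l (f0 x) (pt x Dx); have h2 := f1 x.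
    have h4 := gamma_pdf_ge0 s l2 x.
    have h5 : (0 <= (1 - fine (g x)) * ((1 - th) * gamma_pdf s l2 x))%R.
      by apply: mulr_ge0; [rewrite subr_ge0|exact: mulr_ge0].
    nra.
Qed.
End gamma_compare.

(** * Gaussian second moments *)

Section gauss_quadratic.
Context {R : realType} (n : nat).
Local Notation RT := (measurableTypeR R).
Local Open Scope ereal_scope.

Lemma measurable_thead_sqr : measurable_fun setT
  (fun z : n.+1.-tuple RT => ((thead z : R) ^+ 2)%:E).
Proof.
apply/measurable_EFinP; apply: measurable_funX; exact: measurable_tnth.
Qed.

Lemma integral_gauss_thead_sqr :
  \int[gauss_tuple n.+1]_z (((thead z : R) ^+ 2)%:E) <= 6%:E :> \bar R.
Proof.
rewrite ge0_integral_cons_measure//; last 2 first.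
- exact: measurable_thead_sqr.
- by move=> z; rewrite lee_fin sqr_ge0.
under eq_integral do under eq_integral do rewrite theadE.
under eq_integral do rewrite integral_gauss_cst.
exact: integral_normal_sqr.
Qed.

Lemma integral_gauss_sqr_eta :
  \int[gauss_tuple n.+1]_z ((sqr_eta z)%:E) <= (6 * n%:R)%:E :> \bar R.
Proof.
rewrite ge0_integral_cons_measure//; last 2 first.
- apply/measurable_EFinP; exact: measurable_sqr_eta.
- by move=> z; rewrite lee_fin sqr_eta_ge0.
rewrite [leLHS](_ : _ = \int[normal_prob 0 1]_(x in setT)
    \int[gauss_tuple n]_t (\sum_(i < n) (tnth t i : R) ^+ 2)%:E); last first.
  apply: eq_integral => x _; apply: eq_integral => t _.
  by rewrite /sqr_eta; under eq_bigr do rewrite tnthS.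
rewrite integral_cst// [X in _ * X](_ : _ = 1); last exact: probability_setT.
by rewrite mule1 integral_gauss_tuple_sqr.
Qed.

Lemma integral_gauss_quadratic (c0 c1 c2 : R) :
  (0 <= c0)%R -> (0 <= c1)%R -> (0 <= c2)%R ->
  \int[gauss_tuple n.+1]_z (c0 + c1 * (thead z : R) ^+ 2 + c2 * sqr_eta z)%:E <=
  (c0 + c1 * 6 + c2 * (6 * n%:R))%:E :> \bar R.
Proof.
move=> c00 c10 c20.
have ms : measurable_fun setT (fun z : n.+1.-tuple RT => (sqr_eta z)%:E).
  apply/measurable_EFinP; exact: measurable_sqr_eta.
have mt := measurable_thead_sqr.
under eq_integral do rewrite !EFinD !EFinM.
rewrite ge0_integralD//; first last.
- by apply: emeasurable_funM.
- by move=> z _; rewrite -EFinM lee_fin mulr_ge0// sqr_eta_ge0.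
- by apply: emeasurable_funD => //; exact: emeasurable_funM.
- by move=> z _; rewrite -EFinM -EFinD lee_fin addr_ge0// mulr_ge0// sqr_ge0.
rewrite ge0_integralD//; first last.
- by apply: emeasurable_funM.
- by move=> z _; rewrite -EFinM lee_fin mulr_ge0// sqr_ge0.
rewrite integral_gauss_cst !ge0_integralZl_EFin//; first last.
- by move=> z _; rewrite lee_fin sqr_ge0.
- by move=> z _; rewrite lee_fin sqr_eta_ge0.
rewrite !EFinD !EFinM; apply: leeD; last first.
  by apply: lee_wpmul2l; [rewrite lee_fin|exact: integral_gauss_sqr_eta].
apply: leeD => //.
by apply: lee_wpmul2l; [rewrite lee_fin|exact: integral_gauss_thead_sqr].
Qed.
End gauss_quadratic.

(** * Smoothing and contraction of the chain *)

Section contraction.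
Context {R : realType} {n r : nat}.
Local Notation RT := (measurableTypeR R).
Local Notation mu := (@lebesgue_measure R).
Local Notation D := (`]0%R, +oo[%classic : set R).
Variables (U a b : R) (y : 'M[R]_(n, r)).
Hypotheses (U0 : 0 < U) (b0 : 0 < b) (n0 : (0 < n)%N) (r0 : (0 < r)%N).
Local Notation rho := (r%:R * U).
Local Notation alpha := (a + n%:R / 2).
Local Notation tau := (Num.sqrt (2 * b)).
Hypothesis alpha2 : 2 < alpha.

Lemma tau_gt0 : 0 < tau. Proof. by rewrite sqrtr_gt0 mulr_gt0. Qed.

Lemma spread_gt0 (x : n.+1.-tuple RT) : 0 < spread b x.
Proof. exact: lt_le_trans tau_gt0 (spread_ge b x). Qed.

Lemma integral_eta_kernel_gamma x (f : n.+1.-tuple RT -> \bar R) :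
  measurable_fun setT f -> (forall z, 0 <= f z)%E ->
  (\int[eta_kernel U a b y x]_z f z = \int[mu]_(B in D)
    (eta_mean U y f B * (gamma_pdf alpha (2^-1 * spread b x ^+ 2) B)%:E))%E.
Proof.
move=> mf f0; rewrite (integral_eta_kernel a b y U0 r0 x mf f0).
by apply: eq_integral => B _; rewrite /B_cond_pdf -(rateE b0 x).
Qed.

(** The two Gamma distributions of B have rates spread^2 / 2, whose ratio is close
    to 1 when the spreads are close relative to their lower bound tau. The
    constant depends on n, but it only enters the factor M of the rate. *)
Lemma eta_kernel_smoothing (f : n.+1.-tuple RT -> \bar R) :
  measurable_fun setT f -> (forall x, 0 <= f x <= 1)%E -> forall x x',
  (\int[eta_kernel U a b y x]_z f z <= \int[eta_kernel U a b y x']_z f z +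
    (2 * alpha / tau * `|spread b x - spread b x'|)%:E)%E.
Proof.
move=> mf f01 x x'.
have f0 z : (0 <= f z)%E by case/andP: (f01 z).
have mg : measurable_fun setT (eta_mean U y f) by exact: measurable_eta_mean.
have g01 B : (0 <= eta_mean U y f B <= 1)%E.
  rewrite eta_mean_ge0//= -(integral_gauss_cst n.+1 (1%E : \bar R)).
  apply: ge0_le_integral => //.
  - by apply: (measurableT_comp mf); exact: measurable_eta_of.
  - by move=> z _; case/andP: (f01 (eta_of U y B z)).
have al1 : 1 < alpha by apply: lt_trans alpha2; rewrite ltr1n.
have main (t1 t2 : R) : tau <= t1 -> t1 <= t2 ->
    1 - ((2^-1 * t1 ^+ 2) / (2^-1 * t2 ^+ 2)) `^ alpha <= 2 * alpha / tau * (t2 - t1).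
  move=> le1 le12; have t10 : 0 < t1 := lt_le_trans tau_gt0 le1.
  have := gamma_ratio_ge al1 t10 le12.
  have h : 2 * alpha * (t2 - t1) / t1 <= 2 * alpha * (t2 - t1) / tau.
    rewrite ler_wpM2l ?lef_pV2 ?posrE ?tau_gt0//.
    by apply: mulr_ge0; [lra|rewrite subr_ge0].
  rewrite [2 * alpha / tau * _]mulrAC; lra.
have sq (t : R) : 0 < t -> 0 < 2^-1 * t ^+ 2 by move=> t0; rewrite mulr_gt0 ?exprn_gt0.
have sqle (t1 t2 : R) : 0 < t1 -> t1 <= t2 -> 2^-1 * t1 ^+ 2 <= 2^-1 * t2 ^+ 2.
  by move=> t0 le; rewrite ler_wpM2l// ler_pXn2r ?nnegrE ?(ltW t0)// (le_trans (ltW t0)).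
have Ex := integral_eta_kernel_gamma x mf f0.
have Ex' := integral_eta_kernel_gamma x' mf f0.
rewrite [leLHS]Ex.
rewrite [X in (_ <= X + _)%E]Ex'.
rewrite {Ex Ex'}.
have := spread_ge b x; have := spread_ge b x'.
have := spread_gt0 x; have := spread_gt0 x'.
move: (spread b x) (spread b x') => t1 t2 t20 t10 h2 h1.
have [le|/ltW le] := leP t1 t2.
  have [H _] := gamma_mean_close al1 (sq _ t10) (sqle _ _ t10 le) mg g01.
  apply: (le_trans H); rewrite leeD2l// lee_fin distrC ger0_norm ?subr_ge0//.
  exact: main.
have [_ H] := gamma_mean_close al1 (sq _ t20) (sqle _ _ t20 le) mg g01.
apply: (le_trans H); rewrite leeD2l// lee_fin ger0_norm ?subr_ge0//.
exact: main.
Qed.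

(** The mean Lipschitz constant, in the scale of [spread], of one step of the
    random map: the first two terms come from [slope] and [noise] with E u at
    most 2 (alpha + 1), the last one from the noise of eta_0, with E (1 / u) at
    most 2 / (alpha - 2). *)
Definition contraction_bound : R :=
  (4 / (rho * tau ^+ 3) * Num.sqrt (between y)
    + 7 / (rho * Num.sqrt rho * tau ^+ 3) * Num.sqrt n%:R) * (2 * (alpha + 1))
  + 21 / 4 * (Num.sqrt alpha * (2 / (alpha - 2)) + (Num.sqrt alpha)^-1).

Lemma normr_le_mean_sqr (x : R) : `|x| <= (1 + x ^+ 2) / 2.
Proof.
have := sqr_ge0 (`|x| - 1); rewrite sqrrB1 -normrX ger0_norm ?sqr_ge0// mulr2n; lra.
Qed.

Lemma sqrtr_le_mean (s m : R) : 0 <= s -> 0 < m ->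
  Num.sqrt s <= (s / Num.sqrt m + Num.sqrt m) / 2.
Proof.
move=> s0 m0; have m10 : 0 < Num.sqrt m by rewrite sqrtr_gt0.
have := sqr_ge0 (Num.sqrt s - Num.sqrt m).
rewrite sqrrB !sqr_sqrtr ?(ltW m0)// mulr2n => h.
rewrite ler_pdivlMr// -(ler_pM2r m10) mulrDl mulfVK ?gt_eqF//.
rewrite -[X in _ <= _ + X]expr2 sqr_sqrtr ?(ltW m0)//; lra.
Qed.

(** The two states share u and z and hence differ only through the three
    coefficients, which multiply vectors of norms sqrt between, |z_0| and
    |(z_1, ..., z_n)|. *)
Lemma spread_eta_of_lip (u t1 t2 : R) (z : n.+1.-tuple RT) :
  0 < u -> tau <= t1 -> tau <= t2 ->
  `|spread b (eta_of U y (u / (2^-1 * t1 ^+ 2)) z)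
    - spread b (eta_of U y (u / (2^-1 * t2 ^+ 2)) z)| <=
  `|t1 - t2| * (4 * u / (rho * tau ^+ 3) * Num.sqrt (between y)
   + 3 / Num.sqrt (2 * u) * `|thead z : R|
   + 2 * u / (rho * Num.sqrt rho * tau ^+ 3) * Num.sqrt (sqr_eta z)).
Proof.
move=> u0 h1 h2.
have t10 : 0 < t1 := lt_le_trans tau_gt0 h1.
have t20 : 0 < t2 := lt_le_trans tau_gt0 h2.
have rp : 0 < rho by exact: rho_gt0.
have bb : 0 <= 2 * b by rewrite mulr_ge0// ltW.
have sn : 0 < Num.sqrt n%:R :> R by rewrite sqrtr_gt0 ltr0n.
apply: (le_trans (sqrt_add_sqr_lip _ _ bb)).
set w1 := slope rho (u / (2^-1 * t1 ^+ 2)); set w2 := slope rho (u / (2^-1 * t2 ^+ 2)).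
set c1 := grand_sd rho (u / (2^-1 * t1 ^+ 2)); set c2 := grand_sd rho (u / (2^-1 * t2 ^+ 2)).
set k1 := noise rho (u / (2^-1 * t1 ^+ 2)); set k2 := noise rho (u / (2^-1 * t2 ^+ 2)).
rewrite (_ : (fun i : 'I_n => _) = fun i : 'I_n =>
    (w1 - w2) * (row_mean y i - grand_mean y) +
    ((w1 * c1 - w2 * c2) * - ((thead z : R) / Num.sqrt n%:R) +
     (k1 - k2) * (tnth z (lift ord0 i) : R))); last first.
  apply/funext => i; rewrite !eta_ofE// -/w1 -/w2 -/c1 -/c2 -/k1 -/k2.
  move: (row_mean y i) (grand_mean y) (thead z : R) (tnth z _ : R) (Num.sqrt _)^-1.
  move: w1 w2 c1 c2 k1 k2 => ? ? ? ? ? ? ? ? ? ? ?; ring.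
apply: (le_trans (enormD (fun i : 'I_n => _) (fun i : 'I_n => _))).
rewrite enormZ -addrA mulrDr; apply: lerD.
  rewrite mulrA; apply: ler_wpM2r; first exact: sqrtr_ge0.
  exact: (slope_lip rp u0 tau_gt0 h1 h2).
apply: (le_trans (enormD (fun i : 'I_n => _) (fun i : 'I_n => _))).
rewrite (enormZ (w1 * c1 - w2 * c2) (fun=> _)) enormZ mulrDr; apply: lerD.
  rewrite enorm_const//.
  by rewrite mulrA; apply: ler_wpM2r => //; exact: grand_sd_lip.
rewrite mulrA; apply: ler_wpM2r; first exact: sqrtr_ge0.
exact: (noise_lip rp u0 tau_gt0 h1 h2).
Qed.

Local Open Scope ereal_scope.

(** Average [spread_eta_of_lip] over z. First powers of norms are replaced by
    second moments, and 1 / sqrt u by (sqrt alpha / u + 1 / sqrt alpha) / 2,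
    which is sharp at u = alpha, where u concentrates. *)
Lemma eta_mean_lip (f : n.+1.-tuple RT -> \bar R) (l u t1 t2 : R) : (0 <= l)%R ->
  measurable_fun setT f -> (forall z, 0 <= f z) ->
  (forall z z', f z <= f z' + (l * `|spread b z - spread b z'|)%:E) ->
  (0 < u)%R -> (tau <= t1)%R -> (tau <= t2)%R ->
  eta_mean U y f (u / (2^-1 * t1 ^+ 2)) <= eta_mean U y f (u / (2^-1 * t2 ^+ 2)) +
   (l * `|t1 - t2| *
    ((4 / (rho * tau ^+ 3) * Num.sqrt (between y)
      + 7 / (rho * Num.sqrt rho * tau ^+ 3) * Num.sqrt n%:R) * u
     + 21 / 4 * Num.sqrt alpha * u^-1 + 21 / 4 / Num.sqrt alpha))%:E.
Proof.
move=> l0 mf f0 fl u0 h1 h2.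
set d := (l * `|t1 - t2|)%R; have d0 : (0 <= d)%R by rewrite mulr_ge0.
have t0 := tau_gt0.
have rp : (0 < rho)%R by exact: rho_gt0.
have rr : (0 < r%:R :> R)%R by rewrite ltr0n.
have sn : (0 < Num.sqrt n%:R :> R)%R by rewrite sqrtr_gt0 ltr0n.
have su : (0 < Num.sqrt (2 * u))%R by rewrite sqrtr_gt0 mulr_gt0.
have sr : (0 < Num.sqrt rho)%R by rewrite sqrtr_gt0.
set A := (4 * u / (rho * tau ^+ 3) * Num.sqrt (between y))%R.
set P := (3 / Num.sqrt (2 * u))%R.
set Q := (2 * u / (rho * Num.sqrt rho * tau ^+ 3))%R.
have t30 : (0 < tau ^+ 3)%R by rewrite exprn_gt0.
have A0 : (0 <= A)%R.
  apply: mulr_ge0; last exact: sqrtr_ge0.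
  by apply: ltW; rewrite divr_gt0 ?mulr_gt0.
have P0 : (0 <= P)%R by apply: ltW; rewrite divr_gt0.
have Q0 : (0 <= Q)%R by apply: ltW; rewrite divr_gt0 ?mulr_gt0.
(* |z_0| <= (1 + z_0^2) / 2 and |(z_i)| <= (|(z_i)|^2 / sqrt n + sqrt n) / 2: the
   quadratic bound c0 + c1 z_0^2 + c2 |(z_i)|^2 is of the right order in n *)
pose c0 := (d * (A + P / 2 + Q * Num.sqrt n%:R / 2))%R.
pose c1 := (d * (P / 2))%R.
pose c2 := (d * (Q / (2 * Num.sqrt n%:R)))%R.
have c00 : (0 <= c0)%R.
  apply: mulr_ge0 => //; apply: addr_ge0; first by apply: addr_ge0 => //; exact: divr_ge0.
  by apply: divr_ge0 => //; apply: mulr_ge0 => //; exact: ltW.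
have c10 : (0 <= c1)%R by apply: mulr_ge0 => //; exact: divr_ge0.
have c20 : (0 <= c2)%R.
  by apply: mulr_ge0 => //; apply: divr_ge0 => //; apply: ltW; rewrite mulr_gt0.
have mV B : measurable_fun setT (fun z => f (eta_of U y B z)).
  by apply: (measurableT_comp mf); exact: measurable_eta_of.
have mq : measurable_fun setT (fun z : n.+1.-tuple RT =>
    (c0 + c1 * (thead z : R) ^+ 2 + c2 * sqr_eta z)%:E).
  apply/measurable_EFinP; apply: measurable_funD.
    apply: measurable_funD => //; apply: measurable_funM => //.
    by apply: measurable_funX; exact: measurable_tnth.
  by apply: measurable_funM => //; exact: measurable_sqr_eta.
have q0 (z : n.+1.-tuple RT) : 0 <= (c0 + c1 * (thead z : R) ^+ 2 + c2 * sqr_eta z)%:E.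
  rewrite lee_fin; apply: addr_ge0; last by apply: mulr_ge0 => //; exact: sqr_eta_ge0.
  by apply: addr_ge0 => //; apply: mulr_ge0 => //; exact: sqr_ge0.
apply: (@le_trans _ _ (\int[gauss_tuple n.+1]_z (f (eta_of U y (u / (2^-1 * t2 ^+ 2)) z)
   + (c0 + c1 * (thead z : R) ^+ 2 + c2 * sqr_eta z)%:E))).
  apply: ge0_le_integral; [by []|by move=> z _; exact: f0|exact: mV| |].
    by apply: emeasurable_funD; [exact: mV|exact: mq].
  move=> z _; apply: (le_trans (fl _ (eta_of U y (u / (2^-1 * t2 ^+ 2)) z))).
  rewrite leeD2l// lee_fin.
  apply: (le_trans (ler_wpM2l l0 (spread_eta_of_lip z u0 h1 h2))).
  rewrite mulrA -/d -/A -/P -/Q.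
  have e1 := ler_wpM2l P0 (normr_le_mean_sqr (thead z : R)).
  have n00 : (0 < n%:R :> R)%R by rewrite ltr0n.
  have e2 := ler_wpM2l Q0 (sqrtr_le_mean (sqr_eta_ge0 z) n00).
  have -> : (c0 + c1 * (thead z : R) ^+ 2 + c2 * sqr_eta z = d * (A +
      P * ((1 + (thead z : R) ^+ 2) / 2) +
      Q * ((sqr_eta z / Num.sqrt n%:R + Num.sqrt n%:R) / 2)))%R.
    by rewrite /c0 /c1 /c2; field; rewrite gt_eqF.
  by rewrite ler_wpM2l//; apply: lerD => //; apply: lerD.
rewrite ge0_integralD; [|by []|by move=> z _; exact: f0|exact: mV
  |by move=> z _; exact: q0|exact: mq].
rewrite leeD2l//; apply: (le_trans (integral_gauss_quadratic n c00 c10 c20)).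
rewrite lee_fin.
have -> : (c0 + c1 * 6 + c2 * (6 * n%:R) =
    d * (A + P * (7 / 2) + Q * (7 / 2) * Num.sqrt n%:R))%R.
  rewrite -{1}[n%:R](@sqr_sqrtr R) ?ler0n// /c0 /c1 /c2; field; by rewrite gt_eqF.
rewrite ler_wpM2l// /A /Q.
have sa : (0 < Num.sqrt alpha)%R by rewrite sqrtr_gt0 (lt_trans _ alpha2).
have PB : (P * (7 / 2) <= 21 / 4 * Num.sqrt alpha * u^-1 + 21 / 4 / Num.sqrt alpha)%R.
  have u10 : (0 < Num.sqrt u)%R by rewrite sqrtr_gt0.
  have e1 : ((Num.sqrt (2 * u))^-1 <= (Num.sqrt u)^-1)%R.
    by rewrite lef_pV2 ?posrE// ler_wsqrtr//; lra.
  have e2 : ((Num.sqrt u)^-1 <= (Num.sqrt alpha * u^-1 + (Num.sqrt alpha)^-1) / 2)%R.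
    have uu : (u^-1 = (Num.sqrt u)^-1 ^+ 2)%R by rewrite exprVn sqr_sqrtr// ltW.
    rewrite uu -subr_ge0.
    move: (Num.sqrt alpha) (Num.sqrt u)^-1%R sa => S v S0.
    have -> : ((S * v ^+ 2 + S^-1) / 2 - v = (S * v - 1) ^+ 2 / (2 * S))%R.
      by field; rewrite gt_eqF.
    by apply: divr_ge0; [exact: sqr_ge0|apply: ltW; rewrite mulr_gt0].
  have e3 : ((Num.sqrt (2 * u))^-1 <= (Num.sqrt alpha * u^-1 + (Num.sqrt alpha)^-1) / 2)%R.
    exact: le_trans e2.
  rewrite /P; lra.
have -> : ((4 / (rho * tau ^+ 3) * Num.sqrt (between y)
      + 7 / (rho * Num.sqrt rho * tau ^+ 3) * Num.sqrt n%:R) * u =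
  4 * u / (rho * tau ^+ 3) * Num.sqrt (between y) +
  2 * u / (rho * Num.sqrt rho * tau ^+ 3) * (7 / 2) * Num.sqrt n%:R)%R.
  by field; rewrite !gt_eqF// ltr0n.
lra.
Qed.

Lemma eta_kernel_contracting (f : n.+1.-tuple RT -> \bar R) (l : R) : (0 <= l)%R ->
  measurable_fun setT f -> (forall z, 0 <= f z) ->
  (forall z z', f z <= f z' + (l * `|spread b z - spread b z'|)%:E) -> forall x x',
  \int[eta_kernel U a b y x]_z f z <= \int[eta_kernel U a b y x']_z f z +
    (contraction_bound * l * `|spread b x - spread b x'|)%:E.
Proof.
move=> l0 mf f0 fl x x'.
set d := (l * `|spread b x - spread b x'|)%R; have d0 : (0 <= d)%R by rewrite mulr_ge0.
have rp : (0 < rho)%R by exact: rho_gt0.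
have rr : (0 < r%:R :> R)%R by rewrite ltr0n.
have t0 := tau_gt0.
have sr : (0 < Num.sqrt rho)%R by rewrite sqrtr_gt0.
have sa : (0 < Num.sqrt alpha)%R by rewrite sqrtr_gt0 (lt_trans _ alpha2).
have mg : measurable_fun setT (eta_mean U y f) by exact: measurable_eta_mean.
have g0 B : 0 <= eta_mean U y f B by exact: eta_mean_ge0.
have rate0 (z : n.+1.-tuple RT) : (0 < 2^-1 * spread b z ^+ 2)%R.
  by apply: mulr_gt0 => //; apply: exprn_gt0; exact: spread_gt0.
have Ex := integral_eta_kernel_gamma x mf f0.
have Ex' := integral_eta_kernel_gamma x' mf f0.
rewrite [leLHS]Ex.
rewrite [X in (_ <= X + _)%E]Ex'.
rewrite {Ex Ex'}.
rewrite [leLHS](integral_gamma_pdf_scale alpha (rate0 x) mg g0).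
rewrite [X in (_ <= X + _)%E](integral_gamma_pdf_scale alpha (rate0 x') mg g0).
set k1 := (4 / (rho * tau ^+ 3) * Num.sqrt (between y)
    + 7 / (rho * Num.sqrt rho * tau ^+ 3) * Num.sqrt n%:R)%R.
set k2 := (21 / 4 * Num.sqrt alpha)%R; set k3 := (21 / 4 / Num.sqrt alpha)%R.
have k10 : (0 <= k1)%R.
  have t30 : (0 < tau ^+ 3)%R by rewrite exprn_gt0.
  by apply: addr_ge0; apply: mulr_ge0; rewrite ?sqrtr_ge0//; apply: ltW;
    rewrite divr_gt0 ?mulr_gt0.
have k20 : (0 <= k2)%R by apply: ltW; rewrite mulr_gt0.
have k30 : (0 <= k3)%R by apply: ltW; rewrite divr_gt0.
pose p u := (gamma_pdf alpha 1 u)%:E.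
have p0 u : 0 <= p u by rewrite lee_fin gamma_pdf_ge0.
have mp : measurable_fun D p by exact: measurable_gamma_pdfE.
have mgs (c : R) : measurable_fun D (fun u => eta_mean U y f (u / c)%R * p u).
  apply: emeasurable_funM => //; apply: measurable_funTS.
  by apply: (measurableT_comp mg); exact: measurable_funM.
have mid : measurable_fun D (fun u : R => u%:E).
  by apply: measurable_funTS; exact/measurable_EFinP.
have minv : measurable_fun D (fun u : R => u^-1%:E).
  by apply: measurable_funTS; apply/measurable_EFinP; exact: measurable_invr.
have pD u : D u -> (0 < u)%R by rewrite /= in_itv/= andbT.
pose q u := (d * k1)%:E * (u%:E * p u) + (d * k2)%:E * (u^-1%:E * p u) + (d * k3)%:E * p u.
have q1 u : D u -> 0 <= (d * k1)%:E * (u%:E * p u).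
  move=> /pD u0; apply: mule_ge0; first by rewrite lee_fin; exact: mulr_ge0.
  by apply: mule_ge0; [rewrite lee_fin ltW|exact: p0].
have q2 u : D u -> 0 <= (d * k2)%:E * (u^-1%:E * p u).
  move=> /pD u0; apply: mule_ge0; first by rewrite lee_fin; exact: mulr_ge0.
  by apply: mule_ge0; [rewrite lee_fin invr_ge0 ltW|exact: p0].
have q3 u : D u -> 0 <= (d * k3)%:E * p u.
  by move=> _; apply: mule_ge0; [rewrite lee_fin; exact: mulr_ge0|exact: p0].
have mq1 : measurable_fun D (fun u => (d * k1)%:E * (u%:E * p u)).
  by apply: emeasurable_funM => //; exact: emeasurable_funM.
have mq2 : measurable_fun D (fun u => (d * k2)%:E * (u^-1%:E * p u)).
  by apply: emeasurable_funM => //; exact: emeasurable_funM.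
have mq3 : measurable_fun D (fun u => (d * k3)%:E * p u).
  exact: emeasurable_funM.
have mq12 := emeasurable_funD mq1 mq2.
have mq : measurable_fun D q := emeasurable_funD mq12 mq3.
have q0 u : D u -> 0 <= q u.
  by move=> Du; apply: adde_ge0; [apply: adde_ge0; [exact: q1|exact: q2]|exact: q3].
apply: (@le_trans _ _ (\int[mu]_(u in D)
    (eta_mean U y f (u / (2^-1 * spread b x' ^+ 2))%R * p u + q u))).
  apply: ge0_le_integral; [by []|by move=> u _; apply: mule_ge0; [exact: g0|exact: p0]|exact: mgs| |].
    exact: (emeasurable_funD (mgs _) mq).
  move=> u Du; have u0 := pD u Du.
  apply: (le_trans (lee_wpmul2r (p0 u)
    (eta_mean_lip l0 mf f0 fl u0 (spread_ge b x) (spread_ge b x')))).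
  rewrite -/d -/k1 -/k2 -/k3 ge0_muleDl//; last first.
    rewrite lee_fin mulr_ge0// !addr_ge0//; rewrite mulr_ge0 ?invr_ge0 ?(ltW u0)//.
  rewrite leeD2l// /q /p -!EFinM -!EFinD lee_fin le_eqVlt; apply/orP; left; apply/eqP.
  by move: u^-1%R (gamma_pdf _ _ _) => *; ring.
rewrite ge0_integralD; [|by []|by move=> u _; apply: mule_ge0; [exact: g0|exact: p0]|exact: mgs
  |exact: q0|exact: mq].
rewrite leeD2l// /q.
rewrite ge0_integralD; [|by []|by move=> u Du; apply: adde_ge0; [exact: q1|exact: q2]
  |exact: mq12|exact: q3|exact: mq3].
rewrite ge0_integralD; [|by []|exact: q1|exact: mq1|exact: q2|exact: mq2].
have Z (c : R) (h : R -> \bar R) : (0 <= c)%R -> measurable_fun D h ->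
    (forall u, D u -> 0 <= h u) ->
    \int[mu]_(u in D) (c%:E * h u) = c%:E * \int[mu]_(u in D) h u.
  by move=> c0 mh h0; apply: ge0_integralZl_EFin.
rewrite (Z _ (fun u => u%:E * p u)); [|exact: mulr_ge0|exact: emeasurable_funM
  |by move=> u /pD u0; apply: mule_ge0; [rewrite lee_fin ltW|exact: p0]].
rewrite (Z _ (fun u => u^-1%:E * p u)); [|exact: mulr_ge0|exact: emeasurable_funM
  |by move=> u /pD u0; apply: mule_ge0; [rewrite lee_fin invr_ge0 ltW|exact: p0]].
rewrite (Z _ p); [|exact: mulr_ge0|exact: mp|by move=> u _; exact: p0].
have al1 : (1 < alpha)%R by apply: lt_trans alpha2; rewrite ltr1n.
rewrite (_ : \int[mu]_(u in D) p u = 1); last exact: integral_gamma_pdf.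
apply: (@le_trans _ _ ((d * k1)%:E * (2 * (alpha + 1))%:E
    + (d * k2)%:E * (2 / (alpha - 2))%:E + (d * k3)%:E * 1)).
  rewrite leeD2r//; apply: leeD; apply: lee_wpmul2l; rewrite ?lee_fin ?mulr_ge0//.
    exact: integral_gamma_pdf_id.
  exact: integral_gamma_pdf_inv.
rewrite mule1 -!EFinM -!EFinD lee_fin le_eqVlt; apply/orP; left; apply/eqP.
rewrite /contraction_bound -/k1 -mulrA -/d /k2 /k3; ring.
Qed.

End contraction.

(** * The two factorizations of the posterior density *)

Section factorization.
Context {R : realType} {n r : nat}.
Local Notation RT := (measurableTypeR R).
Variables (U a b : R) (y : 'M[R]_(n, r)).
Hypotheses (U0 : 0 < U) (b0 : 0 < b) (n0 : (0 < n)%N) (r0 : (0 < r)%N).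
Local Notation rho := (r%:R * U).
Local Notation alpha := (a + n%:R / 2).
Local Notation eta_ eta i := (tnth eta (lift ord0 i) : R).
Hypothesis alpha2 : 2 < alpha.

Let rp : 0 < rho. Proof. exact: rho_gt0. Qed.
Let rr : 0 < r%:R :> R. Proof. by rewrite ltr0n. Qed.
Let nn : 0 < n%:R :> R. Proof. by rewrite ltr0n. Qed.

Definition residual (eta : n.+1.-tuple RT) : R :=
  \sum_(i < n) \sum_(j < r)
    (y i j - (thead eta : R) / Num.sqrt n%:R - eta_ eta i) ^+ 2.

Definition within : R := \sum_(i < n) \sum_(j < r) (y i j - row_mean y i) ^+ 2.

Lemma row_meanK (i : 'I_n) : \sum_(j < r) y i j = r%:R * row_mean y i.
Proof. by rewrite /row_mean mulrC divfK// gt_eqF. Qed.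

Lemma sum_row_mean : \sum_(i < n) row_mean y i = n%:R * grand_mean y.
Proof.
rewrite /row_mean -mulr_suml /grand_mean; field.
by rewrite !gt_eqF.
Qed.

Lemma row_sum_sqr (i : 'I_n) (c : R) : \sum_(j < r) (y i j - c) ^+ 2 =
  \sum_(j < r) (y i j - row_mean y i) ^+ 2 + r%:R * (row_mean y i - c) ^+ 2.
Proof.
transitivity (\sum_(j < r) ((y i j - row_mean y i) ^+ 2 +
    (2 * (row_mean y i - c) * y i j +
      (c ^+ 2 - row_mean y i ^+ 2)))).
  by apply: eq_bigr => j _; ring.
rewrite big_split/= big_split/= -mulr_sumr row_meanK sumr_const card_ord -mulr_natr.
ring.
Qed.

Lemma between_sum_sqr (c : R) : \sum_(i < n) (row_mean y i - c) ^+ 2 =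
  between y + n%:R * (grand_mean y - c) ^+ 2.
Proof.
transitivity (\sum_(i < n) ((row_mean y i - grand_mean y) ^+ 2 +
    (2 * (grand_mean y - c) * row_mean y i + (c ^+ 2 - grand_mean y ^+ 2)))).
  by apply: eq_bigr => j _; ring.
rewrite big_split/= big_split/= -mulr_sumr sum_row_mean sumr_const card_ord -mulr_natr.
rewrite -/(between y); ring.
Qed.

(** Decompose the residual sum of squares within rows, complete the square in
    each eta_i, and split the remaining squares of row means between rows. *)
Lemma complete_squares (B : R) (eta : n.+1.-tuple RT) : 0 < B ->
  U * residual eta + B * sqr_eta eta =
  U * within + rho * B / (B + rho) *
    (between y + ((thead eta : R) - Num.sqrt n%:R * grand_mean y) ^+ 2)
  + (B + rho) * \sum_(i < n)
     (eta_ eta i - slope rho B * (row_mean y i - (thead eta : R) / Num.sqrt n%:R)) ^+ 2.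
Proof.
move=> B0; have Br : 0 < B + rho by rewrite addr_gt0.
set e0 := (thead eta : R); set s := Num.sqrt n%:R.
have s0 : 0 < s by rewrite sqrtr_gt0.
have ss : s ^+ 2 = n%:R by rewrite sqr_sqrtr// ltW.
have -> : residual eta = within + r%:R * \sum_(i < n) (row_mean y i - e0 / s - eta_ eta i) ^+ 2.
  rewrite /residual /within mulr_sumr -big_split/=; apply: eq_bigr => i _.
  transitivity (\sum_(j < r) (y i j - (e0 / s + eta_ eta i)) ^+ 2).
    by apply: eq_bigr => j _; rewrite opprD addrA.
  by rewrite row_sum_sqr opprD addrA.
have -> : (e0 - s * grand_mean y) ^+ 2 = n%:R * (grand_mean y - e0 / s) ^+ 2.
  by rewrite -ss; field; rewrite gt_eqF.
rewrite -between_sum_sqr mulrDr -!addrA; congr +%R.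
rewrite /sqr_eta mulrA !mulr_sumr -!big_split/=; apply: eq_bigr => i _.
by rewrite /slope; field; rewrite !gt_eqF.
Qed.

Definition B_weight (B : R) : R :=
  B `^ (alpha - 1) *
  expR (- (b * B) - (U * within + rho * B / (B + rho) * between y) / 2) /
  (normal_peak (grand_sd rho B) * normal_peak (noise rho B) ^+ n).

Lemma B_weight_gt0 B : 0 < B -> 0 < B_weight B.
Proof.
move=> B0; rewrite divr_gt0 ?mulr_gt0 ?powR_gt0 ?expR_gt0 ?exprn_gt0//.
  by rewrite normal_peak_gt0// gt_eqF// grand_sd_gt0.
by rewrite normal_peak_gt0// gt_eqF// noise_gt0.
Qed.

Lemma prod_normal_pdf (s : R) (m x : 'I_n -> R) : s != 0 ->
  \prod_(i < n) normal_pdf (m i) s (x i) =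
  normal_peak s ^+ n * expR (- ((\sum_(i < n) (x i - m i) ^+ 2) / (s ^+ 2 *+ 2))).
Proof.
move=> s0; under eq_bigr do rewrite normal_pdfE//.
rewrite big_split/= prodr_const card_ord; congr *%R.
rewrite mulr_suml -sumrN expR_sum; apply: eq_bigr => i _.
by rewrite /normal_fun mulNr.
Qed.

Lemma exponent_split (p B rh w v T X : R) : B != 0 -> rh != 0 -> B + rh != 0 ->
  - p - (w + rh * B / (B + rh) * (v + X) + (B + rh) * T) / 2 =
  - p - (w + rh * B / (B + rh) * v) / 2 + - X / ((B + rh) / (rh * B) *+ 2)
  + - (T / (1 / (B + rh) *+ 2)).
Proof. by move=> B' r' Br'; field; rewrite B' r' Br'. Qed.

Lemma posterior_weight_B (B : R) (eta : n.+1.-tuple RT) : 0 < B ->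
  posterior_weight U a b y (eta, B) = B_weight B * eta_cond_pdf U y B eta.
Proof.
move=> B0; have Br : 0 < B + rho by rewrite addr_gt0.
have g0 : 0 < grand_sd rho B by exact: grand_sd_gt0.
have h0 : 0 < noise rho B by exact: noise_gt0.
have gg : grand_sd rho B ^+ 2 = (B + rho) / (rho * B).
  by rewrite sqr_sqrtr// ltW// divr_gt0// mulr_gt0.
have hh : noise rho B ^+ 2 = 1 / (B + rho) by rewrite sqr_sqrtr// ltW// divr_gt0.
rewrite /posterior_weight B0 /eta_cond_pdf.
have -> : Num.sqrt ((B + rho) / (r%:R * B * U)) = grand_sd rho B.
  by rewrite /grand_sd mulrAC.
rewrite -/(noise rho B) -/(slope rho B) prod_normal_pdf ?gt_eqF//.
rewrite normal_pdfE ?gt_eqF// /normal_fun.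
have P0 := normal_peak_gt0 (lt0r_neq0 g0).
have Q0 := exprn_gt0 n (normal_peak_gt0 (lt0r_neq0 h0)).
rewrite /B_weight.
have E := complete_squares eta B0.
set e0 := (thead eta : R) in E *.
set T := \sum_(i < n) (_ - _) ^+ 2 in E *.
set e1 := expR (- (U / 2) * _ - _).
set e2 := expR (- (b * B) - _). set e3 := expR (- (_ - _) ^+ 2 / _).
set e4 := expR (- (T / _)).
have -> : e1 = e2 * e3 * e4.
  rewrite /e1 /e2 /e3 /e4 -!expRD; congr expR.
  rewrite -/(residual eta) -/(sqr_eta eta) gg hh.
  have -> : - (U / 2) * residual eta - B * (b + 2^-1 * sqr_eta eta) =
    - (b * B) - (U * residual eta + B * sqr_eta eta) / 2 by field.
  by rewrite E; apply: exponent_split; exact: lt0r_neq0.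
move: P0 Q0 => /lt0r_neq0 P0 /lt0r_neq0 Q0.
move: (normal_peak _) (_ ^+ n) P0 Q0 => P Q P0 Q0.
by field; rewrite P0 Q0.
Qed.

Definition eta_weight (eta : n.+1.-tuple RT) : R :=
  gamma_fun alpha / (b + 2^-1 * sqr_eta eta) `^ alpha *
  expR (- (U / 2) * residual eta).

Lemma eta_weight_ge0 eta : 0 <= eta_weight eta.
Proof.
have al1 : 1 < alpha by apply: lt_trans alpha2; rewrite ltr1n.
apply: mulr_ge0; last exact: expR_ge0.
by apply: divr_ge0; [exact/ltW/gamma_fun_gt0|exact: powR_ge0].
Qed.

Lemma posterior_weight_eta (B : R) (eta : n.+1.-tuple RT) : 0 < B ->
  posterior_weight U a b y (eta, B) = eta_weight eta * B_cond_pdf a b eta B.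
Proof.
move=> B0; rewrite /posterior_weight B0 /eta_weight /B_cond_pdf /gamma_pdf.
rewrite -/(residual eta) -/(sqr_eta eta).
have al1 : 1 < alpha by apply: lt_trans alpha2; rewrite ltr1n.
have G0 := lt0r_neq0 (gamma_fun_gt0 al1).
have p0 := lt0r_neq0 (powR_gt0 alpha (rate_gt0 b0 eta)).
rewrite expRD -(mulrC (b + _) B); move: (_ `^ alpha) (gamma_fun _) G0 p0 => G P P0 G0.
by move: (expR _) (expR _) (B `^ _) => *; field; rewrite P0 G0.
Qed.

End factorization.

(** * Stationarity of the posterior *)

Section mnormalize_integral.
Local Open Scope ereal_scope.
Context d (T : measurableType d) (R : realType).

Lemma ge0_integral_mnormalize (m : {measure set T -> \bar R})
    (P : probability T R) (f : T -> \bar R) :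
  m [set: T] != 0 -> m [set: T] < +oo ->
  measurable_fun setT f -> (forall x, 0 <= f x) ->
  \int[mnormalize m P]_x f x = (fine (m [set: T]))^-1%:E * \int[m]_x f x.
Proof.
move=> m0 moo mf f0.
have c0 : (0 <= (fine (m [set: T]))^-1)%R by rewrite invr_ge0 fine_ge0.
transitivity (\int[mscale (NngNum c0) m]_x f x).
  apply: eq_measure_integral => A mA _.
  rewrite /= /mnormalize ifF; last first.
    by apply/negbTE; rewrite negb_or; apply/andP; split; [exact: m0|rewrite lt_eqF].
  by rewrite /mscale/= muleC.
by rewrite ge0_integral_mscale.
Qed.
End mnormalize_integral.

Section posterior_integral.
Context {R : realType} {n r : nat}.
Local Notation RT := (measurableTypeR R).
Local Notation mu := (@lebesgue_measure R).
Local Notation D := (`]0%R, +oo[%classic : set R).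
Variables (U a b : R) (y : 'M[R]_(n, r)).
Hypotheses (U0 : 0 < U) (b0 : 0 < b) (n0 : (0 < n)%N) (r0 : (0 < r)%N).
Local Notation rho := (r%:R * U).
Local Notation alpha := (a + n%:R / 2).
Local Notation tau := (Num.sqrt (2 * b)).
Hypothesis alpha2 : 2 < alpha.
Local Notation eta_ eta i := (tnth eta (lift ord0 i) : R).
Local Notation leb := (lebesgue_tuple R n.+1).
Local Notation weight := (posterior_weight U a b y).

Lemma measurable_residual : measurable_fun setT (@residual R n r y).
Proof.
apply: measurable_sum => i; apply: measurable_sum => j; apply: measurable_funX.
apply: measurable_funB; last exact: measurable_tnth.
by apply: measurable_funB => //; apply: measurable_funM => //; exact: measurable_tnth.
Qed.

Lemma measurable_posterior_weight : measurable_fun setT weight.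
Proof.
have m2 : measurable_fun setT (fun z : n.+1.-tuple RT * RT => z.2 : R) by exact: measurable_snd.
have mS := measurableT_comp (@measurable_sqr_eta R n)
  (@measurable_fst _ _ (n.+1.-tuple RT) RT).
have mr := measurableT_comp measurable_residual
  (@measurable_fst _ _ (n.+1.-tuple RT) RT).
rewrite (_ : weight = fun z => if 0 < (z.2 : R) then
    (z.2 : R) `^ (alpha - 1) * expR (- (U / 2) * residual y z.1
      - (z.2 : R) * (b + 2^-1 * sqr_eta z.1)) else 0); last by apply/funext => -[].
apply: measurable_fun_ifT => //; first exact: measurable_fun_ltr.
apply: measurable_funM; first exact: (measurableT_comp (measurable_powR _) m2).
apply: (measurableT_comp (@measurable_expR R)).
apply: measurable_funB; first exact: measurable_funM.
apply: measurable_funM => //; apply: measurable_funD => //.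
exact: measurable_funM.
Qed.

Lemma posterior_weight_ge0 z : 0 <= weight z.
Proof.
case: z => eta B /=; case: ifP => // _.
by apply: mulr_ge0; [exact: powR_ge0|exact: expR_ge0].
Qed.

Local Open Scope ereal_scope.

Lemma integral_posterior_mass (F : n.+1.-tuple RT * RT -> \bar R) :
  measurable_fun setT F -> (forall z, 0 <= F z) ->
  \int[posterior_mass U a b y]_z F z =
  \int[leb]_x \int[mu]_(B in D) (F (x, B) * (weight (x, B))%:E).
Proof.
move=> mF F0.
have mw : measurable_fun setT (fun z => (weight z)%:E).
  by apply/measurable_EFinP; exact: measurable_posterior_weight.
rewrite [LHS](@ge0_integral_density _ _ _ (leb \x mu)%E _ (fun z => (weight z)%:E) mw)//;
  last by move=> z; rewrite lee_fin posterior_weight_ge0.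
have mFw := emeasurable_funM mF mw.
have Fw0 z : 0 <= F z * (weight z)%:E.
  by apply: mule_ge0 => //; rewrite lee_fin posterior_weight_ge0.
rewrite [LHS](fubini_tonelli1 _ mFw Fw0).
apply: eq_integral => x _; rewrite [RHS]integral_mkcond; apply: eq_integral => B _.
rewrite patchE; case: ifPn => // /negP h.
rewrite /posterior_weight ifF ?mule0//; apply/negbTE/negP => B0.
by apply: h; rewrite inE/= in_itv/= andbT.
Qed.

Lemma integral_posterior_mass_swap (F : n.+1.-tuple RT * RT -> \bar R) :
  measurable_fun setT F -> (forall z, 0 <= F z) ->
  \int[posterior_mass U a b y]_z F z =
  \int[mu]_(B in D) \int[leb]_x (F (x, B) * (weight (x, B))%:E).
Proof.
move=> mF F0; rewrite [LHS]integral_posterior_mass//.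
apply: (@tonelli_on _ _ _ _ _ leb mu D (fun z => F z * (weight z)%:E)) => //.
- apply: emeasurable_funM => //; apply/measurable_EFinP.
  exact: measurable_posterior_weight.
- by move=> z; apply: mule_ge0 => //; rewrite lee_fin posterior_weight_ge0.
Qed.

Lemma measurable_eta_cond_slice (B : R) :
  measurable_fun setT (fun x : n.+1.-tuple RT => (eta_cond_pdf U y B x)%:E).
Proof. by apply/measurable_EFinP; exact: measurable_eta_cond_pdf. Qed.

Lemma integral_posterior_mass_eta (f : n.+1.-tuple RT -> \bar R) :
  measurable_fun setT f -> (forall z, 0 <= f z) ->
  \int[posterior_mass U a b y]_z f z.1 =
  \int[mu]_(B in D) ((B_weight U a b y B)%:E * eta_mean U y f B).
Proof.
move=> mf f0.
rewrite [LHS](@integral_posterior_mass_swap (fun z => f z.1))//; last first.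
  exact: measurableT_comp.
apply: eq_integral => B /mem_itv_gt0 B0.
rewrite /eta_mean -(integral_eta_cond_pdf y U0 r0 B0 mf f0).
rewrite -ge0_integralZl_EFin//; last 3 first.
- by move=> x _; apply: mule_ge0 => //; rewrite lee_fin eta_cond_pdf_ge0.
- by apply: emeasurable_funM => //; exact: measurable_eta_cond_slice.
- by apply: ltW; exact: B_weight_gt0.
by apply: eq_integral => x _; rewrite posterior_weight_B// EFinM /= muleCA.
Qed.

Lemma integral_posterior_mass_B (g : R -> \bar R) :
  measurable_fun setT g -> (forall B, 0 <= g B) ->
  \int[posterior_mass U a b y]_z g z.2 =
  \int[mu]_(B in D) ((B_weight U a b y B)%:E * g B).
Proof.
move=> mg g0.
rewrite [LHS](@integral_posterior_mass_swap (fun z => g z.2))//; last first.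
  exact: (measurableT_comp mg measurable_snd).
apply: eq_integral => B /mem_itv_gt0 B0.
transitivity (\int[leb]_x (((B_weight U a b y B)%:E * g B) * (eta_cond_pdf U y B x)%:E)).
  apply: eq_integral => x _; rewrite posterior_weight_B// EFinM /=.
  by rewrite -muleA muleCA.
have w0 : 0 <= (B_weight U a b y B)%:E * g B.
  by apply: mule_ge0 => //; rewrite lee_fin ltW// B_weight_gt0.
rewrite [LHS](@integral_eta_cond_pdf _ _ _ _ y U0 r0 B
  (fun=> (B_weight U a b y B)%:E * g B))//.
exact: integral_gauss_cst.
Qed.

(** Both sides are the integral of [eta_mean f] under the marginal law of B: the
    left one because eta_weight times B_cond_pdf is the joint density, the right
    one because B_weight times eta_cond_pdf is. *)
Lemma integral_posterior_mass_stationary (f : n.+1.-tuple RT -> \bar R) :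
  measurable_fun setT f -> (forall z, 0 <= f z) ->
  \int[posterior_mass U a b y]_z (\int[eta_kernel U a b y z.1]_x f x) =
  \int[posterior_mass U a b y]_z f z.1.
Proof.
move=> mf f0.
have mK : measurable_fun setT (fun x => \int[eta_kernel U a b y x]_x' f x').
  by apply: measurable_fun_integral_kernel => // A mA; exact: measurable_kernel.
have K0 x : 0 <= \int[eta_kernel U a b y x]_x' f x' by exact: integral_ge0.
have mg : measurable_fun setT (eta_mean U y f) by exact: measurable_eta_mean.
have g0 B : 0 <= eta_mean U y f B by exact: eta_mean_ge0.
rewrite [RHS](integral_posterior_mass_eta mf f0) -[RHS](integral_posterior_mass_B mg g0).
have mK1 : measurable_fun setT
    (fun z : n.+1.-tuple RT * RT => \int[eta_kernel U a b y z.1]_x' f x').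
  exact: (measurableT_comp mK measurable_fst).
have mg2 : measurable_fun setT
    (fun z : n.+1.-tuple RT * RT => eta_mean U y f z.2).
  exact: (measurableT_comp mg measurable_snd).
rewrite [LHS](integral_posterior_mass mK1 (fun z => K0 z.1)).
rewrite [RHS](integral_posterior_mass mg2 (fun z => g0 z.2)).
apply: eq_integral => x _.
have al1 : (1 < alpha)%R by apply: lt_trans alpha2; rewrite ltr1n.
have W0 : (0 <= eta_weight U a b y x)%R by exact: eta_weight_ge0.
have mp : measurable_fun D (fun B => (B_cond_pdf a b x B)%:E).
  exact: measurable_gamma_pdfE.
have p0 B : 0 <= (B_cond_pdf a b x B)%:E by rewrite lee_fin gamma_pdf_ge0.
transitivity (\int[eta_kernel U a b y x]_x' f x' * (eta_weight U a b y x)%:E).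
  transitivity (\int[mu]_(B in D) ((\int[eta_kernel U a b y x]_x' f x' *
      (eta_weight U a b y x)%:E) * (B_cond_pdf a b x B)%:E)).
    apply: eq_integral => B /mem_itv_gt0 B0.
    by rewrite posterior_weight_eta// EFinM muleA.
  rewrite ge0_integralZl//; last by apply: mule_ge0.
  rewrite [X in _ * X](_ : _ = 1) ?mule1//.
  by apply: integral_gamma_pdf => //; exact: rate_gt0.
rewrite [X in X * _](integral_eta_kernel a b y U0 r0 x mf f0).
rewrite -ge0_integralZr//; last 2 first.
- apply: emeasurable_funM => //; exact: measurable_funTS.
- by move=> B _; exact: mule_ge0.
apply: eq_integral => B /mem_itv_gt0 B0.
by rewrite posterior_weight_eta// EFinM -muleA [X in _ * X]muleC.
Qed.

End posterior_integral.

(** * Posterior moments and the rate for fixed n *)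

Section fixed_n.
Context {R : realType} {n r : nat}.
Local Notation RT := (measurableTypeR R).
Local Notation mu := (@lebesgue_measure R).
Local Notation D := (`]0%R, +oo[%classic : set R).
Variables (U a b : R) (y : 'M[R]_(n, r)).
Hypotheses (U0 : 0 < U) (b0 : 0 < b) (n0 : (0 < n)%N) (r0 : (0 < r)%N).
Local Notation rho := (r%:R * U).
Local Notation alpha := (a + n%:R / 2).
Local Notation tau := (Num.sqrt (2 * b)).
Hypothesis alpha2 : 2 < alpha.
Local Notation eta_ eta i := (tnth eta (lift ord0 i) : R).

Let rp : 0 < rho. Proof. exact: rho_gt0. Qed.
Let sr : 0 < Num.sqrt rho. Proof. by rewrite sqrtr_gt0. Qed.

Lemma slope_itv01 B : 0 < B -> 0 <= slope rho B <= 1.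
Proof.
move=> B0; have Br : 0 < B + rho by rewrite addr_gt0.
by rewrite /slope divr_ge0 ?(ltW rp) ?(ltW Br)//= ler_pdivrMr// mul1r lerDr ltW.
Qed.

Lemma noise_le B : 0 < B -> noise rho B <= (Num.sqrt rho)^-1.
Proof.
move=> B0; rewrite -sqrtrV ?(ltW rp)// /noise ler_wsqrtr// div1r.
by rewrite lef_pV2 ?posrE ?addr_gt0// lerDr ltW.
Qed.

Lemma spread_eta_of_le B (z : n.+1.-tuple RT) : 0 < B ->
  spread b (eta_of U y B z) <= tau + (Num.sqrt (between y) +
    (grand_sd rho B * `|thead z : R| + (Num.sqrt rho)^-1 * Num.sqrt (sqr_eta z))).
Proof.
move=> B0.
have bb : 0 <= 2 * b by rewrite mulr_ge0// ltW.
have sn : 0 < Num.sqrt n%:R :> R by rewrite sqrtr_gt0 ltr0n.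
have /andP[w0 w1] := slope_itv01 B0.
have g0 := ltW (grand_sd_gt0 U0 r0 B0).
have h0 := ltW (noise_gt0 U0 r0 B0).
have := sqrt_add_sqr_lip (fun i : 'I_n => eta_ (eta_of U y B z) i) (fun=> 0) bb.
rewrite [X in Num.sqrt (_ + X)](_ : _ = sqr_eta (eta_of U y B z))//.
have -> : 2 * b + \sum_(i < n) (0 : R) ^+ 2 = 2 * b.
  by rewrite big1 ?addr0// => i _; rewrite expr0n.
rewrite -/(spread b (eta_of U y B z)) => /(le_trans (ler_norm _)).
rewrite lerBlDl => /le_trans; apply; rewrite lerD2l.
rewrite (_ : (fun i : 'I_n => _) = fun i : 'I_n =>
    slope rho B * (row_mean y i - grand_mean y) +
    ((slope rho B * grand_sd rho B) * - ((thead z : R) / Num.sqrt n%:R) +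
     noise rho B * (tnth z (lift ord0 i) : R))); last first.
  by apply/funext => i; rewrite eta_ofE// subr0.
apply: (le_trans (enormD (fun i : 'I_n => _) (fun i : 'I_n => _))).
rewrite enormZ; apply: lerD.
  by rewrite ger0_norm// ler_piMl// sqrtr_ge0.
apply: (le_trans (enormD (fun i : 'I_n => _) (fun i : 'I_n => _))).
rewrite (enormZ (slope rho B * grand_sd rho B) (fun=> _)) enormZ; apply: lerD.
  rewrite enorm_const//.
  apply: ler_wpM2r => //; rewrite ger0_norm; last exact: mulr_ge0.
  exact: ler_piMl.
apply: ler_wpM2r; first exact: sqrtr_ge0.
by rewrite ger0_norm// noise_le.
Qed.

(** The part of the bound on the mean spread given B that is free of B. *)
Definition spread_const : R :=
  tau + Num.sqrt (between y) + (1 + 6 * n%:R) / (2 * Num.sqrt rho).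

Lemma spread_const_ge0 : 0 <= spread_const.
Proof.
apply: addr_ge0; first by apply: addr_ge0; exact: sqrtr_ge0.
apply: divr_ge0; first by rewrite addr_ge0// mulr_ge0.
by apply: mulr_ge0 => //; exact: sqrtr_ge0.
Qed.

Lemma eta_mean_spread_le B : 0 < B ->
  (eta_mean U y (fun x => (spread b x)%:E) B <=
   (spread_const + 7 / 2 * grand_sd rho B)%:E)%E.
Proof.
move=> B0; have g0 := ltW (grand_sd_gt0 U0 r0 B0).
pose q := (2 * Num.sqrt rho)^-1; have q0 : 0 <= q by rewrite invr_ge0 mulr_ge0// ltW.
pose c0 := tau + Num.sqrt (between y) + grand_sd rho B / 2 + q.
pose c1 := grand_sd rho B / 2.
have c00 : 0 <= c0.
  apply: addr_ge0 => //; apply: addr_ge0; last exact: divr_ge0.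
  by apply: addr_ge0; exact: sqrtr_ge0.
have c10 : 0 <= c1 by exact: divr_ge0.
apply: (le_trans _ (le_trans (integral_gauss_quadratic n c00 c10 q0) _)); last first.
  rewrite lee_fin le_eqVlt; apply/orP; left; apply/eqP.
  rewrite /c0 /c1 /q /spread_const; field; exact: lt0r_neq0.
apply: ge0_le_integral => //.
- by move=> z _; rewrite lee_fin spread_ge0.
- apply/measurable_EFinP; apply: (measurableT_comp (measurable_spread b)).
  exact: measurable_eta_of.
- apply/measurable_EFinP; apply: measurable_funD.
    apply: measurable_funD => //; apply: measurable_funM => //.
    by apply: measurable_funX; exact: measurable_tnth.
  by apply: measurable_funM => //; exact: measurable_sqr_eta.
move=> z _; rewrite lee_fin; apply: (le_trans (spread_eta_of_le z B0)).
have e1 := ler_wpM2l g0 (normr_le_mean_sqr (thead z : R)).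
have s0 := sqrtr_ge0 (sqr_eta z).
have e2 : Num.sqrt (sqr_eta z) <= (1 + sqr_eta z) / 2.
  have := normr_le_mean_sqr (Num.sqrt (sqr_eta z)).
  by rewrite ger0_norm// sqr_sqrtr ?sqr_eta_ge0.
have sr0 : 0 <= (Num.sqrt rho)^-1 by rewrite invr_ge0 ltW.
have e3 := ler_wpM2l sr0 e2.
have -> : c0 + c1 * (thead z : R) ^+ 2 + q * sqr_eta z =
    tau + (Num.sqrt (between y) + (grand_sd rho B * ((1 + (thead z : R) ^+ 2) / 2) +
      (Num.sqrt rho)^-1 * ((1 + sqr_eta z) / 2))).
  by rewrite /c0 /c1 /q; field; exact: lt0r_neq0.
by rewrite !lerD2l; exact: lerD.
Qed.

Lemma normal_peakV (s : R) : 0 < s -> (normal_peak s)^-1 = s * Num.sqrt (pi *+ 2).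
Proof.
move=> s0; rewrite /normal_peak invrK.
rewrite -[X in Num.sqrt X]mulrnAr sqrtrM ?sqr_ge0// sqrtr_sqr ger0_norm//; exact: ltW.
Qed.

Definition weight_const : R :=
  Num.sqrt (pi *+ 2) * ((Num.sqrt rho)^-1 * Num.sqrt (pi *+ 2)) ^+ n.

Lemma weight_const_ge0 : 0 <= weight_const.
Proof.
apply: mulr_ge0; first exact: sqrtr_ge0.
by apply: exprn_ge0; apply: mulr_ge0; rewrite ?invr_ge0 sqrtr_ge0.
Qed.

Lemma B_weight_le B : 0 < B ->
  B_weight U a b y B <= weight_const * (grand_sd rho B * gamma_kern alpha b B).
Proof.
move=> B0; have g0 := grand_sd_gt0 U0 r0 B0; have h0 := noise_gt0 U0 r0 B0.
have Br : 0 < B + rho by rewrite addr_gt0.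
rewrite /B_weight invfM -exprVn !normal_peakV// /gamma_kern.
have e1 : expR (- (b * B) - (U * within y + rho * B / (B + rho) * between y) / 2) <=
    expR (- (b * B)).
  rewrite ler_expR lerBlDr lerDl divr_ge0// addr_ge0//.
    apply: mulr_ge0; first exact: ltW.
    by apply: sumr_ge0 => i _; apply: sumr_ge0 => j _; exact: sqr_ge0.
  apply: mulr_ge0; last by apply: sumr_ge0 => i _; exact: sqr_ge0.
  by apply: divr_ge0; [apply: mulr_ge0|]; exact: ltW.
have e2 : (noise rho B * Num.sqrt (pi *+ 2)) ^+ n <=
    ((Num.sqrt rho)^-1 * Num.sqrt (pi *+ 2)) ^+ n.
  have pp := sqrtr_ge0 (pi *+ 2 : R).
  apply: lerXn2r; rewrite ?nnegrE ?mulr_ge0 ?invr_ge0 ?(ltW h0) ?(ltW sr)//.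
  by apply: ler_wpM2r => //; exact: noise_le.
rewrite /weight_const.
set P := Num.sqrt (pi *+ 2).
have P0 : 0 <= P by exact: sqrtr_ge0.
have -> : P * ((Num.sqrt rho)^-1 * P) ^+ n *
    (grand_sd rho B * (B `^ (alpha - 1) * expR (- (b * B)))) =
    (B `^ (alpha - 1) * expR (- (b * B))) *
    ((grand_sd rho B * P) * ((Num.sqrt rho)^-1 * P) ^+ n) by ring.
apply: ler_pM.
- by apply: mulr_ge0; [exact: powR_ge0|exact: expR_ge0].
- apply: mulr_ge0; first by apply: mulr_ge0 => //; exact: ltW.
  by apply: exprn_ge0; apply: mulr_ge0 => //; exact: ltW.
- by apply: ler_wpM2l => //; exact: powR_ge0.
- by apply: ler_wpM2l => //; apply: mulr_ge0 => //; exact: ltW.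
Qed.

Lemma measurable_B_weight : measurable_fun setT (B_weight U a b y).
Proof.
apply: measurable_funM.
  apply: measurable_funM; first exact: measurable_powR.
  apply: (measurableT_comp (@measurable_expR R)); apply: measurable_funB.
    by apply: measurableT_comp => //; exact: measurable_funM.
  apply: measurable_funM => //; apply: measurable_funD => //.
  apply: measurable_funM => //; apply: measurable_funM; first exact: measurable_funM.
  by apply: measurable_funVr; exact: measurable_funD.
apply: measurable_funVr.
have mp (s : R -> R) : measurable_fun setT s ->
    measurable_fun setT (fun B => normal_peak (s B)).
  move=> ms; apply: measurable_funVr; apply: (measurableT_comp measurable_sqrtr).
  have : measurable_fun setT (fun B => s B ^+ 2 * (pi *+ 2)).
    by apply: measurable_funM => //; exact: measurable_funX.
  by under eq_fun do rewrite mulrnAr.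
apply: measurable_funM; first by apply: mp; exact: measurable_grand_sd.
by apply: measurable_funX; apply: mp; exact: measurable_noise.
Qed.

Local Open Scope ereal_scope.

(** The weight of B is at most a multiple of grand_sd B times a Gamma kernel, and
    the mean of the spread is affine in grand_sd B. As grand_sd B ^ 2 is
    1 / rho + 1 / B, the singularity at B = 0 costs one unit of shape. The
    summand 1 gives at the same time the finiteness of the total mass. *)
Lemma posterior_moment_lty :
  \int[mu]_(B in D) ((B_weight U a b y B)%:E *
    (1 + eta_mean U y (fun x => (spread b x)%:E) B)) < +oo.
Proof.
have k0 := spread_const_ge0; have W0 := weight_const_ge0.
(* with g = grand_sd rho B and k = spread_const, the coefficient comes from
   g (1 + k + 7/2 g) <= (4 + k) (1 + g^2) and 1 + g^2 <= (1 + 1/rho) (1 + 1/B) *)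
pose K := (weight_const * (4 + spread_const) * (1 + rho^-1))%R.
have ri : (0 < rho^-1)%R by rewrite invr_gt0.
have K0 : (0 <= K)%R.
  by apply: mulr_ge0; [apply: mulr_ge0 => //; apply: addr_ge0|apply: addr_ge0 => //; exact: ltW].
have ms : measurable_fun setT (fun x : n.+1.-tuple RT => (spread b x)%:E).
  by apply/measurable_EFinP; exact: measurable_spread.
have s0 (x : n.+1.-tuple RT) : 0 <= (spread b x)%:E by rewrite lee_fin spread_ge0.
have mm := measurable_eta_mean U y ms s0.
apply: (@le_lt_trans _ _ (\int[mu]_(B in D)
    (K%:E * ((gamma_kern alpha b B)%:E + (gamma_kern (alpha - 1) b B)%:E)))).
  apply: ge0_le_integral.
  - by [].
  - move=> B; rewrite /= in_itv/= andbT => B0.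
    apply: mule_ge0; first by rewrite lee_fin ltW// B_weight_gt0.
    by apply: adde_ge0 => //; exact: eta_mean_ge0.
  - apply: measurable_funTS; apply: emeasurable_funM.
      by apply/measurable_EFinP; exact: measurable_B_weight.
    exact: emeasurable_funD.
  - apply: emeasurable_funM => //.
    by apply: emeasurable_funD; exact: measurable_gamma_kernE.
  move=> B; rewrite /= in_itv/= andbT => B0.
  have w0 := ltW (B_weight_gt0 a b y U0 r0 B0).
  apply: (le_trans (lee_wpmul2l _ (leeD2l 1 (eta_mean_spread_le B0)))).
    by rewrite lee_fin.
  rewrite -EFinD -EFinM -EFinD -EFinM lee_fin.
  have g0 := grand_sd_gt0 U0 r0 B0.
  have kk := gamma_kern_ge0 (alpha - 1) b B.
  have kE : (gamma_kern alpha b B = B * gamma_kern (alpha - 1) b B)%R.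
    by rewrite -gamma_kernS// subrK.
  have m0 : (0 <= 1 + (spread_const + 7 / 2 * grand_sd rho B))%R.
    by rewrite !addr_ge0// mulr_ge0// ltW.
  apply: (le_trans (ler_wpM2r m0 (B_weight_le B0))).
  rewrite kE.
  have gg : (grand_sd rho B ^+ 2 = rho^-1 + B^-1)%R.
    rewrite sqr_sqrtr; last by apply: ltW; rewrite divr_gt0 ?mulr_gt0 ?addr_gt0 ?ltr0n.
    by field; rewrite !gt_eqF// ltr0n.
  have key : (grand_sd rho B * (1 + (spread_const + 7 / 2 * grand_sd rho B)) <=
      (4 + spread_const) * (1 + rho^-1) * (1 + B^-1))%R.
    have iB : (0 < B^-1)%R by rewrite invr_gt0.
    move: (grand_sd rho B) spread_const gg k0 g0 => s k gg k0 g0.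
    have h1 : (s <= (1 + s ^+ 2) / 2)%R by have := sqr_ge0 (s - 1); nra.
    have h2 : (s * (1 + (k + 7 / 2 * s)) <= (4 + k) * (1 + s ^+ 2))%R by nra.
    apply: (le_trans h2); rewrite -mulrA ler_wpM2l ?addr_ge0// gg.
    have := mulr_gt0 ri iB; nra.
  have -> : (weight_const * (grand_sd rho B * (B * gamma_kern (alpha - 1) b B)) *
      (1 + (spread_const + 7 / 2 * grand_sd rho B)) =
      weight_const * (B * gamma_kern (alpha - 1) b B) *
      (grand_sd rho B * (1 + (spread_const + 7 / 2 * grand_sd rho B))))%R by ring.
  have -> : (K * (B * gamma_kern (alpha - 1) b B + gamma_kern (alpha - 1) b B) =
     weight_const * (B * gamma_kern (alpha - 1) b B) *
      ((4 + spread_const) * (1 + rho^-1) * (1 + B^-1)))%R.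
    by rewrite /K; move: rho^-1%R => *; field; rewrite gt_eqF.
  apply: ler_wpM2l => //; apply: mulr_ge0 => //; apply: mulr_ge0 => //; exact: ltW.
have mk (t : R) : measurable_fun D (fun B => (gamma_kern t b B)%:E).
  exact: measurable_gamma_kernE.
have k00 (t B : R) : 0 <= (gamma_kern t b B)%:E by rewrite lee_fin gamma_kern_ge0.
rewrite ge0_integralZl_EFin; [|by []|by move=> B _; apply: adde_ge0; exact: k00
  |by apply: emeasurable_funD; exact: mk|by []].
rewrite ge0_integralD; [|by []|by move=> B _; exact: k00|exact: mk
  |by move=> B _; exact: k00|exact: mk].
rewrite -/(gamma_int _ _) -/(gamma_int (alpha - 1) b).
have al1 : (1 < alpha)%R by apply: lt_trans alpha2; rewrite ltr1n.
have al2 : (1 < alpha - 1)%R by rewrite ltrBrDl.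
have F (t : R) : (1 < t)%R -> gamma_int t b = (b `^ (- t) * gamma_fun t)%:E.
  by move=> t1; rewrite gamma_int_scale// gamma_intE.
by rewrite (F _ al1) (F _ al2) -EFinD -EFinM ltry.
Qed.

Let mcst : measurable_fun setT (cst 1 : n.+1.-tuple RT -> \bar R).
Proof. exact: measurable_cst. Qed.

Lemma posterior_massT :
  posterior_mass U a b y setT = \int[mu]_(B in D) (B_weight U a b y B)%:E.
Proof.
transitivity (\int[posterior_mass U a b y]_z (cst 1 z)).
  by rewrite integral_cst// mul1e.
rewrite [LHS](@integral_posterior_mass_eta R n r U a b y U0 n0 r0 _ mcst (fun=> lee01)).
by apply: eq_integral => B _; rewrite /eta_mean integral_gauss_cst mule1.
Qed.

Let B_weight_ge0 B : (D : set R) B -> 0 <= (B_weight U a b y B)%:E.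
Proof.
by rewrite /= in_itv/= andbT => B0; rewrite lee_fin ltW// B_weight_gt0.
Qed.

Let mBw : measurable_fun D (fun B => (B_weight U a b y B)%:E).
Proof. by apply: measurable_funTS; apply/measurable_EFinP; exact: measurable_B_weight. Qed.

Let mspread : measurable_fun setT (fun x : n.+1.-tuple RT => (spread b x)%:E).
Proof. by apply/measurable_EFinP; exact: measurable_spread. Qed.

Let spread0 (x : n.+1.-tuple RT) : 0 <= (spread b x)%:E.
Proof. by rewrite lee_fin spread_ge0. Qed.

Lemma posterior_mass_lty : posterior_mass U a b y setT < +oo.
Proof.
rewrite posterior_massT; apply: le_lt_trans posterior_moment_lty.
apply: ge0_le_integral; [by []|exact: B_weight_ge0|exact: mBw| |].
  apply: emeasurable_funM => //; apply: measurable_funTS; apply: emeasurable_funD => //.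
  exact: measurable_eta_mean.
move=> B DB; rewrite -[leLHS]mule1; apply: lee_wpmul2l; first exact: B_weight_ge0.
by rewrite leeDl// eta_mean_ge0.
Qed.

Lemma posterior_mass_neq0 : posterior_mass U a b y setT != 0.
Proof.
rewrite posterior_massT; apply/negP => /eqP I0.
have : \int[mu]_(B in D) `|(B_weight U a b y B)%:E| = 0.
  by rewrite -[RHS]I0; apply: eq_integral => B /set_mem DB; rewrite gee0_abs// B_weight_ge0.
move/(ae_eq_integral_abs mu _ mBw) => /(_ ltac:(by [])) ae0.
have muD : lebesgue_measure (`]0%R, +oo[%classic : set R) = +oo.
  by rewrite lebesgue_measure_itv/= ltry.
have ND : mu.-negligible D.
  apply: negligibleS ae0 => B DB /= /(_ DB) /eqP.
  rewrite eqe gt_eqF// B_weight_gt0//.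
  by move: DB; rewrite /= in_itv/= andbT.
have : mu D = 0 by apply: measure_negligible.
by rewrite [LHS]muD.
Qed.

Lemma integral_eta_posterior (f : n.+1.-tuple RT -> \bar R) :
  measurable_fun setT f -> (forall z, 0 <= f z) ->
  \int[eta_posterior U a b y]_x f x =
  (fine (posterior_mass U a b y setT))^-1%:E * \int[posterior_mass U a b y]_z f z.1.
Proof.
move=> mf f0.
have mf1 : measurable_fun setT (fun z : n.+1.-tuple RT * RT => f z.1).
  exact: (measurableT_comp mf measurable_fst).
rewrite [LHS]ge0_integral_distribution//.
exact: (ge0_integral_mnormalize _ posterior_mass_neq0 posterior_mass_lty mf1 (fun z => f0 z.1)).
Qed.

Lemma eta_posterior_spread_lty :
  \int[eta_posterior U a b y]_x (spread b x)%:E < +oo.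
Proof.
rewrite (integral_eta_posterior mspread spread0).
rewrite [X in _ * X](@integral_posterior_mass_eta R n r U a b y U0 n0 r0 _ mspread spread0).
apply: lte_mul_pinfty => //.
  by rewrite lee_fin invr_ge0 fine_ge0.
apply: le_lt_trans posterior_moment_lty.
have mE : measurable_fun setT (eta_mean U y (fun x => (spread b x)%:E)).
  exact: measurable_eta_mean.
apply: ge0_le_integral; [by []| | | |].
- by move=> B DB; apply: mule_ge0; [exact: B_weight_ge0|exact: eta_mean_ge0].
- by apply: emeasurable_funM => //; exact: measurable_funTS.
- apply: emeasurable_funM => //; apply: measurable_funTS; exact: emeasurable_funD.
move=> B DB; apply: lee_wpmul2l; first exact: B_weight_ge0.
by rewrite leeDr.
Qed.

Lemma eta_posterior_stationary (f : n.+1.-tuple RT -> \bar R) :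
  measurable_fun setT f -> (forall z, 0 <= f z) ->
  \int[eta_posterior U a b y]_x \int[eta_kernel U a b y x]_z f z =
  \int[eta_posterior U a b y]_x f x.
Proof.
move=> mf f0.
have mK : measurable_fun setT (fun x => \int[eta_kernel U a b y x]_x' f x').
  by apply: measurable_fun_integral_kernel => // A mA; exact: measurable_kernel.
have K0 x : 0 <= \int[eta_kernel U a b y x]_x' f x' by exact: integral_ge0.
rewrite [LHS](integral_eta_posterior mK K0) [RHS](integral_eta_posterior mf f0).
congr (_ * _).
exact: integral_posterior_mass_stationary.
Qed.

Lemma contraction_bound_gt0 : (0 < contraction_bound U a b y)%R.
Proof.
have al2 := alpha2; have rr : (0 < r%:R :> R)%R by rewrite ltr0n.
have sa : (0 < Num.sqrt alpha)%R by rewrite sqrtr_gt0 (lt_trans _ al2).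
have t0 : (0 < tau)%R by rewrite sqrtr_gt0 mulr_gt0.
apply: ltr_wpDl.
  apply: mulr_ge0; last by apply: mulr_ge0 => //; lra.
  apply: addr_ge0; (apply: mulr_ge0; last exact: sqrtr_ge0);
    by apply: ltW; rewrite divr_gt0 ?mulr_gt0.
have d0 : (0 < alpha - 2)%R by rewrite subr_gt0.
by apply: mulr_gt0 => //; apply: addr_gt0; [rewrite mulr_gt0// divr_gt0|rewrite invr_gt0].
Qed.

Lemma eta_geometric_rate_le : (contraction_bound U a b y <= 1)%R ->
  (0 <= eta_geometric_rate U a b y <= contraction_bound U a b y)%R.
Proof.
move=> c1; apply: (@geometric_rate_le _ _ _ _ _ (spread b) (2 * alpha / tau)) => //.
- exact: measurable_spread.
- have al2 := alpha2.
  by apply: divr_ge0; [lra|exact: sqrtr_ge0].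
- exact: contraction_bound_gt0.
- exact: eta_posterior_stationary.
- by move=> f mf f01 x x'; exact: eta_kernel_smoothing.
- by move=> f l l0 mf f0 fl x x'; exact: eta_kernel_contracting.
- exact: eta_posterior_spread_lty.
Qed.
End fixed_n.

(** * The limit *)

(** With rho = r U, between = O(n) and alpha of order n, the terms of [slope] and
    [noise] are O(n^(3/2) / r) and the term of eta_0 is O(n^(-1/2)). *)
Lemma contraction_bound_le (R : realType) (n r : nat) (U a b C : R) (y : 'M[R]_(n, r)) :
  0 < U -> 0 < a -> 0 < b -> (0 < n)%N -> (0 < r)%N -> 4 <= a + n%:R / 2 ->
  between y <= C * n%:R ->
  contraction_bound U a b y <=
    2 * (a + 2) * (4 * Num.sqrt C / (U * Num.sqrt (2 * b) ^+ 3)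
      + 7 / (U * Num.sqrt U * Num.sqrt (2 * b) ^+ 3))
      * Num.sqrt (r%:R ^+ 2 / n%:R ^+ 3)^-1
    + 105 / 2 * Num.sqrt n%:R^-1.
Proof.
move=> U0 a0 b0 n0 r0 al4 hC; rewrite /contraction_bound.
set alpha := a + n%:R / 2 in al4 *; set tau := Num.sqrt (2 * b).
have t0 : 0 < tau by rewrite sqrtr_gt0 mulr_gt0.
have nn : 1 <= n%:R :> R by rewrite ler1n.
have np : 0 < n%:R :> R by rewrite ltr0n.
have rr : 1 <= r%:R :> R by rewrite ler1n.
have rp : 0 < r%:R :> R by rewrite ltr0n.
have su : 0 < Num.sqrt U by rewrite sqrtr_gt0.
have D0 : 0 <= between y by apply: sumr_ge0 => i _; exact: sqr_ge0.
have sE : Num.sqrt (r%:R ^+ 2 / n%:R ^+ 3)^-1 = n%:R * (Num.sqrt n%:R / r%:R) :> R.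
  rewrite invf_div; have -> : n%:R ^+ 3 / r%:R ^+ 2 = (n%:R / r%:R) ^+ 2 * n%:R :> R.
    by field; rewrite gt_eqF.
  by rewrite sqrtrM ?sqr_ge0// sqrtr_sqr ger0_norm ?divr_ge0// mulrAC -mulrA.
have s0 : 0 < Num.sqrt n%:R :> R by rewrite sqrtr_gt0.
set s := Num.sqrt n%:R in sE s0 *.
have sr : Num.sqrt U <= Num.sqrt (r%:R * U) by rewrite ler_wsqrtr// ler_peMl// ltW.
have sD : Num.sqrt (between y) <= Num.sqrt C * s.
  rewrite -sqrtrM; first by rewrite ler_wsqrtr.
  by rewrite -(pmulr_lge0 _ np); exact: le_trans hC.
apply: lerD.
  rewrite sE.
  set K := 4 * Num.sqrt C / _ + _.
  have -> : 2 * (a + 2) * K * (n%:R * (s / r%:R)) =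
    (K * (s / r%:R)) * (2 * ((a + 2) * n%:R)) by ring.
  have K1 : 4 / (r%:R * U * tau ^+ 3) * Num.sqrt (between y) <=
      4 * Num.sqrt C / (U * tau ^+ 3) * (s / r%:R).
    have -> : 4 * Num.sqrt C / (U * tau ^+ 3) * (s / r%:R) =
        4 / (r%:R * U * tau ^+ 3) * (Num.sqrt C * s) by field; rewrite !gt_eqF.
    by apply: ler_wpM2l => //; apply: ltW; rewrite divr_gt0 ?mulr_gt0.
  have K2 : 7 / (r%:R * U * Num.sqrt (r%:R * U) * tau ^+ 3) * s <=
      7 / (U * Num.sqrt U * tau ^+ 3) * (s / r%:R).
    have -> : 7 / (U * Num.sqrt U * tau ^+ 3) * (s / r%:R) =
        7 / (r%:R * U * Num.sqrt U * tau ^+ 3) * s by field; rewrite !gt_eqF.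
    have su' : 0 < Num.sqrt (r%:R * U) by exact: lt_le_trans sr.
    apply: ler_wpM2r; first exact: ltW.
    rewrite ler_pM2l// lef_pV2 ?posrE ?mulr_gt0//.
    apply: ler_wpM2r; first by apply: ltW; rewrite exprn_gt0.
    by apply: ler_wpM2l => //; apply: ltW; rewrite mulr_gt0.
  apply: ler_pM.
  - have su' : 0 < Num.sqrt (r%:R * U) by exact: lt_le_trans sr.
    by apply: addr_ge0; (apply: mulr_ge0; last by rewrite ?sqrtr_ge0 ?(ltW s0));
      apply: ltW; rewrite divr_gt0 ?mulr_gt0.
  - by apply: mulr_ge0 => //; lra.
  - by rewrite [leRHS]mulrDl; exact: lerD.
  - rewrite ler_pM2l// /alpha [leRHS]mulrDl; have := ler_wpM2l (ltW a0) nn; lra.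
have al0 : 0 < alpha by lra.
have sa : 0 < Num.sqrt alpha by rewrite sqrtr_gt0.
have ss : Num.sqrt alpha ^+ 2 = alpha by rewrite sqr_sqrtr// ltW.
have e1 : 2 / (alpha - 2) <= 4 / alpha.
  have d0 : 0 < alpha - 2 by lra.
  by rewrite ler_pdivrMr// mulrAC ler_pdivlMr//; lra.
have e2 : Num.sqrt alpha * (2 / (alpha - 2)) <= 4 * (Num.sqrt alpha)^-1.
  apply: (le_trans (ler_wpM2l (ltW sa) e1)).
  by rewrite -{2}ss le_eqVlt; apply/orP; left; apply/eqP; field; rewrite gt_eqF.
have e3 : (Num.sqrt alpha)^-1 <= 2 * Num.sqrt n%:R^-1.
  have -> : 2 = Num.sqrt (2 ^+ 2) :> R by rewrite sqrtr_sqr ger0_norm.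
  rewrite -sqrtrV ?(ltW al0)// -sqrtrM ?sqr_ge0// ler_wsqrtr//.
  rewrite -[leLHS]mul1r ler_pdivrMr// mulrAC ler_pdivlMr// mul1r expr2 /alpha; lra.
have p0 : 0 <= Num.sqrt n%:R^-1 :> R by exact: sqrtr_ge0.
lra.
Qed.

Theorem proposition6 (R : realType) (U a b : R)
    (hU : 0 < U) (ha : 0 < a) (hb : 0 < b)
    (r : nat -> nat) (hr : forall n, (0 < n)%N -> (0 < r n)%N)
    (y : forall n, 'M[R]_(n, r n))
    (A1 : ((r n)%:R ^+ 2 / n%:R ^+ 3 : R) @[n --> \oo] --> +oo)
    (A2 : exists C : R, \forall n \near \oo,
      n%:R^-1 * (\sum_(i < n) (row_mean (y n) i - grand_mean (y n)) ^+ 2) < C) :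
  eta_geometric_rate U a b (y n) @[n --> \oo] --> (0 : R).
Proof.
case: A2 => C A2.
pose K := 2 * (a + 2) * (4 * Num.sqrt C / (U * Num.sqrt (2 * b) ^+ 3)
      + 7 / (U * Num.sqrt U * Num.sqrt (2 * b) ^+ 3)).
pose v n : R := K * Num.sqrt ((r n)%:R ^+ 2 / n%:R ^+ 3)^-1
    + 105 / 2 * Num.sqrt n%:R^-1.
have sqrt_cvg0 (f : nat -> R) : f n @[n --> \oo] --> +oo ->
    Num.sqrt (f n)^-1 @[n --> \oo] --> (0 : R).
  move=> foo; rewrite -(sqrtr0 R).
  apply: (@cvg_comp _ _ _ (fun n => (f n)^-1) Num.sqrt); last exact: sqrt_continuous.
  apply/gtr0_cvgV0 => //.
  by move/cvgryPgt : foo; apply.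
have v0 : v n @[n --> \oo] --> (0 : R).
  rewrite -(addr0 0) -[X in X + _](mulr0 K) -[X in _ + X](mulr0 (105 / 2)).
  apply: cvgD; apply: cvgM; [exact: cvg_cst| |exact: cvg_cst|]; apply: sqrt_cvg0.
    exact: A1.
  exact: cvgr_idn.
have v1 : \forall n \near \oo, v n <= 1.
  have := v0; move/cvgr0_norm_le => /(_ 1 ltr01); apply: filterS => n.
  exact: le_trans (ler_norm _).
apply: (@squeeze_cvgr _ _ _ _ (fun=> 0) v); [|exact: cvg_cst|exact: v0].
near=> n.
have n0 : (0 < n)%N by near: n; exact: nbhs_infty_gt.
have np : 0 < n%:R :> R by rewrite ltr0n.
have al4 : 4 <= a + n%:R / 2.
  have : 8 <= n%:R :> R by near: n; exact: nbhs_infty_ger.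
  have := ha; lra.
have hC : between (y n) <= C * n%:R.
  rewrite -ler_pdivrMr// mulrC ltW//; near: n; exact: A2.
have Bv : contraction_bound U a b (y n) <= v n.
  exact: contraction_bound_le (hr _ n0) al4 hC.
have B1 : contraction_bound U a b (y n) <= 1.
  by apply: (le_trans Bv); near: n; exact: v1.
have al2 : 2 < a + n%:R / 2 by lra.
have /andP[-> h] := eta_geometric_rate_le hU hb n0 (hr _ n0) al2 B1.
exact: le_trans Bv.
Unshelve. all: by end_near. Qed.
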